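(* Let $n\ge 2$, let $\Omega\subset\mathbb{R}^n$ be a bounded open set, $T>0$, $\Omega_T=\Omega\times(0,T)$, $2\le p<q<\infty$, $\alpha\in(0,1]$, and let $0\le a\in C^{\alpha,\frac{\alpha}{2}}(\Omega_T)$. Let $\mathcal{P}(w,B\times I)=\int_I\int_{B}\left[|Dw(x,t)|^p+a(x,t)|Dw(x,t)|^q\right]dx\,dt$ for cylinders $B\times I\subset\Omega_T$. Then the following hold. (i) If $$q\le p+\frac{p\alpha}{n+2},$$ then for every function $w\in L^p_{\mathrm{loc}}(0,T;W^{1,p}_{\mathrm{loc}}(\Omega))$ and all cylinders $Q=B\times I$ and $\tilde Q$ with $Q\subset\subset\tilde Q\subset\subset\Omega_T$ and $\mathcal{P}(w,\tilde Q)<\infty$, there exists a sequence $\{w_m\}_{m=1}^\infty$ of $C^\infty$-functions on $Q$ such that $$w_m\to w\ \text{ in } L^p(I;W^{1,p}(B))\quad\text{and}\quad \mathcal{P}(w_m,Q)\to\mathcal{P}(w,Q).$$ (ii) If $$q\le p+\max\left\{\frac{p\alpha}{n+2},\alpha\right\},$$ then for every function $w\in L^\infty_{\mathrm{loc}}(\Omega_T)\cap L^p_{\mathrm{loc}}(0,T;W^{1,p}_{\mathrm{loc}}(\Omega))$ and all cylinders $Q=B\times I$ and $\tilde Q$ with $Q\subset\subset\tilde Q\subset\subset\Omega_T$ and $\mathcal{P}(w,\tilde Q)<\infty$, there exists a sequence $\{w_m\}_{m=1}^\infty$ of $C^\infty$-functions on $Q$ such that $$w_m\to w\ \text{ in }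 L^p(I;W^{1,p}(B))\quad\text{and}\quad \mathcal{P}(w_m,Q)\to\mathcal{P}(w,Q).$$ (iii) Let $s\ge 2$. If $$q\le p+\max\left\{\frac{s\alpha}{n+s},\frac{p\alpha}{n+2}\right\},$$ then for every function $w\in C_{\mathrm{loc}}(0,T;L^s_{\mathrm{loc}}(\Omega))\cap L^p_{\mathrm{loc}}(0,T;W^{1,p}_{\mathrm{loc}}(\Omega))$ and all cylinders $Q=B\times I$ and $\tilde Q$ with $Q\subset\subset\tilde Q\subset\subset\Omega_T$ and $\mathcal{P}(w,\tilde Q)<\infty$, there exists a sequence $\{w_m\}_{m=1}^\infty$ of $C^\infty$-functions on $Q$ such that $$w_m\to w\ \text{ in } L^p(I;W^{1,p}(B))\quad\text{and}\quad \mathcal{P}(w_m,Q)\to\mathcal{P}(w,Q).$$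
   Context: Functions are real-valued; $D$ denotes the (weak) gradient with respect to the spatial variable $x$ only. A cylinder is a set $Q=B\times I$ where $B$ is a ball in $\mathbb{R}^n$ and $I$ is an interval in $\mathbb{R}$ (likewise $\tilde Q=\tilde B\times\tilde I$). $A\subset\subset A'$ means that the closure of $A$ is compact and contained in the interior of $A'$. $a\in C^{\alpha,\frac{\alpha}{2}}(\Omega_T)$ means that $a\in L^\infty(\Omega_T)$ and there is a constant $[a]_\alpha>0$ with $|a(x_1,t_1)-a(x_2,t_2)|\le [a]_\alpha\max\{|x_1-x_2|^\alpha,|t_1-t_2|^{\frac{\alpha}{2}}\}$ for all $x_1,x_2\in\Omega$ and $t_1,t_2\in(0,T)$. The subscript ''loc'' in time and space means that the property holds on compactly contained subsets: $w\in L^p_{\mathrm{loc}}(0,T;W^{1,p}_{\mathrm{loc}}(\Omega))$ means $w\in L^p(J;W^{1,p}(\Omega'))$ for all intervals $J\subset\subset(0,T)$ and open $\Omega'\subset\subset\Omega$, and $w\in C_{\mathrm{loc}}(0,T;L^s_{\mathrm{loc}}(\Omega))$ means that $t\mapsto w(\cdot,t)$ is continuous from $J$ into $L^s(\Omega')$ (with respect to the $L^s(\Omega')$-norm) for all compact intervals $J\subset(0,T)$ and open $\Omega'\subset\subset\Omega$. The norm on $L^p(I;W^{1,p}(B))$ is given by $\|w\|^p=\int_I\int_B(|w|^p+|Dw|^p)\,dx\,dt$. *)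

(* Defs.v *)
From HB Require Import structures.
From mathcomp Require Import all_boot all_order all_algebra.
From mathcomp Require Import all_classical all_reals all_analysis.

Set Implicit Arguments.
Unset Strict Implicit.
Unset Printing Implicit Defensive.

Import Order.TTheory GRing.Theory Num.Theory.
Import numFieldNormedType.Exports.

Local Open Scope classical_set_scope.
Local Open Scope ring_scope.

(* Points of R^n are row vectors 'rV[R]_n and points of space-time are pairs
   (x, t) : 'rV[R]_n * R.  The library norm on 'rV[R]_n is the sup norm; it is
   used only through the topology and differentiability, which do not depend
   on the choice of norm.  All metric quantities use the Euclidean [enorm]. *)

Definition measure_rV_display : measure_display.
Proof. exact: default_measure_display. Qed.

Section measurable_rV.
Context {R : realType} (n : nat).

Let coors : 'I_n -> 'rV[R]_n -> R := fun i x => x ord0 i.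

Let rV_set0 : g_sigma_preimage coors set0.
Proof. exact: sigma_algebra0. Qed.

Let rV_setC A : g_sigma_preimage coors A -> g_sigma_preimage coors (~` A).
Proof. exact: sigma_algebraC. Qed.

Let rV_bigcup (F : _^nat) : (forall i, g_sigma_preimage coors (F i)) ->
  g_sigma_preimage coors (\bigcup_i (F i)).
Proof. exact: sigma_algebra_bigcup. Qed.

(* The Borel sigma-algebra of R^n, generated by the coordinates. *)
HB.instance Definition _ := @isMeasurable.Build measure_rV_display
  'rV[R]_n (g_sigma_preimage coors) rV_set0 rV_setC rV_bigcup.

Lemma measurable_coord (i : 'I_n) :
  measurable_fun [set: 'rV[R]_n] (fun x : 'rV[R]_n => x ord0 i).
Proof.
move=> _ Y mY; rewrite setTI; apply: sub_sigma_algebra => /=.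
rewrite -bigcup_seq/=; exists i => /=; first by rewrite mem_index_enum.
by exists Y => //; rewrite setTI.
Qed.

Lemma measurable_fun_rVP d (T : measurableType d) (f : T -> 'rV[R]_n) :
  measurable_fun [set: T] f <->
  forall i, measurable_fun [set: T] (fun y => f y ord0 i).
Proof.
split=> [mf i|mf].
  exact: (measurableT_comp (measurable_coord i) mf).
move=> _ A mA; rewrite setTI.
suff : g_sigma_preimage coors `<=` [set A | measurable (f @^-1` A)] by exact.
apply: smallest_sub => /=.
  split => /=; first by rewrite preimage_set0.
    by move=> B mB; rewrite setTD preimage_setC; exact: measurableC.
  by move=> F mF; rewrite preimage_bigcup; exact: bigcup_measurable.
rewrite -bigcup_seq/=; apply: bigcup_sub => i _ _ [B mB <-] /=.
by have := mf i measurableT B mB; rewrite !setTI.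
Qed.

End measurable_rV.

(* The library instance of this fact for product_measure1 is shadowed by the
   one for products of subprobabilities and cannot be inferred. *)
Lemma product_sigma_finite d1 d2 (T1 : measurableType d1)
    (T2 : measurableType d2) (R : realType)
    (m1 : {sigma_finite_measure set T1 -> \bar R})
    (m2 : {sigma_finite_measure set T2 -> \bar R}) :
  sigma_finite setT (m1 \x m2)%E.
Proof.
have /sigma_finiteP[F [TF ndF Foo]] := sigma_finiteT m1.
have /sigma_finiteP[G [TG ndG Goo]] := sigma_finiteT m2.
exists (fun n => F n `*` G n).
  rewrite -setXTT TF TG predeqE => -[x y]; split.
    move=> [/= [n _ Fnx] [k _ Gky]]; exists (maxn n k) => //; split.
    - by move: x Fnx; exact/subsetPset/ndF/leq_maxl.
    - by move: y Gky; exact/subsetPset/ndG/leq_maxr.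
  by move=> [n _ []/= ? ?]; split; exists n.
move=> k; have [? ?] := Foo k; have [? ?] := Goo k.
split; first exact: measurableX.
by rewrite product_measure1E// lte_mul_pinfty// ge0_fin_numE.
Qed.

Section lebesgue_rV.
Context {R : realType}.

Let T1 := measurableTypeR R.

Definition cons_rV n (z : T1 * 'rV[R]_n) : 'rV[R]_n.+1 :=
  row_mx (const_mx z.1 : 'rV[R]_1) z.2.

Definition uncons_rV n (x : 'rV[R]_n.+1) : T1 * 'rV[R]_n :=
  (x ord0 ord0, rsubmx (x : 'rV[R]_(1 + n))).

Lemma uncons_rVK n : cancel (@uncons_rV n) (@cons_rV n).
Proof.
move=> x; rewrite /cons_rV /uncons_rV /=.
suff -> : const_mx (x ord0 ord0) = @lsubmx _ 1 1 n x by exact: (@hsubmxK _ 1 1 n x).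
apply/rowP => i; rewrite !mxE; congr (x _ _).
by apply/val_inj; rewrite /= (ord1 i).
Qed.

Lemma cons_rV0 n (z : T1 * 'rV[R]_n) : cons_rV z ord0 ord0 = z.1.
Proof.
rewrite (_ : (ord0 : 'I_n.+1) = @lshift 1 n ord0); last exact/val_inj.
by rewrite /cons_rV (@row_mxEl _ _ 1 n) mxE.
Qed.

Lemma cons_rV_lift n (z : T1 * 'rV[R]_n) i :
  cons_rV z ord0 (lift ord0 i) = z.2 ord0 i.
Proof.
rewrite (_ : lift ord0 i = @rshift 1 n i); last exact/val_inj.
by rewrite /cons_rV (@row_mxEr _ _ 1 n).
Qed.

Lemma cons_rVK n : cancel (@cons_rV n) (@uncons_rV n).
Proof.
by move=> [t x]; rewrite /uncons_rV cons_rV0 /cons_rV row_mxKr.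
Qed.

Lemma measurable_cons_rV n : measurable_fun setT (@cons_rV n).
Proof.
apply/measurable_fun_rVP => i; have [j ->|->] := unliftP ord0 i.
- under eq_fun do rewrite cons_rV_lift.
  exact: (measurableT_comp (measurable_coord j) measurable_snd).
- under eq_fun do rewrite cons_rV0.
  exact: measurable_fst.
Qed.

Lemma measurable_uncons_rV n : measurable_fun setT (@uncons_rV n).
Proof.
apply/measurable_fun_pairP; split; first exact: measurable_coord.
apply/measurable_fun_rVP => i.
rewrite (_ : (fun _ => _) = fun x : 'rV[R]_n.+1 => x ord0 (@rshift 1 n i)).
  exact: measurable_coord.
by apply/funext => x; rewrite /= mxE.
Qed.

Section step.
Variables (n : nat) (mu : {sigma_finite_measure set 'rV[R]_n -> \bar R}).

Definition lebesgue_cons : set 'rV[R]_n.+1 -> \bar R :=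
  pushforward (lebesgue_measure \x mu)%E (@cons_rV n).

Let lebesgue_cons0 : lebesgue_cons set0 = 0%E.
Proof. by rewrite /lebesgue_cons /pushforward preimage_set0 measure0. Qed.

Let lebesgue_cons_ge0 A : (0 <= lebesgue_cons A)%E.
Proof. by rewrite /lebesgue_cons /pushforward measure_ge0. Qed.

Let lebesgue_cons_semi_sigma_additive : semi_sigma_additive lebesgue_cons.
Proof.
move=> F mF tF mUF; rewrite /lebesgue_cons /pushforward preimage_bigcup.
apply: measure_semi_sigma_additive.
- by move=> k; rewrite -[X in measurable X]setTI; exact: measurable_cons_rV.
- apply/trivIsetP => /= i j _ _ ij; rewrite -preimage_setI.
  by move/trivIsetP : tF => /(_ _ _ _ _ ij) ->//; rewrite preimage_set0.
- rewrite -preimage_bigcup -[X in measurable X]setTI.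
  exact: measurable_cons_rV.
Qed.

HB.instance Definition _ := isMeasure.Build _ _ _ lebesgue_cons
  lebesgue_cons0 lebesgue_cons_ge0 lebesgue_cons_semi_sigma_additive.

Let lebesgue_cons_sigma_finite : sigma_finite setT lebesgue_cons.
Proof.
have [F UF mF] := product_sigma_finite (@lebesgue_measure R) mu.
exists (fun k => @uncons_rV n @^-1` F k).
  by rewrite -preimage_bigcup -UF preimage_setT.
move=> k; have [mFk Fkoo] := mF k; split.
  by rewrite -[X in measurable X]setTI; exact: measurable_uncons_rV.
rewrite /lebesgue_cons /pushforward -comp_preimage.
by rewrite (_ : _ \o _ = id) ?preimage_id//; apply/funext/cons_rVK.
Qed.

HB.instance Definition _ := Measure_isSigmaFinite.Build _ _ _
  lebesgue_cons lebesgue_cons_sigma_finite.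

End step.

(* n-dimensional Lebesgue measure on the Borel sets, as the n-fold product of
   [lebesgue_measure]; see [lebesgue_rV_box]. *)
Fixpoint lebesgue_rV n : {sigma_finite_measure set 'rV[R]_n -> \bar R} :=
  match n with
  | 0 => [the {sigma_finite_measure set 'rV[R]_0 -> \bar R}
           of \d_(0 : 'rV[R]_0)]
  | m.+1 => [the {sigma_finite_measure set 'rV[R]_m.+1 -> \bar R}
              of lebesgue_cons (lebesgue_rV m)]
  end.

Lemma measurable_box n (A : 'I_n -> set R) : (forall i, measurable (A i)) ->
  measurable [set x : 'rV[R]_n | forall i, A i (x ord0 i)].
Proof.
move=> mA.
rewrite (_ : [set _ | _] =
    \bigcap_(i in [set: 'I_n]) ((fun x : 'rV[R]_n => x ord0 i) @^-1` A i)).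
  apply: fin_bigcap_measurable; first exact: (@finite_finset 'I_n).
  move=> i _.
  by rewrite -[X in measurable X]setTI; exact: measurable_coord.
by apply/seteqP; split => [x Ax i _|x Ax i]; exact: Ax.
Qed.

Lemma lebesgue_rV_box n (A : 'I_n -> set R) : (forall i, measurable (A i)) ->
  lebesgue_rV n [set x : 'rV[R]_n | forall i, A i (x ord0 i)] =
  (\prod_(i < n) lebesgue_measure (A i))%E.
Proof.
elim: n A => [|n IH] A mA.
  by rewrite big_ord0 /= diracE mem_set//; case.
rewrite big_ord_recl /= -(IH _ (fun i => mA (lift ord0 i))) /lebesgue_cons /pushforward.
rewrite -product_measure1E; last first.
- exact: (measurable_box (fun i => mA (lift ord0 i))).
- exact: (mA ord0).
congr (product_measure1 _ _ _); apply/seteqP; split => [[t x]|[t x]] /=.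
- move=> Atx; split => [|i]; first by have := Atx ord0; rewrite cons_rV0.
  by have := Atx (lift ord0 i); rewrite cons_rV_lift.
- move=> [At Ax] i; have [j ->|->] := unliftP ord0 i.
    by rewrite cons_rV_lift; exact: Ax.
  by rewrite cons_rV0.
Qed.

End lebesgue_rV.

Definition cpt_contained {T : topologicalType} (A B : set T) : Prop :=
  compact (closure A) /\ closure A `<=` B°.

Section smooth.
Context {R : realType} {V : normedModType R}.

Fixpoint iter_derive (vs : seq V) (f : V -> R) : V -> R :=
  if vs is v :: vs' then 'D_v (iter_derive vs' f) else f.

(* C^oo on an open set U of a finite-dimensional space *)
Definition smooth_on_open (U : set V) (f : V -> R) : Prop :=
  forall (vs : seq V) (x : V), U x -> differentiable (iter_derive vs f) x.

(* C^oo on an arbitrary set Q (the time interval of a cylinder need not be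
   open): f coincides on Q with a function that is smooth on a neighbourhood
   of Q.  If Q is open, this amounts to [smooth_on_open Q f]. *)
Definition smooth_on (Q : set V) (f : V -> R) : Prop :=
  exists (U : set V) (g : V -> R),
    [/\ open U, Q `<=` U, smooth_on_open U g & {in Q, g =1 f}].

Definition test_function (U : set V) (phi : V -> R) : Prop :=
  let supp := closure [set x | phi x != 0] in
  [/\ smooth_on_open setT phi, compact supp & supp `<=` U].

End smooth.

Section spaces.
Context {R : realType} {n : nat}.
Implicit Types (U B Om : set 'rV[R]_n) (I J : set R) (p q s T alpha : R).
Implicit Types (w : 'rV[R]_n * R -> R) (G : 'rV[R]_n * R -> 'rV[R]_n).

Definition enorm (x : 'rV[R]_n) : R := Num.sqrt (\sum_(i < n) x ord0 i ^+ 2).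

(* open balls of positive radius *)
Definition is_euclidean_ball B : Prop :=
  exists (c : 'rV[R]_n) (r : R), 0 < r /\ B = [set x | enorm (x - c) < r].

Definition loc_integrable U (f : 'rV[R]_n -> R) : Prop :=
  forall K, compact K -> K `<=` U ->
    (lebesgue_rV n).-integrable K (EFin \o f).

Definition weak_gradient U (u : 'rV[R]_n -> R) (g : 'rV[R]_n -> 'rV[R]_n) :
    Prop :=
  [/\ loc_integrable U u,
      forall i, loc_integrable U (fun x => g x ord0 i) &
      forall (phi : 'rV[R]_n -> R) (i : 'I_n), test_function U phi ->
        \int[lebesgue_rV n]_(x in U) (u x * 'D_(delta_mx ord0 i) phi x) =
        - \int[lebesgue_rV n]_(x in U) (g x ord0 i * phi x)].

(* G is a (jointly measurable) weak gradient of w in the space variable on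
   U x J: for a.e. t in J, G(., t) is the weak gradient of w(., t) on U. *)
Definition spatial_gradient U J w G : Prop :=
  measurable_fun (U `*` J) G /\
  \forall t \ae lebesgue_measure,
    J t -> weak_gradient U (fun x => w (x, t)) (fun x => G (x, t)).

(* A chosen spatial weak gradient of w on U x J.  It is unique up to a null
   set when it exists; otherwise the value is junk, and this is used only for
   w known to have a gradient. *)
Definition Dx U J w : 'rV[R]_n * R -> 'rV[R]_n :=
  xget (fun=> 0) [set G | spatial_gradient U J w G].

Definition LpW1p_norm p U J w : \bar R :=
  ((\int[lebesgue_measure]_(t in J) \int[lebesgue_rV n]_(x in U)
     (`|w (x, t)| `^ p + enorm (Dx U J w (x, t)) `^ p)%:E) `^ p^-1)%E.

(* w is in L^p(J; W^{1,p}(U)).  Joint measurability of w and of its gradient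
   stands for Bochner measurability of t |-> w(., t); as elements of
   L^p(J; W^{1,p}(U)) are classes modulo a.e. equality, there is no loss in
   considering Borel representatives. *)
Definition LpW1p p U J w : Prop :=
  [/\ measurable_fun (U `*` J) w,
      exists G, spatial_gradient U J w G &
      (LpW1p_norm p U J w < +oo)%E].

Definition LpW1p_loc p Om T w : Prop :=
  forall J U, is_interval J -> cpt_contained J `]0, T[ ->
    open U -> cpt_contained U Om -> LpW1p p U J w.

(* L^oo(Q), for a Borel set Q of R^n x R *)
Definition Linfty (Q : set ('rV[R]_n * R)) w : Prop :=
  w \_ Q \in Lfun (lebesgue_rV n \x lebesgue_measure)%E +oo%E.

Definition Linfty_loc (Q : set ('rV[R]_n * R)) w : Prop :=
  forall K, open K -> cpt_contained K Q -> Linfty K w.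

Definition CLs_loc s Om T w : Prop :=
  forall J U, is_interval J -> compact J -> J `<=` `]0, T[ ->
    open U -> cpt_contained U Om ->
    (forall t, J t ->
      (fun x => w (x, t)) \_ U \in Lfun (lebesgue_rV n) s%:E) /\
    (forall t0, J t0 ->
      ('N[lebesgue_rV n]_(s%:E)
         [EFin \o ((fun x => w (x, t) - w (x, t0))%R \_ U)])%E
      @[t --> within J (nbhs t0)] --> 0%E).

(* C^{alpha, alpha/2}(Om x (0, T)) *)
Definition parabolic_holder alpha Om T (a : 'rV[R]_n * R -> R) : Prop :=
  Linfty (Om `*` `]0, T[) a /\
  exists c : R, 0 < c /\
    forall (x1 x2 : 'rV[R]_n) (t1 t2 : R),
      Om x1 -> Om x2 -> t1 \in `]0, T[ -> t2 \in `]0, T[ ->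
      `|a (x1, t1) - a (x2, t2)| <=
      c * Num.max (enorm (x1 - x2) `^ alpha) (`|t1 - t2| `^ (alpha / 2)).

Definition energy p q (a : 'rV[R]_n * R -> R) B I w : \bar R :=
  (\int[lebesgue_measure]_(t in I) \int[lebesgue_rV n]_(x in B)
    (enorm (Dx B I w (x, t)) `^ p +
     a (x, t) * enorm (Dx B I w (x, t)) `^ q)%:E)%E.

(* The common conclusion: on all cylinders B x I cc B' x I' cc Om x (0, T)
   with P(w, B' x I') finite, w is approximable by smooth functions in
   L^p(I; W^{1,p}(B)) with convergence of the energies. *)
Definition smoothly_approximable Om T p q (a : 'rV[R]_n * R -> R) w : Prop :=
  forall B I B' I',
    is_euclidean_ball B -> is_interval I -> is_euclidean_ball B' -> is_interval I' ->
    cpt_contained (B `*` I) (B' `*` I') ->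
    cpt_contained (B' `*` I') (Om `*` `]0, T[) ->
    (energy p q a B' I' w < +oo)%E ->
    exists wm : nat -> 'rV[R]_n * R -> R,
      [/\ forall m, smooth_on (B `*` I) (wm m),
          forall m, LpW1p p B I (wm m),
          LpW1p_norm p B I (wm m \- w) @[m --> \oo] --> 0%E &
          energy p q a B I (wm m) @[m --> \oo] --> energy p q a B I w].

End spaces.

(* Main.v *)
Require Import Defs.
From HB Require Import structures.
From mathcomp Require Import all_boot all_order all_algebra.
From mathcomp Require Import all_classical all_reals all_analysis.
From mathcomp Require Import measurable_realfun ess_sup_inf.
From mathcomp Require Import ring lra.

Set Implicit Arguments.
Unset Strict Implicit.
Unset Printing Implicit Defensive.

Import Order.TTheory GRing.Theory Num.Theory.
Import numFieldNormedType.Exports.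

Local Open Scope classical_set_scope.
Local Open Scope ring_scope.

(** Mollify [w], cut off outside the larger cylinder, with a product bump kernel of spatial scale
    [e] and temporal scale [e^2].  For small [e] the result is smooth on the smaller cylinder, and
    its spatial gradient there is the mollification of the gradient of [w].  By Hoelder continuity
    the coefficient varies by at most [C e^alpha] on the support of the kernel, so up to that error
    Jensen's inequality bounds [a |D w_e|^q] by the mollified energy density; the error term is
    [e^alpha |D w_e|^(q-p) |D w_e|^p], which is controlled once [|D w_e| <= K e^(-gam)] with
    [gam (q - p) <= alpha].  The three assumptions on [w] give this bound with [gam = (n+2)/p]
    (finite p-norm of the gradient), [gam = 1] (bounded [w], moving the derivative to the kernel)
    and [gam = 1 + n/s] ([w] bounded in [L^s] uniformly in time).  Along a sequence [e_m] for which
    the L^1 errors of all mollified functions are at most [2^-m], the mollifications converge almost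
    everywhere and the mollified densities have an integrable majorant, so dominated convergence
    applies. *)

(** The parabolic scale is dictated by the Hoelder condition: a time step e^2 costs as much as a
    space step e. The kernel then has supremum of order e^-(n+2), the origin of n + 2, and gam (q -
    p) <= alpha becomes, for the three values of gam, exactly the three expressions that bound q.
    Only an integrable majorant is wanted, so every inequality may lose a constant: Jensen's
    inequality is replaced by an elementary splitting with factor 2^r, and mollified vectors are
    estimated coordinate by coordinate. Two obstacles shape the rest. The energy is written with a
    chosen weak gradient, so uniqueness almost everywhere must be known before the energy of a
    mollification can be computed from the mollified gradient. Weak differentiability is given for
    almost every time only, so the null set of bad times must not depend on the test function, since
    mollification tests each slice with another translate. Continuity of translations in L^1 starts
    from intervals and reaches space-time through Dynkin systems and products, so that density of
    continuous functions never enters. *)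

(* A product of measures carrying its sigma-finite structure, see [product_sigma_finite]. *)
Definition sprod d1 d2 (T1 : measurableType d1) (T2 : measurableType d2)
    (R : realType) (m1 : {sigma_finite_measure set T1 -> \bar R})
    (m2 : {sigma_finite_measure set T2 -> \bar R}) : set (T1 * T2) -> \bar R :=
  (m1 \x m2)%E.

Section sprod.
Context d1 d2 (T1 : measurableType d1) (T2 : measurableType d2) (R : realType).
Variables (m1 : {sigma_finite_measure set T1 -> \bar R}).
Variables (m2 : {sigma_finite_measure set T2 -> \bar R}).
HB.instance Definition _ := Measure.copy (sprod m1 m2) (m1 \x m2)%E.
HB.instance Definition _ := Measure_isSigmaFinite.Build _ _ _ (sprod m1 m2)
  (product_sigma_finite m1 m2).
End sprod.

Import HBSimple.

(** * Translations and mollification in L^1 *)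

Section translation.
Context d (T : measurableType d) (R : realType).
Variables (m : {sigma_finite_measure set T -> \bar R}).
Variables (add : T -> T -> T) (bx : R -> set T).

(** The sum [add] and the neighbourhoods of zero [bx] stay abstract, so that what is proved on the
    line passes to products and through the bijection between R x R^n and R^(n+1). *)
Definition translation_invariant :=
  measurable_fun [set: T * T] (fun z => add z.1 z.2) /\
  forall h A, measurable A -> m ((add^~ h) @^-1` A) = m A.

Definition shift_modulus (f : T -> R) (h : T) : \bar R :=
  (\int[m]_z `|f (add z h) - f z|%:E)%E.

Definition shift_continuous (f : T -> R) : Prop :=
  forall e : R, 0 < e -> exists2 r : R, 0 < r &
    forall h, bx r h -> (shift_modulus f h <= e%:E)%E.

Implicit Types f g : T -> R.
Hypothesis tr : translation_invariant.
Hypothesis bxS : forall r s : R, r <= s -> bx r `<=` bx s.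

Lemma measurable_shift h : measurable_fun setT (add^~ h).
Proof.
have [mad _] := tr.
rewrite (_ : add^~ h = (fun z => add z.1 z.2) \o (fun x => (x, h))); last exact/funext.
by apply: measurableT_comp => //; apply/measurable_fun_pairP; split.
Qed.

Lemma integral_shift (f : T -> \bar R) (h : T) : measurable_fun setT f ->
  (forall z, 0 <= f z)%E -> (\int[m]_z f (add z h) = \int[m]_z f z)%E.
Proof.
move=> mf f0; have [_ inv] := tr.
have := @ge0_integral_pushforward _ _ T T R (add^~ h) (measurable_shift h) m setT f
  measurableT mf (fun y _ => f0 y).
rewrite preimage_setT => <-.
apply: eq_measure_integral => [|? A mA _]; first exact: measurable_shift.
exact: (inv h A mA).
Qed.

Lemma measurable_fun_shift (f : T -> R) h : measurable_fun setT f ->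
  measurable_fun setT (fun z => f (add z h)).
Proof. by move=> mf; exact: (measurableT_comp mf (measurable_shift h)). Qed.

Lemma shift_modulusD f g h : measurable_fun setT f -> measurable_fun setT g ->
  (shift_modulus (f \+ g)%R h <= shift_modulus f h + shift_modulus g h)%E.
Proof.
move=> mf mg; rewrite /shift_modulus -ge0_integralD//=.
- apply: ge0_le_integral => //=.
  + apply/measurable_EFinP/measurableT_comp => //; apply: measurable_funB.
      by apply: measurable_funD; exact: measurable_fun_shift.
    exact: measurable_funD.
  + apply: emeasurable_funD; apply/measurable_EFinP/measurableT_comp => //;
      by apply: measurable_funB => //; exact: measurable_fun_shift.
  + move=> x _; rewrite -EFinD lee_fin.
    by rewrite (_ : _ - _ = (f (add x h) - f x) + (g (add x h) - g x)) ?ler_normD//; ring.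
- by apply/measurable_EFinP/measurableT_comp => //; apply: measurable_funB => //;
    exact: measurable_fun_shift.
- by apply/measurable_EFinP/measurableT_comp => //; apply: measurable_funB => //;
    exact: measurable_fun_shift.
Qed.

Lemma shift_modulus_le f h : measurable_fun setT f ->
  (shift_modulus f h <= 2%:E * \int[m]_z `|f z|%:E)%E.
Proof.
move=> mf; rewrite (_ : 2%:E = 1 + 1)%E; last by rewrite -EFinD.
have mn : measurable_fun setT (fun z => `|f z|%:E).
  by apply/measurable_EFinP/measurableT_comp.
rewrite ge0_muleDl// mul1e -{1}(@integral_shift (fun z => `|f z|%:E) h)//.
rewrite -ge0_integralD//=.
- apply: ge0_le_integral => //=.
  + apply/measurable_EFinP/measurableT_comp => //; apply: measurable_funB => //.
    exact: measurable_fun_shift.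
  + apply: emeasurable_funD => //; apply/measurable_EFinP/measurableT_comp => //.
    exact: measurable_fun_shift.
  + by move=> x _; rewrite -EFinD lee_fin ler_normB.
- by apply/measurable_EFinP/measurableT_comp => //; exact: measurable_fun_shift.
Qed.

Lemma shift_continuousD f g : measurable_fun setT f -> measurable_fun setT g ->
  shift_continuous f -> shift_continuous g -> shift_continuous (f \+ g).
Proof.
move=> mf mg cf cg e e0; have e20 : 0 < e / 2 by rewrite divr_gt0.
have [r r0 rP] := cf _ e20; have [s s0 sP] := cg _ e20.
exists (Num.min r s); first by rewrite lt_min r0.
move=> h bh; apply: (le_trans (shift_modulusD _ _ _)) => //.
rewrite (splitr e) EFinD leeD//; [apply: rP|apply: sP];
  by apply: bxS bh; rewrite ge_min lexx ?orbT.
Qed.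

Lemma shift_continuousZ (c : R) f : measurable_fun setT f ->
  shift_continuous f -> shift_continuous (fun z => c * f z).
Proof.
move=> mf cf e e0.
have c0 : 0 < `|c| + 1 by rewrite ltr_pwDr.
have [r r0 rP] := cf (e / (`|c| + 1)) (divr_gt0 e0 c0).
exists r => // h /rP; rewrite /shift_modulus => le.
under eq_integral do rewrite -mulrBr normrM EFinM.
rewrite ge0_integralZl//=; last first.
  apply/measurable_EFinP/measurableT_comp => //; apply: measurable_funB => //.
  exact: measurable_fun_shift.
apply: (@le_trans _ _ (`|c|%:E * (e / (`|c| + 1))%:E)%E).
  by rewrite lee_pmul// integral_ge0.
rewrite -EFinM lee_fin mulrC -mulrA ler_piMr// ?(ltW e0)//.
by rewrite mulrC ler_pdivrMr// mul1r lerDl.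
Qed.

(** A translation modulus is at most twice the L^1 norm, so an approximation error e / 4 costs e /
    2, uniformly in [h]. *)
Lemma shift_continuous_lim f : measurable_fun setT f ->
  (forall e : R, 0 < e -> exists g, [/\ measurable_fun setT g, shift_continuous g &
    (\int[m]_z `|f z - g z|%:E <= e%:E)%E]) -> shift_continuous f.
Proof.
move=> mf H e e0.
have [|g [mg cg lg]] := H (e / 4); first by rewrite divr_gt0.
have [|r r0 rP] := cg (e / 2); first by rewrite divr_gt0.
exists r => // h /rP le; have -> : f = (f \- g) \+ g.
  by apply/funext => z /=; rewrite subrK.
have mfg : measurable_fun setT (f \- g) by exact: measurable_funB.
apply: (le_trans (shift_modulusD _ _ _)) => //.
rewrite (splitr e) EFinD leeD//.
apply: (le_trans (shift_modulus_le _ _)) => //=.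
apply: (@le_trans _ _ (2%:E * (e / 4)%:E)%E); first by rewrite lee_pmul// integral_ge0.
by rewrite -EFinM lee_fin; lra.
Qed.

Lemma shift_continuous_cst (c : R) : shift_continuous (cst c).
Proof.
move=> e e0; exists 1 => // h _; rewrite /shift_modulus.
under eq_integral do rewrite subrr normr0.
by rewrite integral0 lee_fin ltW.
Qed.

Lemma shift_continuous_indicU (F : (set T)^nat) E n :
  (forall k, measurable (F k)) -> measurable E -> trivIset setT F ->
  (forall k, shift_continuous (\1_(F k `&` E))) ->
  shift_continuous (\1_((\big[setU/set0]_(k < n) F k) `&` E)).
Proof.
move=> mF mE tF cF; elim: n => [|n IH].
  rewrite big_ord0 set0I indic0; exact: shift_continuous_cst.
rewrite big_ord_recr /= setIUl.
have mU : measurable (\big[setU/set0]_(k < n) F k) by apply: bigsetU_measurable.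
rewrite (_ : \1__ = \1_((\big[setU/set0]_(k < n) F k) `&` E) \+ \1_(F n `&` E) :> (T -> R)).
  by apply: shift_continuousD => //; apply: measurable_indic; exact: measurableI.
apply/funext => x /=; rewrite !indicE !in_setU !in_setI.
case: (boolP (x \in E)) => xE; rewrite ?andbF ?andbT/= ?addr0//.
case: (boolP (x \in F n)) => xF; last by rewrite orbF addr0.
case: (boolP (x \in \big[setU/set0]_(k < n) F k)) => xU/=; rewrite ?add0r//.
move/set_mem: xU; rewrite -bigcup_mkord => -[k /= kn Fkx].
have kE : k = n by apply: (tF k n I I); exists x; split => //; exact: set_mem.
by rewrite kE ltnn in kn.
Qed.

(** The sets whose trace on [E] has a shift-continuous indicator form a Dynkin system: complements
    are differences from [\1_E], and a countable disjoint union is an L^1 limit of finite ones,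
    because the remainders decrease to the empty set inside [E], which has finite measure. *)
Lemma shift_continuous_dynkin (G : set (set T)) (E : set T) :
  @measurable _ T = <<s G >> -> setI_closed G ->
  measurable E -> (m E < +oo)%E -> shift_continuous (\1_E) ->
  (forall A, G A -> shift_continuous (\1_(A `&` E))) ->
  forall A, measurable A -> shift_continuous (\1_(A `&` E)).
Proof.
move=> mG GI mE Efin cE cG A mA.
apply: (@dynkin_induction _ T G (fun S => shift_continuous (\1_(S `&` E)))) => //.
- by rewrite setTI.
- move=> S mS cS.
  rewrite (_ : \1__ = \1_E \+ (fun z => -1 * \1_(S `&` E) z) :> (T -> R)).
    apply: shift_continuousD => //; [|apply: shift_continuousZ => //].
    + apply: measurable_funM => //; apply: measurable_indic; exact: measurableI.
    + apply: measurable_indic; exact: measurableI.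
  apply/funext => x /=; rewrite !indicE !in_setI in_setC.
  by case: (x \in E); case: (x \in S); rewrite /= ?mulN1r ?subrr ?subr0 ?oppr0 ?addr0.
- move=> F mF tF cF; apply: shift_continuous_lim.
    apply: measurable_indic; apply: measurableI => //; exact: bigcup_measurable.
  move=> e e0.
  pose D N := (\bigcup_k F k `&` E) `\` \big[setU/set0]_(k < N) F k.
  have mU N : measurable (\big[setU/set0]_(k < N) F k) by apply: bigsetU_measurable.
  have mb : measurable (\bigcup_k F k `&` E).
    apply: measurableI => //; exact: bigcup_measurable.
  have mD N : measurable (D N) by apply: measurableD.
  have : (m \o D) n @[n --> \oo] --> m (\bigcap_n D n).
    apply: nonincreasing_cvg_mu => //=.
    + apply: le_lt_trans Efin; apply: le_measure; rewrite ?inE//.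
      by move=> x [[_]].
    + exact: bigcap_measurable.
    + move=> i j ij; apply/subsetPset => x [xb xn]; split => //; apply: contra_not xn.
      exact: subset_bigsetU.
  rewrite (_ : \bigcap_n D n = set0) ?measure0; last first.
    rewrite -subset0 => x xD; have [[[k _ Fkx] Ex] _] := xD 0%N I.
    have [_] := xD k.+1 I; apply; rewrite -bigcup_mkord; exists k => //=.
  move=> /fine_cvgP[_ /cvgrPdist_le/(_ _ e0)] [N _ /(_ N (leqnn _))] /= DN.
  have DNfin : m (D N) \is a fin_num.
    rewrite ge0_fin_numE//; apply: le_lt_trans Efin; apply: le_measure; rewrite ?inE//.
    by move=> x [[_]].
  exists (\1_((\big[setU/set0]_(k < N) F k) `&` E)); split.
  + by apply: measurable_indic; exact: measurableI.
  + exact: shift_continuous_indicU.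
  + rewrite (eq_integral (fun x => (\1_(D N) x)%:E)); last first.
      move=> x _; rewrite !indicE /D in_setD !in_setI.
      case: (boolP (x \in E)); rewrite ?andbT ?andbF ?subrr ?normr0//= => xE.
      case: (boolP (x \in \big[setU/set0]_(k < N) F k)) => xU.
        rewrite mem_set ?subrr ?normr0//.
        by move/set_mem: xU; rewrite -bigcup_mkord => -[k _ Fk]; exists k.
      by case: (boolP (x \in \bigcup_k F k)) => xb; rewrite subr0 ?normr1 ?normr0.
    apply: (@le_trans _ _ (m (D N))); first by rewrite integral_indic// setIT.
  rewrite -(fineK DNfin) lee_fin.
    by move: DN; rewrite sub0r normrN ger0_norm// fine_ge0.
- by rewrite -mG.
Qed.

Definition shift_regular := forall A, measurable A -> (m A < +oo)%E ->
  shift_continuous (\1_A).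

(** Up to small measure, a set of finite measure is its trace on some [E n], and those traces are
    covered by the Dynkin argument. *)
Lemma shift_regular_exhaust (G : set (set T)) (E : (set T)^nat) :
  @measurable _ T = <<s G >> -> setI_closed G ->
  (forall n, measurable (E n)) -> (forall n, m (E n) < +oo)%E ->
  (\bigcup_n E n = setT) -> nondecreasing_seq E ->
  (forall n, shift_continuous (\1_(E n))) ->
  (forall A n, G A -> shift_continuous (\1_(A `&` E n))) ->
  shift_regular.
Proof.
move=> mG GI mE Efin ET ndE cE cG A mA Afin.
apply: shift_continuous_lim => // e e0.
pose D n := A `\` E n.
have mD n : measurable (D n) by exact: measurableD.
have : (m \o D) n @[n --> \oo] --> m (\bigcap_n D n).
  apply: nonincreasing_cvg_mu => //=.
  + apply: le_lt_trans Afin; apply: le_measure; rewrite ?inE//.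
    by move=> x [].
  + exact: bigcap_measurable.
  + move=> i j ij; apply/subsetPset => x [xb xn]; split => //; apply: contra_not xn.
    by have /subsetPset := ndE _ _ ij; exact.
rewrite (_ : \bigcap_n D n = set0) ?measure0; last first.
  rewrite -subset0 => x xD; have : setT x by [].
  by rewrite -ET => -[n _ Enx]; have [_] := xD n I; exact.
move=> /fine_cvgP[_ /cvgrPdist_le/(_ _ e0)] [N _ /(_ N (leqnn _))] /= DN.
have DNfin : m (D N) \is a fin_num.
  rewrite ge0_fin_numE//; apply: le_lt_trans Afin; apply: le_measure; rewrite ?inE//.
  by move=> x [].
exists (\1_(A `&` E N)); split.
- by apply: measurable_indic; exact: measurableI.
- by apply: (@shift_continuous_dynkin G) => //; move=> B GB; exact: cG.
- rewrite (eq_integral (fun x => (\1_(D N) x)%:E)); last first.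
    move=> x _; rewrite !indicE /D in_setD !in_setI.
    by case: (x \in A); case: (x \in E N); rewrite /= ?subrr ?subr0 ?normr0 ?normr1.
  apply: (@le_trans _ _ (m (D N))); first by rewrite integral_indic// setIT.
  rewrite -(fineK DNfin) lee_fin.
  by move: DN; rewrite sub0r normrN ger0_norm// fine_ge0.
Qed.

Lemma shift_continuous_sum (I : Type) (r : seq I) (F : I -> T -> R) :
  (forall i, measurable_fun setT (F i)) ->
  (forall i, shift_continuous (F i)) ->
  shift_continuous (fun z => \sum_(i <- r) F i z).
Proof.
move=> mF cF; elim: r => [|i r IH].
  rewrite (_ : (fun _ => _) = cst 0); last by apply/funext => z; rewrite big_nil.
  exact: shift_continuous_cst.
rewrite (_ : (fun _ => _) = F i \+ (fun z => \sum_(i <- r) F i z)); last first.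
  by apply/funext => z; rewrite big_cons.
by apply: shift_continuousD => //; exact: measurable_sum.
Qed.

Lemma integrable_shift_continuous (f : T -> R) : shift_regular ->
  m.-integrable setT (EFin \o f) -> shift_continuous f.
Proof.
move=> reg intf; have mf : measurable_fun setT f.
  by apply/measurable_EFinP; exact: measurable_int intf.
apply: shift_continuous_lim => // e e0.
have [g [ig _ gf]] := @approximation_sfun_integrable _ _ _ m setT measurableT _ intf.
move/fine_cvgP : gf => [gfin /cvgrPdist_le/(_ _ e0)].
move=> H; have [N _ /(_ N (leqnn N)) [/= Nfin NP]] : \forall n \near \oo,
    (\int[m]_z `|f z - g n z|%:E \is a fin_num)%E /\
    `|0 - fine (\int[m]_z `|f z - g n z|%:E)%E| <= e.
  by near=> n; split; near: n.
have mgN : measurable_fun setT (g N) by [].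
exists (g N); split => //.
- apply: (eq_ind_r shift_continuous _ (funext (fimfunEord (g N)))).
  apply: shift_continuous_sum => [i|i].
    by apply: measurable_funM => //; apply: measurable_indic.
  set y := _`_i; have mS : measurable (g N @^-1` [set y]).
    by rewrite -[X in measurable X]setTI; exact: mgN.
  (* Only the level set of 0 may have infinite measure, and its term vanishes; the others have
     finite measure by Chebyshev's inequality. *)
  have [->|y0] := eqVneq y 0.
    rewrite (_ : (fun _ => _) = cst 0); last by apply/funext => z; rewrite mul0r.
    exact: shift_continuous_cst.
  apply: shift_continuousZ => //; apply: reg => //.
  have /integrableP[mg gfin'] := ig N.
  have ny0 : 0 < `|y| by rewrite normr_gt0.
  have := @le_integral_abse _ _ _ m setT measurableT _ _ mg ny0.
  move=> /le_lt_trans/(_ gfin') H2.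
  rewrite ltNge; apply/negP; rewrite leye_eq => /eqP mSoo.
  move: H2; rewrite ltNge => /negP; apply.
  set S := _ `&` _; suff mSE : m S = +oo%E.
    by rewrite [X in (_ <= _ * X)%E]mSE gt0_muley ?lte_fin.
  apply/eqP; rewrite -leye_eq -mSoo; apply: le_measure; rewrite ?inE//.
  + rewrite /S setTI [X in measurable X](_ : _ = (Num.norm \o g N) @^-1` `[`|y|, +oo[%classic).
      rewrite -[X in measurable X]setTI; apply: measurableT_comp => //.
    by apply/seteqP; split => z /=; rewrite in_itv/= andbT lee_fin.
  + by move=> z zy; split => //=; have {}zy : g N z = y := zy; rewrite zy lee_fin.
- rewrite -(fineK Nfin) lee_fin.
  by move: NP; rewrite sub0r normrN ger0_norm// fine_ge0// integral_ge0.
Unshelve. all: by end_near. Qed.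

Lemma integral_shift_signed (f : T -> \bar R) (h : T) : measurable_fun setT f ->
  (\int[m]_z f (add z h) = \int[m]_z f z)%E.
Proof.
move=> mf; rewrite integralE [RHS]integralE; congr (_ - _)%E.
  transitivity (\int[m]_z (f^\+ (add z h)))%E; first by apply: eq_integral => z _; rewrite !(funeposE, funenegE).
  by apply: (@integral_shift f^\+%E h) => //; exact: measurable_funepos.
transitivity (\int[m]_z (f^\- (add z h)))%E; first by apply: eq_integral => z _; rewrite !(funeposE, funenegE).
by apply: (@integral_shift f^\-%E h) => //; exact: measurable_funeneg.
Qed.

(** The kernel is not reflected: this is a weighted mean of translates of [f], that is, the
    convolution with h -> k (- h). *)
Definition mollify (k : T -> R) (f : T -> R) (z : T) : R :=
  (\int[m]_h (f (add z h) * k h))%R.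

Lemma measurable_shift2 f : measurable_fun setT f ->
  measurable_fun [set: T * T] (fun z => f (add z.1 z.2)).
Proof. by move=> mf; have [mad _] := tr; exact: (measurableT_comp mf mad). Qed.

End translation.

Section mollify.
Context d (T : measurableType d) (R : realType).
Variables (m : {sigma_finite_measure set T -> \bar R}).
Variables (add : T -> T -> T) (bx : R -> set T).
Hypothesis tr : translation_invariant m add.
Hypothesis addC : commutative add.
Implicit Types f : T -> R.

Variables (k : T -> R) (C : R).
Hypothesis mk : measurable_fun setT k.
Hypothesis k0 : forall h, 0 <= k h.
Hypothesis kC : forall h, k h <= C.
Hypothesis k1 : (\int[m]_h (k h)%:E = 1)%E.

Lemma integrable_shift f z : m.-integrable setT (EFin \o f) ->
  m.-integrable setT (fun h => (f (add z h))%:E).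
Proof.
move=> /integrableP[mf fi]; apply/integrableP; split.
  under eq_fun do rewrite addC.
  by apply/measurable_EFinP/(measurable_fun_shift tr); exact/measurable_EFinP.
under eq_integral do rewrite addC.
rewrite (integral_shift tr z (f := fun h => `|(f h)%:E|%E))//.
exact: measurableT_comp.
Qed.

Lemma integrable_mollify_integrand f z : m.-integrable setT (EFin \o f) ->
  m.-integrable setT (fun h => (f (add z h) * k h)%:E).
Proof.
move=> intf.
have C0 : 0 <= C by exact: le_trans (k0 z) (kC z).
have intC := integrableZl measurableT C (integrable_shift z intf).
apply: le_integrable intC => //.
  apply/measurable_EFinP/measurable_funM => //.
  have := measurable_int _ (integrable_shift z intf).
  by move/measurable_EFinP.
move=> h _ /=; rewrite lee_fin !normrM mulrC ler_wpM2r//.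
by rewrite !ger0_norm.
Qed.

Lemma mollify_EFin f z : m.-integrable setT (EFin \o f) ->
  (mollify m add k f z)%:E = (\int[m]_h (f (add z h) * k h)%:E)%E.
Proof.
move=> intf; rewrite /mollify /Rintegral fineK//.
exact: integrable_fin_num (integrable_mollify_integrand _ intf).
Qed.

(** Tonelli's theorem gives measurability of the partial integral for nonnegative integrands, whence
    the splitting into positive and negative parts. *)
Lemma measurable_mollify f : m.-integrable setT (EFin \o f) ->
  measurable_fun setT (mollify m add k f).
Proof.
move=> intf; apply/measurable_EFinP.
have mf : measurable_fun setT f.
  by apply/measurable_EFinP; exact: measurable_int intf.
have mfp : measurable_fun setT f^\+ by exact: measurable_funrpos.
have mfn : measurable_fun setT f^\- by exact: measurable_funrneg.
pose F (g : T -> R) := fun z => (\int[m]_h (g (add z h) * k h)%:E)%E.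
have mF (g : T -> R) : measurable_fun setT g -> (forall z, 0 <= g z) -> measurable_fun setT (F g).
  move=> mg g0.
  apply: (measurable_fun_fubini_tonelli_F (fun z : T * T => (g (add z.1 z.2) * k z.2)%:E)) => /=.
    apply/measurable_EFinP/measurable_funM; first exact: (measurable_shift2 tr).
    exact: measurableT_comp.
  by move=> z; rewrite lee_fin mulr_ge0.
rewrite (_ : _ \o _ = (F f^\+%R \- F f^\-%R)%E); last first.
  apply/funext => z /=; rewrite mollify_EFin// /F -integralB_EFin//.
  - have fE x : f x = f^\+ x - f^\- x by rewrite -{1}(funrposBneg f).
    by apply: eq_integral => h _ /=; rewrite -EFinB -mulrBl -fE.
  - apply: (integrable_mollify_integrand z (f := f^\+)); exact: integrable_funrpos.
  - apply: (integrable_mollify_integrand z (f := f^\-)); exact: integrable_funrneg.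
by apply: emeasurable_funB; apply: mF.
Qed.

Lemma mollifyB_le f z : m.-integrable setT (EFin \o f) ->
  (`|mollify m add k f z - f z|%:E <= \int[m]_h (`|f (add z h) - f z| * k h)%:E)%E.
Proof.
move=> intf.
have intk : m.-integrable setT (EFin \o k).
  apply/integrableP; split; first exact/measurable_EFinP.
  under eq_integral do rewrite /= ger0_norm//.
  by rewrite k1 ltry.
have intB : m.-integrable setT (EFin \o (fun h => (f (add z h) - f z) * k h)).
  have := integrableB measurableT (integrable_mollify_integrand z intf)
    (integrableZl measurableT (f z) intk).
  by apply: eq_integrable => // h _ /=; rewrite mulrBl EFinB !EFinM.
have E : (mollify m add k f z - f z)%:E = (\int[m]_h ((f (add z h) - f z) * k h)%:E)%E.
  have fzE : (f z)%:E = (\int[m]_h ((f z)%:E * (k h)%:E))%E.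
    by rewrite integralZl// k1 mule1.
  rewrite EFinB mollify_EFin// {1}fzE -integralB//=.
  - by apply: eq_integral => h _ /=; rewrite mulrBl EFinB !EFinM.
  - exact: integrable_mollify_integrand.
  - exact: integrableZl.
rewrite -abse_EFin E (le_trans (le_abse_integral _ _ _))//.
  exact: measurable_int intB.
rewrite le_eqVlt; apply/orP; left; apply/eqP.
by apply: eq_integral => h _ /=; rewrite normrM (ger0_norm (k0 h)).
Qed.

(** By Tonelli's theorem the L^1 error is at most the mean of the shift moduli with weight [k], and
    only shifts in the support of [k] count. *)
Lemma mollify_L1_le f (e : R) : m.-integrable setT (EFin \o f) ->
  (forall h, k h != 0 -> (shift_modulus m add f h <= e%:E)%E) ->
  (\int[m]_z `|mollify m add k f z - f z|%:E <= e%:E)%E.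
Proof.
move=> intf He.
have mf : measurable_fun setT f.
  by apply/measurable_EFinP; exact: measurable_int intf.
have mg : measurable_fun setT (fun z : T * T => (`|f (add z.1 z.2) - f z.1| * k z.2)%:E).
  apply/measurable_EFinP/measurable_funM; last exact: measurableT_comp.
  apply/measurableT_comp => //; apply: measurable_funB; first exact: (measurable_shift2 tr).
  exact: measurableT_comp.
have g0 (z : T * T) : (0 <= (`|f (add z.1 z.2) - f z.1| * k z.2)%:E)%E.
  by rewrite lee_fin mulr_ge0.
apply: (@le_trans _ _ (\int[m]_z \int[m]_h (`|f (add z h) - f z| * k h)%:E)%E).
  apply: ge0_le_integral => //=.
  - apply/measurable_EFinP/measurableT_comp => //; apply: measurable_funB => //.
    exact: measurable_mollify.
  - exact: (measurable_fun_fubini_tonelli_F _ mg g0).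
  - by move=> z _; exact: mollifyB_le.
rewrite (fubini_tonelli _ mg g0)/=.
have -> : e%:E = (\int[m]_h (e * k h)%:E)%E.
  under [RHS]eq_integral do rewrite EFinM.
  rewrite integralZl// ?k1 ?mule1//.
  apply/integrableP; split; first exact/measurable_EFinP.
  under eq_integral do rewrite /= ger0_norm//.
  by rewrite k1 ltry.
have e0 h : k h != 0 -> 0 <= e.
  move=> /He; rewrite -lee_fin; apply: le_trans.
  by apply: integral_ge0.
apply: ge0_le_integral => //=.
- by move=> h _; apply: integral_ge0 => z _; exact: (g0 (z, h)).
- exact: (measurable_fun_fubini_tonelli_G _ mg g0).
- by apply/measurable_EFinP/measurable_funM.
- move=> h _; under eq_integral do rewrite mulrC EFinM.
  have mh : measurable_fun setT (fun z => `|f (add z h) - f z|%:E).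
    apply/measurable_EFinP/measurableT_comp => //; apply: measurable_funB => //.
    exact: (measurable_fun_shift tr).
  rewrite ge0_integralZl//; last by rewrite lee_fin.
  have [->|kh] := eqVneq (k h) 0; first by rewrite mulr0 mul0e.
  by rewrite mulrC EFinM; apply: lee_pmul => //; rewrite ?lee_fin ?integral_ge0//; exact: He.
Qed.

(** The substitution y = z + h, licensed by translation invariance, moves [z] into the kernel, where
    it can be differentiated. *)
Lemma mollifyE (sub : T -> T -> T) f z : (forall h w, sub (add w h) w = h) ->
  measurable_fun setT f -> measurable_fun setT (fun y => k (sub y z)) ->
  mollify m add k f z = (\int[m]_y (f y * k (sub y z)))%R.
Proof.
move=> subK mf mks; rewrite /mollify /Rintegral; congr fine.
rewrite -(@integral_shift_signed _ _ _ m add tr (fun y => (f y * k (sub y z))%:E) z).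
  by apply: eq_integral => h _; rewrite (addC h z) subK.
by apply/measurable_EFinP; exact: measurable_funM.
Qed.

End mollify.

Definition regular_shift d (T : measurableType d) (R : realType)
    (m : {sigma_finite_measure set T -> \bar R})
    (add : T -> T -> T) (bx : R -> set T) : Prop :=
  [/\ translation_invariant m add, forall r s : R, r <= s -> bx r `<=` bx s &
      shift_regular m add bx].

(** * Translations on the real line *)

Section line.
Context (R : realType).
Let addR : R -> R -> R := fun x y => x + y.
Let bxR (r : R) : set R := [set h | `|h| < r].

Lemma lebesgue_measure_shift (h : R) (A : set R) : measurable A ->
  lebesgue_measure ((addR^~ h) @^-1` A) = lebesgue_measure A.
Proof.
move=> mA.
have mh : measurable_fun setT (addR^~ h : measurableTypeR R -> measurableTypeR R).
  exact: measurable_funD.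
apply/esym.
pose nu := pushforward (@lebesgue_measure R) (addR^~ h).
have : forall X, ocitv X -> lebesgue_measure X = nu X.
  move=> _ [[a b]] _ <-.
  rewrite /nu /pushforward (_ : _ @^-1` _ = `](a - h), (b - h)]%classic).
    rewrite !lebesgue_measure_itv/= !lte_fin ltrD2r -!EFinB.
    by rewrite (_ : b - h - (a - h) = b - a)//; ring.
  by apply/seteqP; split => x /=; rewrite !in_itv/= ltrBlDr lerBrDr.
move=> H; exact: (@lebesgue_measure_unique _
  (measure_function_pushforward__canonical__measure_function_Measure lebesgue_measure mh) H A mA).
Qed.

Lemma translation_invariant_line : translation_invariant (@lebesgue_measure R) addR.
Proof.
split; last by move=> h A mA; exact: lebesgue_measure_shift.
by apply: measurable_funD; [exact: measurable_fst|exact: measurable_snd].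
Qed.

(** The indicator and its translate differ only at points within [|h|] of an endpoint; these lie in
    two intervals of length 2 |h|. *)
Lemma shift_modulus_itv (a b h : R) :
  (shift_modulus lebesgue_measure addR (\1_`]a, b]) h <= (4 * `|h|)%:E)%E.
Proof.
pose J (c : R) : set R := `[c - `|h|, c + `|h|]%classic.
have mJ c : measurable (J c) by exact: measurable_itv.
have mJI c : measurable_fun setT (\1_(J c) : measurableTypeR R -> R).
  by apply: measurable_indic; exact: measurable_itv.
apply: (@le_trans _ _ (\int[lebesgue_measure]_z ((\1_(J a) z)%:E + (\1_(J b) z)%:E))%E).
  rewrite /shift_modulus; apply: ge0_le_integral => //=.
  - have mI : measurable_fun setT (\1_`]a, b]%classic : measurableTypeR R -> R).
      by apply: measurable_indic; exact: measurable_itv.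
    apply/measurable_EFinP/measurableT_comp => //; apply: measurable_funB => //.
    exact: (measurable_fun_shift translation_invariant_line h mI).
  - by apply: emeasurable_funD; apply/measurable_EFinP.
  - move=> z _; rewrite -EFinD lee_fin !indicE /J /addR.
    have Pa c : (z \in `[c - `|h|, c + `|h|]%classic) = (`|z - c| <= `|h|).
      by rewrite mem_setE in_itv/= ler_distl.
    rewrite !Pa !mem_setE !in_itv/=.
    case: (ltP a z); case: (leP z b); case: (ltP a (z + h)); case: (leP (z + h) b) => /=;
      move=> h1 h2 h3 h4; rewrite ?subrr ?normr0 ?sub0r ?subr0 ?normrN ?normr1 ?addr_ge0//.
    all: have /andP[hh1 hh2] : - `|h| <= h <= `|h| by rewrite -ler_norml.
    all: try (have -> : `|z - a| <= `|h| by rewrite ler_distl; apply/andP; split; lra).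
    all: try (have -> : `|z - b| <= `|h| by rewrite ler_distl; apply/andP; split; lra).
    all: try by rewrite /= ?mulr1n ?lerDl ?lerDr ?ler0n.
rewrite ge0_integralD//=; try by apply/measurable_EFinP.
have IJ c : (\int[lebesgue_measure]_x (\1_(J c) x)%:E = lebesgue_measure (J c))%E.
  have := @integral_indic _ _ _ (@lebesgue_measure R) setT measurableT (J c) (mJ c).
  by rewrite setIT.
rewrite !IJ !lebesgue_measure_itv/=.
have H c : (if (c - `|h|)%:E < (c + `|h|)%:E then (c + `|h|)%:E - (c - `|h|)%:E else 0)%E
    = (2 * `|h|)%:E.
  rewrite lte_fin -EFinB; case: ltP => hh; congr EFin; first by ring.
  have := normr_ge0 h; lra.
by rewrite !H -EFinD lee_fin; lra.
Qed.

Lemma regular_shift_line : regular_shift (@lebesgue_measure R) addR bxR.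
Proof.
have tr := translation_invariant_line.
have bxS (r s : R) : r <= s -> bxR r `<=` bxR s.
  by move=> rs h; rewrite /bxR/= => /lt_le_trans; exact.
split => //.
have citv (a b : R) : shift_continuous lebesgue_measure addR bxR (\1_`]a, b]).
  move=> e e0; exists (e / 4); first by rewrite divr_gt0.
  move=> h hr; apply: (le_trans (shift_modulus_itv a b h)).
  by move: hr; rewrite /bxR/= lee_fin; lra.
pose G : set (set (measurableTypeR R)) := (R.-ocitv).-measurable.
pose E : nat -> set (measurableTypeR R) := fun n => `](- n%:R)%R, n%:R]%classic.
refine (@shift_regular_exhaust _ _ _ lebesgue_measure addR bxR tr bxS G E _ _ _ _ _ _ _ _) => //.
- exact: ocitvI.
- by move=> n; exact: measurable_itv.
- move=> n; have := @lebesgue_measure_itv R `](- n%:R)%R, n%:R].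
  move=> /= LE; rewrite [X in (X < _)%E]LE.
  by case: ifP; rewrite -?EFinB ltry.
- by rewrite bigcup_itvT.
- move=> i j ij; apply/subsetPset => x; rewrite /E /= !in_itv/= => /andP[xi ix].
  have := ij; rewrite -(ler_nat R) => ijR; apply/andP; split; lra.
- by move=> n; exact: citv.
- move=> _ n [[a b] _ <-]; rewrite (_ : _ `&` _ =
    `](Num.max a (- n%:R)), (Num.min b n%:R)]%classic); first exact: citv.
  apply/seteqP; split => x; rewrite /E /= !in_itv/= gt_max le_min.
    by move=> [/andP[-> ->] /andP[-> ->]].
  by move=> /andP[/andP[-> ->] /andP[-> ->]].
Qed.

End line.

(** * Translations on product spaces *)

Section plane.
Context d1 d2 (T1 : measurableType d1) (T2 : measurableType d2) (R : realType).
Variables (m1 : {sigma_finite_measure set T1 -> \bar R}).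
Variables (m2 : {sigma_finite_measure set T2 -> \bar R}).
Variables (add1 : T1 -> T1 -> T1) (bx1 : R -> set T1).
Variables (add2 : T2 -> T2 -> T2) (bx2 : R -> set T2).

Definition add_pair (z w : T1 * T2) := (add1 z.1 w.1, add2 z.2 w.2).
Definition bx_pair (r : R) := bx1 r `*` bx2 r.

Hypothesis reg1 : regular_shift m1 add1 bx1.
Hypothesis reg2 : regular_shift m2 add2 bx2.

Lemma sprodE A B : measurable A -> measurable B ->
  (sprod m1 m2 (A `*` B) = m1 A * m2 B)%E.
Proof. exact: product_measure1E. Qed.

Lemma translation_invariant_pair : translation_invariant (sprod m1 m2) add_pair.
Proof.
have [[mad1 inv1] _ _] := reg1; have [[mad2 inv2] _ _] := reg2.
split.
  apply/measurable_fun_pairP; split.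
    apply: (measurableT_comp mad1 (f := fun z : T1 * T1 => add1 z.1 z.2)
       (g := fun z : (T1 * T2) * (T1 * T2) => (z.1.1, z.2.1))).
    apply/measurable_fun_pairP; split => /=.
      exact: (measurableT_comp measurable_fst measurable_fst).
    exact: (measurableT_comp measurable_fst measurable_snd).
  apply: (measurableT_comp mad2 (f := fun z : T2 * T2 => add2 z.1 z.2)
       (g := fun z : (T1 * T2) * (T1 * T2) => (z.1.2, z.2.2))).
  apply/measurable_fun_pairP; split => /=.
    exact: (measurableT_comp measurable_snd measurable_fst).
  exact: (measurableT_comp measurable_snd measurable_snd).
move=> [h k] S mS; rewrite /sprod /product_measure1/=.
transitivity (\int[m1]_x (m2 (xsection S (add1 x h))))%E; last first.
  apply: (@integral_shift _ _ _ m1 add1 _ (fun x => m2 (xsection S x)) h) => //.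
  exact: measurable_fun_xsection.
apply: eq_integral => x _ /=; rewrite -[RHS](inv2 k); last exact: measurable_xsection.
by congr (m2 _); apply/seteqP; split => y; rewrite /xsection/= !inE.
Qed.

(** The difference of the products is telescoped by changing one factor at a time; the shifted
    factor [\1_B] still integrates to [m2 B] by invariance. *)
Lemma shift_modulus_rect A B h : measurable A -> measurable B ->
  (shift_modulus (sprod m1 m2) add_pair (\1_(A `*` B)) h <=
   shift_modulus m1 add1 (\1_A) h.1 * m2 B + m1 A * shift_modulus m2 add2 (\1_B) h.2)%E.
Proof.
move=> mA mB; case: h => h k /=.
have [tr1 _ _] := reg1; have [tr2 _ _] := reg2; have tr := translation_invariant_pair.
have mIA : measurable_fun setT (\1_A : T1 -> R) by exact: measurable_indic.
have mIB : measurable_fun setT (\1_B : T2 -> R) by exact: measurable_indic.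
have mAh : measurable_fun setT (fun x => `|\1_A (add1 x h) - \1_A x| : R).
  apply/measurableT_comp => //; apply: measurable_funB => //.
  exact: (measurable_fun_shift tr1).
have mBk : measurable_fun setT (fun x => `|\1_B (add2 x k) - \1_B x| : R).
  apply/measurableT_comp => //; apply: measurable_funB => //.
  exact: (measurable_fun_shift tr2).
have mBk' : measurable_fun setT (fun x => \1_B (add2 x k) : R).
  exact: (measurable_fun_shift tr2).
pose g (z : T1 * T2) : R := `|\1_A (add1 z.1 h) - \1_A z.1| * \1_B (add2 z.2 k) +
  \1_A z.1 * `|\1_B (add2 z.2 k) - \1_B z.2|.
have mg : measurable_fun setT (EFin \o g).
  apply/measurable_EFinP/measurable_funD; apply: measurable_funM.
  - exact: (measurableT_comp mAh measurable_fst).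
  - exact: (measurableT_comp mBk' measurable_snd).
  - exact: (measurableT_comp mIA measurable_fst).
  - exact: (measurableT_comp mBk measurable_snd).
have g0 z : (0 <= (EFin \o g) z)%E by rewrite lee_fin addr_ge0// mulr_ge0.
apply: (@le_trans _ _ (\int[sprod m1 m2]_z (g z)%:E)%E).
  apply: ge0_le_integral => //=.
  - apply/measurable_EFinP/measurableT_comp => //; apply: measurable_funB => //.
      by apply: (measurable_fun_shift tr); apply: measurable_indic; exact: measurableX.
    by apply: measurable_indic; exact: measurableX.
  - move=> [x y] _; rewrite lee_fin /g /add_pair/=.
    have E2 (u : T1) (v : T2) : \1_(A `*` B) (u, v) = \1_A u * \1_B v :> R.
      by rewrite !indicE in_setX/=; case: (u \in A); case: (v \in B); rewrite ?mul1r ?mul0r.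
    rewrite !E2.
    have -> : \1_A (add1 x h) * \1_B (add2 y k) - \1_A x * \1_B y =
      (\1_A (add1 x h) - \1_A x) * \1_B (add2 y k) +
      \1_A x * (\1_B (add2 y k) - \1_B y) :> R by ring.
    apply: (le_trans (ler_normD _ _)); rewrite !normrM.
    by rewrite (ger0_norm (_ : 0 <= \1_B _))// (ger0_norm (_ : 0 <= \1_A _)).
rewrite (fubini_tonelli1 _ mg g0)/= /fubini_F/= /g /=.
rewrite le_eqVlt; apply/orP; left; apply/eqP.
under eq_integral => x _.
  under eq_integral do rewrite EFinD !EFinM.
  rewrite ge0_integralD//=; try by apply: measurable_funeM; exact/measurable_EFinP.
  rewrite ge0_integralZl//=; last exact/measurable_EFinP.
  rewrite ge0_integralZl//=; last exact/measurable_EFinP.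
  rewrite (integral_shift tr2 k (f := fun y => (\1_B y)%:E))//; last exact/measurable_EFinP.
  rewrite integral_indic// setIT.
  over.
rewrite /= ge0_integralD//=; try by apply: emeasurable_funM => //; exact/measurable_EFinP.
  all: try by move=> y _; rewrite mule_ge0// ?lee_fin// integral_ge0.
rewrite ge0_integralZr//=; last exact/measurable_EFinP.
rewrite ge0_integralZr//=; try exact/measurable_EFinP; try exact: integral_ge0.
  all: try by move=> *; rewrite lee_fin.
by rewrite integral_indic// setIT.
Qed.

Lemma regular_shift_pair : regular_shift (sprod m1 m2) add_pair bx_pair.
Proof.
have [tr1 bS1 sr1] := reg1; have [tr2 bS2 sr2] := reg2.
have tr := translation_invariant_pair.
have bxS (r s : R) : r <= s -> bx_pair r `<=` bx_pair s.
  by move=> rs [x y] [/= /(bS1 _ _ rs) ? /(bS2 _ _ rs)].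
split => //.
have crect A B : measurable A -> measurable B -> (m1 A < +oo)%E -> (m2 B < +oo)%E ->
    shift_continuous (sprod m1 m2) add_pair bx_pair (\1_(A `*` B)).
  move=> mA mB Af Bf e e0.
  (* Dividing by [b + 1] and [a + 1] rather than by [b] and [a] keeps the tolerances meaningful when
     a factor has measure zero. *)
  have aux (u v : R) : 0 <= u -> 0 <= v -> u / (v + 1) * v <= u.
    by move=> u0 v0; rewrite mulrAC ler_pdivrMr ?ltr_wpDl// ler_wpM2l// lerDl.
  have mAE : m1 A = (fine (m1 A))%:E by rewrite fineK// ge0_fin_numE.
  have mBE : m2 B = (fine (m2 B))%:E by rewrite fineK// ge0_fin_numE.
  set a := fine (m1 A) in mAE; set b := fine (m2 B) in mBE.
  have a0 : 0 <= a by rewrite fine_ge0.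
  have b0 : 0 <= b by rewrite fine_ge0.
  have [|r1 r10 P1] := sr1 A mA Af (e / 2 / (b + 1)).
    by rewrite !divr_gt0// ltr_wpDl.
  have [|r2 r20 P2] := sr2 B mB Bf (e / 2 / (a + 1)).
    by rewrite !divr_gt0// ltr_wpDl.
  exists (Num.min r1 r2); first by rewrite lt_min r10.
  move=> [h k] [/= bh bk]; apply: (le_trans (shift_modulus_rect _ mA mB)) => /=.
  have {}P1 := P1 h (bS1 _ _ _ _ bh); have {}P2 := P2 k (bS2 _ _ _ _ bk).
  rewrite mAE mBE (splitr e) EFinD leeD//.
    apply: (@le_trans _ _ ((e / 2 / (b + 1))%:E * b%:E)%E).
      by apply: lee_pmul => //; [exact: integral_ge0|apply: P1; rewrite ge_min lexx].
    by rewrite -EFinM lee_fin aux// ltW// divr_gt0.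
  apply: (@le_trans _ _ (a%:E * (e / 2 / (a + 1))%:E)%E).
    by apply: lee_pmul => //; [exact: integral_ge0|apply: P2; rewrite ge_min lexx orbT].
  by rewrite -EFinM lee_fin mulrC aux// ltW// divr_gt0.
have /sigma_finiteP[F [FT ndF Ff]] := sigma_finiteT m1.
have /sigma_finiteP[G [GT ndG Gf]] := sigma_finiteT m2.
apply: (@shift_regular_exhaust _ _ _ _ add_pair bx_pair tr bxS
  [set A `*` B | A in measurable & B in measurable] (fun n => F n `*` G n)).
- exact: measurable_prod_measurableType.
- move=> X Y [X1 mX1 [X2 mX2 <-{X}]] [Y1 mY1 [Y2 mY2 <-{Y}]].
  exists (X1 `&` Y1); first exact: measurableI.
  by exists (X2 `&` Y2); [exact: measurableI|rewrite setXI].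
- by move=> n; apply: measurableX; [exact: (Ff n).1|exact: (Gf n).1].
- move=> n; have [? ?] := Ff n; have [? ?] := Gf n.
  rewrite [X in (X < _)%E](_ : _ = (m1 (F n) * m2 (G n))%E); last exact: sprodE.
  by rewrite lte_mul_pinfty// ge0_fin_numE.
- rewrite -setXTT FT GT predeqE => -[x y]; split.
    by move=> [n _ []/= ? ?]; split; exists n.
  move=> [/= [n _ Fnx] [k _ Gky]]; exists (maxn n k) => //; split.
  - by move: x Fnx; exact/subsetPset/ndF/leq_maxl.
  - by move: y Gky; exact/subsetPset/ndG/leq_maxr.
- move=> i j ij; apply/subsetPset => -[x y] [/= Fx Gy]; split => /=.
  - by move: x Fx; exact/subsetPset/ndF.
  - by move: y Gy; exact/subsetPset/ndG.
- by move=> n; have [? ?] := Ff n; have [? ?] := Gf n; exact: crect.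
- move=> _ n [A mA [B mB <-]]; have [? ?] := Ff n; have [? ?] := Gf n.
  rewrite -setXI; apply: crect; try exact: measurableI.
    by apply: le_lt_trans (Ff n).2; apply: le_measure; rewrite ?inE//; exact: measurableI.
  by apply: le_lt_trans (Gf n).2; apply: le_measure; rewrite ?inE//; exact: measurableI.
Qed.

End plane.

(** * Transport to R^n and to space-time *)

Lemma regular_shift_iso d1 d2 (T1 : measurableType d1) (T2 : measurableType d2)
    (R : realType) (m1 : {sigma_finite_measure set T1 -> \bar R})
    (m2 : {sigma_finite_measure set T2 -> \bar R})
    (add1 : T1 -> T1 -> T1) (bx1 : R -> set T1)
    (add2 : T2 -> T2 -> T2) (bx2 : R -> set T2) (f : T1 -> T2) (g : T2 -> T1) :
  measurable_fun setT f -> measurable_fun setT g -> cancel f g -> cancel g f ->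
  (forall z w, f (add1 z w) = add2 (f z) (f w)) ->
  (forall r h, bx2 r h <-> bx1 r (g h)) ->
  (forall A, measurable A -> m2 A = m1 (f @^-1` A)) ->
  regular_shift m1 add1 bx1 -> regular_shift m2 add2 bx2.
Proof.
move=> mf mg fK gK fD bxE m2E [[mad1 inv1] bS1 sr1].
have gD z w : g (add2 z w) = add1 (g z) (g w) by rewrite -[RHS]fK fD !gK.
have mpre A : measurable A -> measurable (f @^-1` A).
  by move=> mA; rewrite -[X in measurable X]setTI; exact: mf.
have preE h A : f @^-1` (add2^~ h @^-1` A) = add1^~ (g h) @^-1` (f @^-1` A).
  by apply/seteqP; split => x /=; rewrite fD gK.
have tr2 : translation_invariant m2 add2.
  split.
    have -> : (fun z : T2 * T2 => add2 z.1 z.2) =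
        f \o ((fun z : T1 * T1 => add1 z.1 z.2) \o (fun z : T2 * T2 => (g z.1, g z.2))).
      by apply/funext => z /=; rewrite fD !gK.
    apply: measurableT_comp => //; apply: measurableT_comp => //.
    apply/measurable_fun_pairP; split.
      exact: (measurableT_comp mg measurable_fst).
    exact: (measurableT_comp mg measurable_snd).
  move=> h A mA; rewrite !m2E//; last first.
    have -> : add2^~ h @^-1` A = g @^-1` (add1^~ (g h) @^-1` (f @^-1` A)).
      by apply/seteqP; split => x /=; rewrite fD !gK.
    rewrite -[X in measurable X]setTI; apply: mg => //.
    rewrite -[X in measurable X]setTI; apply: measurable_shift => //; first by split; [exact: mad1|exact: inv1].
    exact: mpre.
  by rewrite preE inv1//; exact: mpre.
split => //.
  by move=> r s rs h /bxE /(bS1 _ _ rs) /bxE.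
move=> A mA Af e e0.
have [||r r0 rP] := sr1 (f @^-1` A) _ _ e e0; [exact: mpre|by rewrite -m2E|].
exists r => // h /bxE /rP; apply: le_trans; rewrite le_eqVlt; apply/orP; left; apply/eqP.
rewrite /shift_modulus.
pose G (y : T2) : \bar R := `|\1_A (add2 y h) - \1_A y|%:E.
have mG : measurable_fun setT G.
  have mI : measurable_fun setT (\1_A : T2 -> R) by exact: measurable_indic.
  apply/measurable_EFinP/measurableT_comp => //; apply: measurable_funB => //.
  exact: (measurable_fun_shift tr2).
have G0 y : (0 <= G y)%E by rewrite lee_fin.
have := @ge0_integral_pushforward _ _ T1 T2 R f mf m1 setT G measurableT mG (fun y _ => G0 y).
rewrite preimage_setT => H; transitivity (\int[m1]_x (G \o f) x)%E; last first.
  have E u : \1_(f @^-1` A) u = \1_A (f u) :> R.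
    by rewrite !indicE; congr (_%:R); congr nat_of_bool; apply/idP/idP; rewrite !inE.
  by apply: eq_integral => x _ /=; rewrite !E /G fD gK.
rewrite -H; apply: eq_measure_integral => // A' mA' _; exact: m2E.
Qed.

Lemma regular_shift_rV (R : realType) n : regular_shift (@lebesgue_rV R n)
  (fun x y : 'rV[R]_n => x + y) (fun r => [set h : 'rV[R]_n | forall i, `|h ord0 i| < r]).
Proof.
elim: n => [|n IH].
  have rV0 (x : 'rV[R]_0) : x = 0 by apply/rowP => -[].
  split.
  - split; first by rewrite (_ : (fun _ => _) = cst 0)//; apply/funext => z; exact: rV0.
    by move=> h A mA; congr (_ _); apply/seteqP; split => x /=; rewrite (rV0 (x + h)) (rV0 x).
  - by move=> r s _ h _ [].
  - move=> A mA _ e e0; exists 1 => // h _; rewrite /shift_modulus.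
    rewrite (eq_integral (cst 0%E)); first by rewrite integral0 lee_fin ltW.
    by move=> z _ /=; rewrite (rV0 (z + h)) (rV0 z) subrr normr0.
(* The measure on R^(n+1) is by definition the image of the product measure under [cons_rV], so the
   condition relating the measures is immediate. *)
apply: (@regular_shift_iso _ _ _ _ R (sprod (@lebesgue_measure R) (lebesgue_rV n)) _ _ _ _ _
  (@cons_rV R n) (@uncons_rV R n) _ _ _ _ _ _ _ (regular_shift_pair (regular_shift_line R) IH)).
- exact: measurable_cons_rV.
- exact: measurable_uncons_rV.
- exact: cons_rVK.
- exact: uncons_rVK.
- move=> z w; apply/rowP => i; rewrite [RHS]mxE; have [j ->|->] := unliftP ord0 i.
    by rewrite !cons_rV_lift mxE.
  by rewrite !cons_rV0.
- move=> r h; split => [hr|[/= h0 hS] i].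
    split => /=; first exact: hr.
    move=> i; have := hr (lift ord0 i).
    by rewrite -{1}(uncons_rVK h) cons_rV_lift.
  rewrite -(uncons_rVK h); have [j ->|->] := unliftP ord0 i.
    by rewrite cons_rV_lift; exact: hS.
  by rewrite cons_rV0.
- by [].
Qed.

Definition spacetime (R : realType) n :
    {sigma_finite_measure set ('rV[R]_n * measurableTypeR R)%type -> \bar R} :=
  [the {sigma_finite_measure set _ -> \bar R} of
    sprod (lebesgue_rV n) (@lebesgue_measure R)].

(** The time side is [r], not [r ^+ 2]: these sets only serve as neighbourhoods of zero for the
    continuity of translations, and in this form they are those of the product. *)
Definition parabolic_box (R : realType) n (r : R) : set ('rV[R]_n * R)%type :=
  [set h : 'rV[R]_n * R | (forall i, `|h.1 ord0 i| < r) /\ `|h.2| < r].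

Lemma regular_shift_spacetime (R : realType) n :
  regular_shift (@spacetime R n) (fun z w : 'rV[R]_n * R => z + w) (@parabolic_box R n).
Proof. exact: (regular_shift_pair (regular_shift_rV R n) (regular_shift_line R)). Qed.

(** * Smooth bump functions *)

Lemma scaleRE (R : realType) (a b : R) : a *: b = a * b.
Proof. by []. Qed.

Section flat.
Context {R : realType}.
Implicit Types (p q : {poly R}) (t u x : R).

(* [p(1/t) exp(-1/t)] extended by [0] for [t <= 0]; this family of smooth
   functions is closed under differentiation. *)
Definition flat p t : R := if 0 < t then p.[t^-1] * expR (- t^-1) else 0.

(** With u = 1/t one has d/dt = - u^2 d/du, which sends p(u) exp(-u) to u^2 (p - p')(u) exp(-u). *)
Definition dflat p : {poly R} := 'X^2 * (p - p^`()).

Lemma monomial_expRN_le k u : 0 <= u -> u ^+ k * expR (- u) <= k`!%:R.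
Proof.
move=> u0; rewrite expRN ler_pdivrMr ?expR_gt0//.
case: k => [|k].
  by rewrite expr0 fact0 mul1r -{1}(expR0 R) ler_expR.
have f0 : 0 < k.+1`!%:R :> R by rewrite ltr0n fact_gt0.
rewrite mulrC -ler_pdivrMr//; apply: le_trans (expR_ge1Dxn k u0).
by rewrite lerDr.
Qed.

Lemma flat_bounded p : exists2 C : R, 0 <= C & forall t, `|flat p t| <= C.
Proof.
exists (\sum_(i < size p) `|p`_i| * i`!%:R) => [|t].
  by apply: sumr_ge0 => i _; rewrite mulr_ge0.
rewrite /flat; case: ltP => t0; last first.
  by rewrite normr0; apply: sumr_ge0 => i _; rewrite mulr_ge0.
rewrite horner_coef mulr_suml (le_trans (ler_norm_sum _ _ _))//.
apply: ler_sum => i _; rewrite -mulrA normrM ler_wpM2l//.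
have u0 : 0 <= t^-1 by rewrite invr_ge0 ltW.
by rewrite ger0_norm ?mulr_ge0 ?exprn_ge0 ?expR_ge0// monomial_expRN_le.
Qed.

(** Replacing [p] by ['X^2 * p] divides the function by t^2 and keeps it bounded. This quadratic
    flatness gives the derivative 0 at the only delicate point, t = 0. *)
Lemma flat_quadratic p : exists2 C : R, 0 <= C & forall t, `|flat p t| <= C * t ^+ 2.
Proof.
have [C C0 CP] := flat_bounded ('X^2 * p); exists C => // t.
have [t0|t0] := ltP 0 t; last first.
  by rewrite {1}/flat ltNge t0/= normr0 mulr_ge0// sqr_ge0.
have -> : flat p t = flat ('X^2 * p) t * t ^+ 2.
  rewrite /flat t0 hornerM hornerXn.
  by field; rewrite gt_eqF.
by rewrite normrM (ger0_norm (sqr_ge0 t)) ler_wpM2r ?sqr_ge0.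
Qed.

Lemma is_derive_quadratic (f : R -> R) (x l C : R) :
  (forall h, `|f (x + h) - f x - l * h| <= C * h ^+ 2) -> is_derive x 1 f l.
Proof.
move=> H.
have C0 : 0 <= C.
  by have := H 1; rewrite expr1n [C * 1]mulr1; exact: le_trans.
have cv : (fun h : R => h^-1 *: ((f \o shift x) (h *: (1 : R)) - f x)) @ 0^' --> l.
  apply/cvgrPdist_le => e e0.
  near=> h.
  have h0 : h != 0 by near: h; exact: nbhs_dnbhs_neq.
  have -> : l - h^-1 *: ((f \o shift x) (h *: (1 : R)) - f x) =
      - (h^-1 * (f (x + h) - f x - l * h)).
    have -> : h *: (1 : R) = h by exact: mulr1.
    have -> (y : R) : h^-1 *: y = h^-1 * y by [].
    by rewrite /= (addrC h x); field.
  rewrite normrN normrM normfV ler_pdivrMl ?normr_gt0//.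
  apply: (le_trans (H h)); rewrite -real_normK ?num_real// expr2 mulrCA ler_wpM2l//.
  apply: (@le_trans _ _ ((C + 1) * `|h|)); first by rewrite ler_wpM2r// lerDl.
  rewrite -ler_pdivlMl ?ltr_wpDl// mulrC.
  by near: h; apply: dnbhs0_le; rewrite divr_gt0// ltr_wpDl.
split; first by apply/cvg_ex; exists l.
exact/cvg_lim.
Unshelve. all: by end_near. Qed.

Lemma is_derive_flat p t : is_derive t 1 (flat p) (flat (dflat p) t).
Proof.
have [t0|t0|t0] := ltgtP t 0.
- rewrite [flat (dflat p) t]/flat ltNge (ltW t0)/=.
  apply: (@near_eq_is_derive _ _ _ (cst 0)).
    near=> s; rewrite /flat ifN// -leNgt.
    by apply: ltW; near: s; exact: lt_nbhsl.
- rewrite [flat (dflat p) t]/flat t0.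
  apply: (@near_eq_is_derive R R R (fun s => p.[s^-1] * expR (- s^-1))).
    near=> s; rewrite /flat ifT//.
    by near: s; exact: lt_nbhsr.
  have dV : is_derive t 1 (fun s : R => s^-1) (- t ^- 2).
    have tn0 : t != 0 by rewrite gt_eqF.
    have := is_deriveV (f := id) tn0 (is_derive_id t (1 : R)).
    by rewrite [_ *: _]mulr1.
  have d1 : is_derive t 1 (fun s => p.[s^-1]) (p^`().[t^-1] * (- t ^- 2)).
    exact: (@is_derive1_comp _ (horner p) (fun s => s^-1) t _ _ (is_derive_poly p t^-1) dV).
  have d2 : is_derive t 1 (fun s => expR (- s^-1)) (expR (- t^-1) * t ^- 2).
    have dN : is_derive t 1 (fun s : R => - s^-1) (t ^- 2).
      by apply: is_derive_eq; rewrite opprK.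
    exact: (@is_derive1_comp _ expR (fun s => - s^-1) t _ _ (is_derive_expR _) dN).
  apply: is_derive_eq.
  rewrite /dflat hornerM hornerXn hornerD hornerN !scaleRE.
  by field; rewrite gt_eqF.
- rewrite t0 [flat (dflat p) 0]/flat ltxx.
  have [C C0 CP] := flat_quadratic p.
  apply: (@is_derive_quadratic _ _ _ C) => h.
  by rewrite add0r mul0r subr0 {2}/flat ltxx subr0.
Unshelve. all: by end_near. Qed.

Lemma derive_lipschitz (f f' : R -> R) C : (forall t, is_derive t 1 f (f' t)) ->
  forall a b, (forall t, Num.min a b <= t <= Num.max a b -> `|f' t| <= C) ->
  `|f b - f a| <= C * `|b - a|.
Proof.
move=> df a b.
wlog ab : a b / a <= b.
  move=> H HC; have [ab|/ltW ba] := leP a b; first exact: H.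
  by rewrite distrC (distrC b a); apply: H => // t; rewrite minC maxC; exact: HC.
rewrite min_l// max_r// => HC.
have [|c cab ->] := @MVT_segment R f f' a b ab (fun x _ => df x).
  apply: continuous_subspaceT => x; apply: differentiable_continuous.
  by apply/derivable1_diffP; apply: ex_derive.
by rewrite normrM ler_wpM2r// HC// -(itvP cab)//; rewrite (itvP cab) andbT (itvP cab).
Qed.

(** The second derivative [flat (dflat (dflat p))] is bounded, so two applications of the mean value
    inequality give a quadratic remainder. One constant serves all three bounds, as [taylor1]
    demands. *)
Lemma flat_taylor p : exists2 C : R, 0 <= C & forall t h,
  [/\ `|flat p t| <= C, `|flat (dflat p) t| <= C &
      `|flat p (t + h) - flat p t - flat (dflat p) t * h| <= C * h ^+ 2].
Proof.
have [C0 C00 H0] := flat_bounded p.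
have [C1 C10 H1] := flat_bounded (dflat p).
have [C2 C20 H2] := flat_bounded (dflat (dflat p)).
exists (C0 + C1 + C2); first by rewrite !addr_ge0.
move=> t h; split.
- by apply: (le_trans (H0 t)); rewrite -addrA lerDl addr_ge0.
- by apply: (le_trans (H1 t)); rewrite addrAC lerDr addr_ge0.
- pose g s := flat p s - flat (dflat p) t * s.
  have dg (s : R) : is_derive s (1 : R) g (flat (dflat p) s - flat (dflat p) t).
    have ? := is_derive_flat p s.
    by apply: is_derive_eq; rewrite [_ *: _]mulr1.
  have := derive_lipschitz dg (a := t) (b := t + h) (C := C2 * `|h|).
  rewrite (_ : t + h - t = h); last by ring.
  have -> : g (t + h) - g t = flat p (t + h) - flat p t - flat (dflat p) t * h.
    by rewrite /g; ring.
  move=> H; apply: (le_trans (H _)).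
    move=> s sh; have := derive_lipschitz (is_derive_flat (dflat p)) (a := t) (b := s) (C := C2).
    move=> /(_ (fun t _ => H2 t)) /le_trans; apply; rewrite ler_wpM2l//.
    move: sh; rewrite ge_min le_max => /andP[/orP[] A /orP[] B];
     (have [h0|h0] := leP 0 h; [rewrite (ger0_norm h0)|rewrite (ltr0_norm h0)]);
     rewrite ler_norml; apply/andP; split; lra.
  rewrite -mulrA -expr2 real_normK ?num_real// ler_wpM2r ?sqr_ge0//.
  by rewrite lerDr addr_ge0.
Qed.

Lemma flat1_gt0 t : (0 < flat 1 t) = (0 < t).
Proof.
rewrite /flat; case: (ltP 0 t) => _; last by rewrite /= ltxx.
by rewrite -polyC1 hornerC mul1r expR_gt0.
Qed.

Lemma flat1_le1 t : 0 <= flat 1 t <= 1.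
Proof.
rewrite /flat; case: ltP => [t0|_]; last by rewrite lexx ler01.
rewrite -polyC1 hornerC mul1r expR_ge0/= -[leRHS](expR0 R) ler_expR.
by rewrite oppr_le0 invr_ge0 ltW.
Qed.

End flat.

(** * An algebra of bump functions stable under derivatives *)

Section tame.
Context {R : realType} {V : normedModType R}.
Implicit Types (f g : V -> R) (df dg : V -> V -> R).

(** A first-order expansion with bounds uniform in the base point. Unlike bare differentiability it
    survives integration against an L^1 function, and so yields differentiation under the integral
    sign. *)
Definition taylor1 f df : Prop :=
  (forall z, linear (df z : V -> R)) /\
  exists2 C : R, 0 <= C & forall z h,
    [/\ `|f z| <= C, `|df z h| <= C * `|h| &
        `|f (z + h) - f z - df z h| <= C * `|h| ^+ 2].

Lemma taylor1_diff f df z : taylor1 f df ->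
  differentiable f z /\ forall v, 'D_v f z = df z v.
Proof.
move=> [lin [C C0 H]].
pose lM := GRing.isLinear.Build R V R *:%R (df z) (lin z).
pose L : {linear V -> R} := HB.pack (df z) lM.
have Lc : continuous L.
  apply: bounded_linear_continuous; apply/linear_boundedP.
  near=> M => x; have [_ Hx _] := H z x; apply: (le_trans Hx).
  by rewrite ler_wpM2r//; near: M; exact: nbhs_pinfty_ge.
have E : f \o shift z = cst (f z) + L +o_ 0 id.
  apply/eqaddoP => e e0; near=> h.
  rewrite /= ![(_ + _ : _ -> _) _]/(_ + _) ![(- _ : _ -> _) _]/(- _) /cst/=.
  apply: (@le_trans _ _ (C * `|h| ^+ 2)).
    have [_ _] := H z h; have -> : f (z + h) - f z - df z h = f (h + z) - (f z + df z h).
      by rewrite opprD addrA (addrC h z).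
    exact.
  rewrite expr2 mulrA ler_wpM2r//.
  apply: (@le_trans _ _ ((C + 1) * `|h|)); first by rewrite ler_wpM2r// lerDl.
  rewrite -ler_pdivlMl ?ltr_wpDl// mulrC.
  by near: h; apply: nbhs0_le; rewrite divr_gt0// ltr_wpDl.
have dE := diff_unique Lc E.
have df0 : differentiable f z by apply/diff_locallyP; rewrite dE.
by split => // v; rewrite deriveE// dE.
Unshelve. all: by end_near. Qed.

(** For [|h|] at most 1 the expansion gives the bound, and for larger [h] the boundedness of [f]
    does. *)
Lemma taylor1_lipschitz f df : taylor1 f df -> exists2 C : R, 0 <= C &
  forall z h, `|f (z + h) - f z| <= C * `|h|.
Proof.
move=> [_ [C C0 H]]; exists (C + C + C); first by rewrite !addr_ge0.
move=> z h; have [h1|h1] := leP `|h| 1.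
  have [_ H1 H2] := H z h.
  rewrite -[f (z + h) - f z](subrK (df z h)) (le_trans (ler_normD _ _))//.
  have : `|h| ^+ 2 <= `|h| by rewrite expr2 ler_piMl.
  move=> /(ler_wpM2l C0) H3; rewrite !mulrDl.
  have : 0 <= C * `|h| by rewrite mulr_ge0.
  lra.
have [H1 _ _] := H z h; have [H2 _ _] := H (z + h) h.
apply: (le_trans (ler_normB _ _)).
apply: (@le_trans _ _ (C + C)); first exact: lerD.
have : C * 1 <= C * `|h| by rewrite ler_wpM2l// ltW.
rewrite mulr1 !mulrDl; have : 0 <= C * `|h| by rewrite mulr_ge0.
lra.
Qed.

Lemma taylor1_cst c : taylor1 (cst c) (fun _ _ => 0).
Proof.
split; first by move=> z a u v; rewrite scaler0 addr0.
exists `|c| => // z h; split => //=.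
  by rewrite normr0 mulr_ge0.
by rewrite subrr subr0 normr0 mulr_ge0// sqr_ge0.
Qed.

Lemma taylor1D f df g dg : taylor1 f df -> taylor1 g dg ->
  taylor1 (fun z => f z + g z) (fun z h => df z h + dg z h).
Proof.
move=> [lf [C C0 Hf]] [lg [D D0 Hg]]; split.
  move=> z a u v; rewrite lf lg scalerDr.
  by rewrite addrACA.
exists (C + D); first exact: addr_ge0.
move=> z h; have [f1 f2 f3] := Hf z h; have [g1 g2 g3] := Hg z h; split.
- exact: le_trans (ler_normD _ _) (lerD f1 g1).
- by rewrite mulrDl; exact: le_trans (ler_normD _ _) (lerD f2 g2).
- rewrite mulrDl; apply: le_trans (lerD f3 g3).
  by rewrite (le_trans _ (ler_normD _ _))// le_eqVlt; apply/orP; left; apply/eqP; congr (`|_|); ring.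
Qed.

Lemma taylor1M f df g dg : taylor1 f df -> taylor1 g dg ->
  taylor1 (fun z => f z * g z) (fun z h => df z h * g z + f z * dg z h).
Proof.
move=> tf tg; have [L L0 HL] := taylor1_lipschitz tg.
move: tf tg => [lf [C C0 Hf]] [lg [D D0 Hg]]; split.
  move=> z a u v; rewrite lf lg.
  by rewrite !scaleRE; ring.
exists (C * D + C * D + C * L); first by rewrite !addr_ge0 ?mulr_ge0.
move=> z h; have [f1 f2 f3] := Hf z h; have [g1 g2 g3] := Hg z h; split.
- rewrite normrM; apply: (@le_trans _ _ (C * D)); first exact: ler_pM.
  by rewrite -addrA lerDl addr_ge0 ?mulr_ge0.
- apply: (le_trans (ler_normD _ _)); rewrite !normrM.
  apply: (@le_trans _ _ ((C * `|h|) * D + C * (D * `|h|))).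
    by rewrite lerD// ler_pM.
  rewrite (_ : _ + _ = (C * D + C * D) * `|h|); last by ring.
  by rewrite ler_wpM2r// lerDl mulr_ge0.
- have [g1' _ _] := Hg (z + h) h.
  (* The middle product is quadratic because [df z h] and the increment of [g] are each of order
     [|h|]; the outer two carry the remainders of [f] and [g]. *)
  rewrite (_ : _ - _ = (f (z + h) - f z - df z h) * g (z + h) +
     df z h * (g (z + h) - g z) + f z * (g (z + h) - g z - dg z h)); last by ring.
  apply: (le_trans (ler_normD _ _)); apply: (le_trans (lerD (ler_normD _ _) (lexx _))).
  rewrite !normrM.
  apply: (@le_trans _ _ ((C * `|h| ^+ 2) * D + (C * `|h|) * (L * `|h|) + C * (D * `|h| ^+ 2))).
    by rewrite !lerD// ler_pM.
  by rewrite le_eqVlt; apply/orP; left; apply/eqP; ring.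
Qed.

Definition bounded_linear (l : V -> R) : Prop :=
  linear l /\ exists2 K : R, 0 <= K & forall v, `|l v| <= K * `|v|.

Lemma taylor1_flat (c b : R) p (l : V -> R) : bounded_linear l ->
  taylor1 (fun z => c * flat p (l z + b))
    (fun z h => c * l h * flat (dflat p) (l z + b)).
Proof.
move=> [ll [K K0 lK]]; have [C C0 H] := flat_taylor p; split.
  by move=> z a u v; rewrite ll !scaleRE; ring.
exists (`|c| * C * (1 + K + K ^+ 2)).
  by rewrite !mulr_ge0// !addr_ge0// sqr_ge0.
have cC : 0 <= `|c| * C by rewrite mulr_ge0.
move=> z h; have [h1 h2 h3] := H (l z + b) (l h); split.
- rewrite normrM; apply: (@le_trans _ _ (`|c| * C)); first by rewrite ler_wpM2l.
  by rewrite ler_peMr// -addrA lerDl addr_ge0// sqr_ge0.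
- rewrite !normrM; apply: (@le_trans _ _ (`|c| * (K * `|h|) * C)).
    by rewrite ler_pM// ?mulr_ge0// ler_wpM2l.
  rewrite (_ : _ * C = `|c| * C * K * `|h|); last by ring.
  rewrite ler_wpM2r// ler_wpM2l//; have := sqr_ge0 K; lra.
- have lD : l (z + h) = l z + l h.
    by have := ll 1 z h; rewrite !scale1r.
  rewrite lD (_ : _ - _ = c * (flat p (l z + b + l h) - flat p (l z + b) -
    flat (dflat p) (l z + b) * l h)); last first.
    by rewrite (addrAC (l z)); ring.
  rewrite normrM; apply: (@le_trans _ _ (`|c| * (C * (K * `|h|) ^+ 2))).
    rewrite ler_wpM2l// (le_trans h3)// ler_wpM2l// -real_normK ?num_real//.
    by rewrite lerXn2r ?nnegrE ?mulr_ge0.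
  rewrite (_ : _ * (C * _) = `|c| * C * K ^+ 2 * `|h| ^+ 2); last by ring.
  by rewrite ler_wpM2r ?sqr_ge0// ler_wpM2l// lerDr addr_ge0.
Qed.

(** The algebra generated by constants and by [flat] of affine forms. By [dflat] and the product
    rule it contains the directional derivatives of its members, so smoothness of all orders follows
    at once. *)
Inductive tame : (V -> R) -> Prop :=
| tame_cst c : tame (cst c)
| tame_flat c b p l : bounded_linear l -> tame (fun z => c * flat p (l z + b))
| tameD f g : tame f -> tame g -> tame (fun z => f z + g z)
| tameM f g : tame f -> tame g -> tame (fun z => f z * g z).

Lemma tame_taylor1 f : tame f ->
  exists2 df, taylor1 f df & forall v, tame (fun z => df z v).
Proof.
elim=> {f} [c|c b p l bl|f g tf [df Tf Df] tg [dg Tg Dg]|f g tf [df Tf Df] tg [dg Tg Dg]].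
- exists (fun _ _ => 0); first exact: taylor1_cst.
  by move=> v; exact: (tame_cst 0).
- exists (fun z h => c * l h * flat (dflat p) (l z + b)); first exact: taylor1_flat.
  by move=> v; exact: tame_flat.
- exists (fun z h => df z h + dg z h); first exact: taylor1D.
  by move=> v; exact: tameD.
- exists (fun z h => df z h * g z + f z * dg z h); first exact: taylor1M.
  by move=> v; apply: tameD; exact: tameM.
Qed.

(** Smooth functions are the largest class of differentiable functions stable under directional
    derivatives, so any class with this stability consists of smooth functions. *)
Lemma smooth_coinduction (S : set (V -> R)) :
  (forall f, S f -> (forall z, differentiable f z) /\ forall v, S ('D_v f)) ->
  forall f, S f -> smooth_on_open setT f.
Proof.
move=> H f Sf vs x _; suff : S (iter_derive vs f) by move=> /H[].
by elim: vs => //= v vs /H[_ +]; exact.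
Qed.

Lemma tame_smooth f : tame f -> smooth_on_open setT f.
Proof.
apply: smooth_coinduction => {}f /tame_taylor1[df Tf Df]; split.
  by move=> z; exact: (taylor1_diff z Tf).1.
move=> v; rewrite (_ : 'D_v f = fun z => df z v); first exact: Df.
by apply/funext => z; exact: (taylor1_diff z Tf).2.
Qed.

Lemma tame_prod (I : Type) (r : seq I) (F : I -> V -> R) : (forall i, tame (F i)) ->
  tame (fun z => \prod_(i <- r) F i z).
Proof.
move=> tF; elim: r => [|i r IH].
  rewrite (_ : (fun _ => _) = cst 1); first exact: tame_cst.
  by apply/funext => z; rewrite big_nil.
rewrite (_ : (fun _ => _) = fun z => F i z * \prod_(i <- r) F i z); first exact: tameM.
by apply/funext => z; rewrite big_cons.
Qed.

End tame.

(** * Borel sets of space-time *)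

Section borel.
Context {R : realType} {n : nat}.
Local Notation V := ('rV[R]_n * R)%type.
Local Notation VT := ('rV[R]_n * measurableTypeR R)%type.

Lemma ball_spacetimeP (z y : V) (e : R) : 0 < e ->
  (forall i, `|z.1 ord0 i - y.1 ord0 i| < e) -> `|z.2 - y.2| < e -> ball z e y.
Proof.
move=> e0 H1 H2; split => //=; split => // i j; rewrite (ord1 i).
exact: H1.
Qed.

Lemma measurable_spacetime_box (c : V) (r s : R) :
  @measurable _ VT [set z : V | (forall i, `|z.1 ord0 i - c.1 ord0 i| < r) /\ `|z.2 - c.2| < s].
Proof.
pose A i : set R := `](c.1 ord0 i - r), (c.1 ord0 i + r)[%classic.
pose B : set R := `](c.2 - s), (c.2 + s)[%classic.
rewrite [X in measurable X](_ : _ = [set x : 'rV[R]_n | forall i, A i (x ord0 i)] `*` B).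
  apply: measurableX; last exact: measurable_itv.
  by apply: measurable_box => i; exact: measurable_itv.
apply/seteqP; split => z /= [z1 z2]; split.
- by move=> i; rewrite /A /= in_itv/= -ltr_distl.
- by rewrite /B /= in_itv/= -ltr_distl.
- by move=> i; have := z1 i; rewrite /A /= in_itv/= -ltr_distl.
- by move: z2; rewrite /B /= in_itv/= -ltr_distl.
Qed.

(** The sigma-algebra is generated by coordinates, so an open set is exhibited as a countable union
    of boxes with rational centres and radii 1 / (k + 1). *)
Lemma open_measurable_spacetime (U : set V) : open U -> @measurable _ VT U.
Proof.
move=> oU.
pose T : Type := (('rV[rat]_n * rat) * nat)%type.
pose ctr (q : T) : V := (map_mx ratr q.1.1, ratr q.1.2).
pose bx (q : T) : set V := [set z : V | (forall i, `|z.1 ord0 i - (ctr q).1 ord0 i| < q.2.+1%:R^-1) /\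
   `|z.2 - (ctr q).2| < q.2.+1%:R^-1].
pose F (q : T) : set VT := if pselect (bx q `<=` U) then bx q else set0.
rewrite [X in measurable X](_ : U = \bigcup_q F q).
  apply: countable_bigcupT_measurable; first exact: countableP.
  move=> q; rewrite /F; case: pselect => sb; last exact: measurable0.
  exact: measurable_spacetime_box.
apply/seteqP; split => [z Uz|z [q _]]; last by rewrite /F; case: pselect => // H /H.
have /nbhs_ballP[e /= e0 eU] : nbhs z U by exact: open_nbhs_nbhs.
(* Two points of a box of radius 1 / (k + 1) differ by less than 2 / (k + 1) in each coordinate, and
   this choice makes that less than [e]. *)
pose k := Num.truncn (2 / e).
have k0 : 0 < k.+1%:R^-1 :> R by rewrite invr_gt0.
have ke : 2 * k.+1%:R^-1 < e.
  rewrite -ltr_pdivlMr// invrK -ltr_pdivrMl// mulrC.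
  by have /andP[] := truncn_itv (ltW (divr_gt0 (ltr0Sn R 1) e0)).
have rd (x : R) : exists q : rat, `|x - ratr q| < k.+1%:R^-1.
  have : x - k.+1%:R^-1 < x + k.+1%:R^-1 by rewrite ltrD2l gtrN.
  by move=> /rat_in_itvoo[q]; rewrite in_itv/= -ltr_distlC => qx; exists q.
have [f fP] := choice rd.
pose q : T := ((\row_i f (z.1 ord0 i), f z.2), k).
have bz : bx q z.
  by split => [i|]; rewrite /ctr/= ?mxE; exact: fP.
exists q => //; rewrite /F; case: pselect => // -[].
move=> y [y1 y2]; case: bz => z1 z2; apply: eU; apply: ball_spacetimeP => //.
  move=> i; apply: le_lt_trans ke; apply: (le_trans (ler_distD ((ctr q).1 ord0 i) _ _)).
  rewrite mulr_natl mulr2n lerD//; first exact/ltW/z1.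
  by rewrite distrC; exact/ltW/y1.
apply: le_lt_trans ke; apply: (le_trans (ler_distD (ctr q).2 _ _)).
rewrite mulr_natl mulr2n lerD//; first exact: ltW.
by rewrite distrC; exact: ltW.
Qed.

Lemma continuous_measurable_spacetime (f : V -> R) : continuous f ->
  measurable_fun [set: VT] f.
Proof.
move=> /continuousP cf; apply: (measurability _ (RGenOpens.measurableE R)).
move=> _ [_ [a [b ->] <-]]; rewrite setTI; apply: open_measurable_spacetime.
exact/cf/interval_open.
Qed.

Lemma measurable_section1 (t : R) : measurable_fun [set: 'rV[R]_n] (fun x : 'rV[R]_n => (x, t) : VT).
Proof.
by apply/measurable_fun_pairP; split; [exact: measurable_id|exact: measurable_cst].
Qed.

Lemma open_measurable_rV (U : set 'rV[R]_n) : open U -> measurable U.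
Proof.
move=> oU.
have oU2 : open ((fst : V -> 'rV[R]_n) @^-1` U).
  by apply: open_comp => // z _; exact: cvg_fst.
rewrite -[X in measurable X]setTI.
exact: (measurable_section1 0 measurableT (open_measurable_spacetime oU2)).
Qed.

Lemma continuous_measurable_rV (f : 'rV[R]_n -> R) : continuous f ->
  measurable_fun [set: 'rV[R]_n] f.
Proof.
move=> /continuousP cf; apply: (measurability _ (RGenOpens.measurableE R)).
move=> _ [_ [a [b ->] <-]]; rewrite setTI; apply: open_measurable_rV.
exact/cf/interval_open.
Qed.

Lemma compact_measurable_rV (K : set 'rV[R]_n) : compact K -> measurable K.
Proof.
move=> /compact_closed cK; rewrite -[X in measurable X]setCK; apply: measurableC.
by apply: open_measurable_rV; apply: closed_openC; apply: cK.
Qed.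

End borel.

Lemma tame_continuous (R : realType) (V : normedModType R) (f : V -> R) :
  tame f -> continuous f.
Proof.
move=> /tame_smooth sf x; apply: differentiable_continuous.
exact: (sf [::] x).
Qed.

(** * Differentiation under the integral sign *)

Section correlation.
Context {R : realType} {n : nat}.
Local Notation V := ('rV[R]_n * R)%type.
Local Notation VT := ('rV[R]_n * measurableTypeR R)%type.
Local Notation mu := (@spacetime R n).

Definition correlation (f k : V -> R) (z : V) : R :=
  (\int[mu]_y (f y * k (y - z)))%R.

Variables (f : V -> R).
Hypothesis intf : mu.-integrable setT (EFin \o f).

Lemma integrable_mul_bounded (g : V -> R) (C : R) : measurable_fun [set: VT] g ->
  (forall y, `|g y| <= C) -> mu.-integrable setT (fun y => (f y * g y)%:E).
Proof.
move=> mg gC; have intC := integrableZl measurableT C intf.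
apply: le_integrable intC => //.
  apply/measurable_EFinP/measurable_funM => //.
  by apply/measurable_EFinP; exact: measurable_int intf.
move=> y _ /=; rewrite lee_fin mulrC !normrM ler_wpM2r//.
by rewrite (le_trans (gC y))// ler_norm.
Qed.

Lemma Rintegral_mul_bounded_le (g : V -> R) (C : R) : measurable_fun [set: VT] g ->
  (forall y, `|g y| <= C) ->
  `|\int[mu]_y (f y * g y)| <= C * \int[mu]_y `|f y|.
Proof.
move=> mg gC; have intfg := integrable_mul_bounded mg gC.
apply: (le_trans (le_normr_Rintegral _ intfg)) => //.
have intn : mu.-integrable setT (EFin \o (fun y => `|f y|)) by exact: integrable_norm.
rewrite -RintegralZl//; apply: le_Rintegral => //.
- by have := integrable_abse intfg; apply: eq_integrable => // y _ /=.
- by have := integrableZl measurableT C intn; apply: eq_integrable => // y _ /=.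
- by move=> y _; rewrite normrM mulrC ler_wpM2r.
Qed.

Lemma tame_measurable_shift (g : V -> R) (z : V) : tame g ->
  measurable_fun [set: VT] (fun y : V => g (y - z)).
Proof.
move=> tg; apply: continuous_measurable_spacetime => y.
apply: (@continuous_comp _ _ _ (fun y : V => y - z) g).
  by apply: continuousB; [exact: cvg_id|exact: cvg_cst].
exact: tame_continuous.
Qed.

(** The expansion of [k] at y - z with increment - h is integrated against [f]; since its constant
    is uniform in y, the result is the same expansion with [C] multiplied by the L^1 norm of [f]. *)
Lemma correlation_taylor1 (k : V -> R) (dk : V -> V -> R) : tame k -> taylor1 k dk ->
  (forall h, tame (fun z => dk z h)) ->
  taylor1 (correlation f k) (fun z h => correlation f (fun y => - dk y h) z).
Proof.
move=> tk [lk [C C0 H]] tdk.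
have mk z := tame_measurable_shift z tk.
have mdk z h : measurable_fun [set: VT] (fun y : V => - dk (y - z) h).
  by apply: measurableT_comp => //; exact: (tame_measurable_shift z (tdk h)).
have intk z : mu.-integrable setT (fun y => (f y * k (y - z))%:E).
  by apply: (integrable_mul_bounded (mk z)) => y; have [+ _ _] := H (y - z) 0; exact.
have intdk z h : mu.-integrable setT (fun y => (f y * (- dk (y - z) h))%:E).
  apply: (integrable_mul_bounded (mdk z h)) => y; have [_ + _] := H (y - z) h.
  by rewrite normrN; exact.
split.
  move=> z a u v; rewrite scaleRE /correlation.
  have i3 : mu.-integrable setT (fun y => (a * (f y * (- dk (y - z) u)))%:E).
    by have := integrableZl measurableT a (intdk z u); apply: eq_integrable => // y _ /=.
  rewrite -(RintegralZl a measurableT (intdk z u)) -(RintegralD measurableT i3 (intdk z v)).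
  by apply: eq_Rintegral => y _; rewrite lk scaleRE; ring.
exists (C * \int[mu]_y `|f y|).
  by rewrite mulr_ge0//; apply: Rintegral_ge0.
move=> z h; split.
- by apply: Rintegral_mul_bounded_le => // y; have [] := H (y - z) 0.
- rewrite mulrAC; apply: Rintegral_mul_bounded_le => // y.
  by have [_ + _] := H (y - z) h; rewrite normrN.
- have i3 : mu.-integrable setT (fun y => (f y * k (y - (z + h)) - f y * k (y - z))%:E).
    by have := integrableB measurableT (intk (z + h)) (intk z); apply: eq_integrable => // y _ /=.
  rewrite /correlation -(RintegralB measurableT (intk (z + h)) (intk z)).
  rewrite -(RintegralB measurableT i3 (intdk z h)) mulrAC.
  rewrite (_ : (fun y => _) = fun y =>
      f y * (k (y - (z + h)) - k (y - z) - (- dk (y - z) h))); last first.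
    by apply/funext => y; ring.
  apply: Rintegral_mul_bounded_le.
    by apply: measurable_funB => //; exact: measurable_funB.
  move=> y; have [_ _] := H (y - z) (- h).
  have -> : dk (y - z) (- h) = - dk (y - z) h.
    have := lk (y - z) (-1) h 0; rewrite addr0 scaleN1r => ->.
    have := lk (y - z) (-1) 0 0; rewrite scaleN1r addr0 oppr0 !scaleRE mulN1r.
    by move=> d0; lra.
  by rewrite normrN opprD addrA.
Qed.

Lemma correlation_smooth (k : V -> R) : tame k ->
  smooth_on_open setT (correlation f k).
Proof.
move=> tk.
apply: (@smooth_coinduction _ _ [set g | exists2 k, tame k & g = correlation f k]); last by exists k.
move=> _ {k tk}[k tk ->]; have [dk Tk tdk] := tame_taylor1 tk.
have Tc := correlation_taylor1 tk Tk tdk.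
split; first by move=> z; exact: (taylor1_diff z Tc).1.
move=> v; exists (fun y => - dk y v).
  have -> : (fun y => - dk y v) = (fun y => cst (-1) y * dk y v).
    by apply/funext => y; rewrite mulN1r.
  by apply: tameM => //; exact: tame_cst.
by apply/funext => z; exact: (taylor1_diff z Tc).2.
Qed.

End correlation.

(** * The parabolic kernel *)

Section beta.
Context {R : realType}.

(** Each factor cuts off one side, so the product vanishes outside (-1, 1) and composes with affine
    forms to a tame function. *)
Definition beta (t : R) : R := flat 1 (1 - t) * flat 1 (1 + t).

Lemma beta_bounds t : 0 <= beta t <= 1.
Proof.
have /andP[a1 a2] := flat1_le1 (1 - t); have /andP[b1 b2] := flat1_le1 (1 + t).
by rewrite /beta mulr_ge0//= mulr_ile1.
Qed.

Lemma beta_ge0 t : 0 <= beta t. Proof. by have /andP[] := beta_bounds t. Qed.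

Lemma beta_neq0 t : beta t != 0 -> `|t| < 1.
Proof.
rewrite /beta mulf_eq0 negb_or => /andP[a b].
have fp (u : R) : flat 1 u != 0 -> 0 < u.
  have /andP[+ _] := flat1_le1 u; rewrite le_eqVlt => /orP[/eqP <-|]; rewrite ?eqxx//.
  by rewrite flat1_gt0.
by have := fp _ a; have := fp _ b; rewrite ltr_norml => ? ?; apply/andP; split; lra.
Qed.

(** Both arguments of [flat 1] are at least 1/2 there, where it is at least exp(-2). An explicit
    lower bound is what the mass estimate needs. *)
Lemma beta_lower t : `|t| <= 2^-1 -> expR (- 2) * expR (- 2) <= beta t.
Proof.
rewrite ler_norml => /andP[t1 t2].
have fl u : 2^-1 <= u -> expR (- 2) <= flat 1 u.
  move=> u2; have u0 : 0 < u by apply: lt_le_trans u2; rewrite invr_gt0.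
  rewrite /flat u0 -polyC1 hornerC mul1r ler_expR lerN2.
  by rewrite -[leRHS]invrK lef_pV2// posrE// invr_gt0.
by apply: ler_pM; rewrite ?expR_ge0//; apply: fl; lra.
Qed.

End beta.

Section tame_beta.
Context {R : realType}.

Lemma tame_beta (V : normedModType R) (l : V -> R) (b : R) :
  bounded_linear l -> tame (fun z => beta (l z + b)).
Proof.
move=> bl; have bl' : bounded_linear (fun z => - l z).
  have [ll [K K0 lK]] := bl; split.
    by move=> a u v; rewrite ll opprD scaleRE scaleRE mulrN.
  by exists K => // v; rewrite normrN.
rewrite (_ : (fun _ => _) = fun z => (1 * flat 1 (- l z + (1 - b))) * (1 * flat 1 (l z + (1 + b)))).
  by apply: tameM; exact: tame_flat.
by apply/funext => z; rewrite /beta !mul1r; congr (flat _ _ * flat _ _); ring.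
Qed.

Lemma coord_norm_le n (x : 'rV[R]_n) i : `|x ord0 i| <= `|x|.
Proof.
rewrite [leRHS]mx_normrE.
exact: (le_bigmax _ (fun ij : 'I_1 * 'I_n => `|x ij.1 ij.2|) (ord0, i)).
Qed.

Lemma bounded_linear_coord n (i : 'I_n) (c : R) :
  bounded_linear (fun x : 'rV[R]_n => x ord0 i * c).
Proof.
split; first by move=> a u v; rewrite !mxE scaleRE mulrDl mulrA.
by exists `|c| => // v; rewrite normrM mulrC ler_wpM2l// coord_norm_le.
Qed.

Lemma bounded_linear_space n (i : 'I_n) (c : R) :
  bounded_linear (fun z : 'rV[R]_n * R => z.1 ord0 i * c).
Proof.
split; first by move=> a u v; rewrite !mxE scaleRE mulrDl mulrA.
exists `|c| => // v; rewrite normrM mulrC ler_wpM2l//.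
by rewrite (le_trans (coord_norm_le _ _))// prod_normE le_max lexx.
Qed.

Lemma bounded_linear_time n (c : R) :
  bounded_linear (fun z : 'rV[R]_n * R => z.2 * c).
Proof.
split; first by move=> a u v; rewrite /= scaleRE mulrDl !scaleRE mulrA.
exists `|c| => // v; rewrite normrM mulrC ler_wpM2l//.
by rewrite prod_normE le_max lexx orbT.
Qed.

End tame_beta.

Section parabolic_kernel.
Context {R : realType} {n : nat}.
Local Notation V := ('rV[R]_n * R)%type.
Local Notation VT := ('rV[R]_n * measurableTypeR R)%type.
Local Notation mu := (@spacetime R n).

Definition cube (r : R) : set 'rV[R]_n :=
  [set x | forall i, `[- r, r]%classic (x ord0 i)].

Lemma measurable_cube r : measurable (cube r).
Proof.
by apply: (@measurable_box R n (fun=> `[- r, r]%classic)) => i; exact: measurable_itv.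
Qed.

Definition closed_box (r s : R) : set V :=
  [set z : V | (forall i, `|z.1 ord0 i| <= r) /\ `|z.2| <= s].

Lemma closed_boxE (r s : R) : closed_box r s =
  cube r `*` `[- s, s]%classic.
Proof.
apply/seteqP; split => z /= [z1 z2]; split.
- by move=> i; rewrite /= in_itv/= -ler_norml.
- by rewrite /= in_itv/= -ler_norml.
- by move=> i; have := z1 i; rewrite /= in_itv/= -ler_norml.
- by move: z2; rewrite /= in_itv/= -ler_norml.
Qed.

Lemma lebesgue_measure_cc (r : R) : 0 <= r -> lebesgue_measure `[- r, r] = (2 * r)%:E.
Proof.
move=> r0; rewrite lebesgue_measure_itv/= lte_fin -EFinB opprK.
by case: ltP => h; congr EFin; lra.
Qed.

Lemma lebesgue_rV_cube (r : R) : 0 <= r ->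
  lebesgue_rV n (cube r) = ((2 * r) ^+ n)%:E.
Proof.
move=> r0; rewrite (@lebesgue_rV_box R n (fun=> `[- r, r]%classic)).
  under eq_bigr do rewrite (lebesgue_measure_cc r0).
  by rewrite prodEFin prodr_const card_ord.
by move=> i; exact: measurable_itv.
Qed.

Lemma measurable_closed_box r s : @measurable _ VT (closed_box r s).
Proof.
rewrite closed_boxE; apply: measurableX; [exact: measurable_cube|exact: measurable_itv].
Qed.

Lemma closed_box_measure r s : 0 <= r -> 0 <= s ->
  mu (closed_box r s) = ((2 * r) ^+ n * (2 * s))%:E.
Proof.
move=> r0 s0; rewrite closed_boxE.
transitivity (lebesgue_rV n (cube r) *
   lebesgue_measure (`[(- s)%R, s]%classic : set R))%E.
  by apply: sprodE; [exact: measurable_cube|exact: measurable_itv].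
by rewrite lebesgue_rV_cube// EFinM; congr (_ * _)%E; exact: lebesgue_measure_cc.
Qed.

Definition bump_space (u : 'rV[R]_n) : R := \prod_(i < n) beta (u ord0 i).

Definition parabolic_bump (e : R) (z : V) : R :=
  bump_space (e^-1 *: z.1) * beta (z.2 * (e ^+ 2)^-1).

Lemma tame_bump_space : tame bump_space.
Proof.
apply: tame_prod => i.
rewrite (_ : (fun _ => _) = fun x : 'rV[R]_n => beta (x ord0 i * 1 + 0)).
  by apply: tame_beta; exact: bounded_linear_coord.
by apply/funext => x; rewrite mulr1 addr0.
Qed.

Lemma tame_bump e : tame (parabolic_bump e).
Proof.
apply: tameM.
  rewrite /bump_space; apply: tame_prod => i.
  rewrite (_ : (fun _ => _) = fun x : V => beta (x.1 ord0 i * e^-1 + 0)).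
    by apply: tame_beta; exact: bounded_linear_space.
  by apply/funext => x; rewrite mxE mulrC addr0.
rewrite (_ : (fun _ => _) = fun x : V => beta (x.2 * (e ^+ 2)^-1 + 0)).
  by apply: tame_beta; exact: bounded_linear_time.
by apply/funext => x; rewrite addr0.
Qed.

Lemma bump_space_ge0 u : 0 <= bump_space u.
Proof. by apply: prodr_ge0 => i _; exact: beta_ge0. Qed.

Lemma bump_space_le1 u : bump_space u <= 1.
Proof.
have /andP[//] : 0 <= bump_space u <= 1.
apply: (big_ind (fun y : R => 0 <= y <= 1)).
- by rewrite ler01 lexx.
- by move=> x y /andP[x0 x1] /andP[y0 y1]; rewrite mulr_ge0//= mulr_ile1.
- by move=> i _; exact: beta_bounds.
Qed.

Lemma bump_space_neq0 u : bump_space u != 0 -> forall i, `|u ord0 i| < 1.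
Proof. by move=> /prodf_neq0 H i; apply: beta_neq0; exact: H. Qed.

Lemma bump_ge0 e z : 0 <= parabolic_bump e z.
Proof. by rewrite mulr_ge0// ?bump_space_ge0 ?beta_ge0. Qed.

Lemma bump_le1 e z : parabolic_bump e z <= 1.
Proof.
by rewrite mulr_ile1 ?bump_space_ge0 ?beta_ge0 ?bump_space_le1//; have /andP[] := beta_bounds (z.2 * (e ^+ 2)^-1).
Qed.

Lemma bump_neq0 e z : 0 < e -> parabolic_bump e z != 0 ->
  (forall i, `|z.1 ord0 i| < e) /\ `|z.2| < e ^+ 2.
Proof.
move=> e0; rewrite /parabolic_bump mulf_eq0 negb_or => /andP[/bump_space_neq0 h1 /beta_neq0 h2].
split.
  move=> i; have := h1 i; rewrite mxE normrM gtr0_norm ?invr_gt0//.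
  by rewrite mulrC ltr_pdivrMr// mul1r.
have e20 : 0 < e ^+ 2 by rewrite exprn_gt0.
by move: h2; rewrite normrM (gtr0_norm (_ : 0 < (e ^+ 2)^-1)) ?invr_gt0// ltr_pdivrMr// mul1r.
Qed.

Lemma measurable_bump e : measurable_fun [set: VT] (parabolic_bump e).
Proof. by apply: continuous_measurable_spacetime; apply: tame_continuous; exact: tame_bump. Qed.

Let b0 : R := expR (- 2) * expR (- 2).

Lemma bump_lower e z : 0 < e -> closed_box (e / 2) (e ^+ 2 / 2) z -> b0 ^+ n * b0 <= parabolic_bump e z.
Proof.
move=> e0 [z1 z2].
have b00 : 0 <= b0 by rewrite mulr_ge0// expR_ge0.
apply: ler_pM => //; first exact: exprn_ge0.
  rewrite -[n in b0 ^+ n]card_ord -prodr_const; apply: ler_prod => i _.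
  rewrite b00/=; apply: beta_lower; rewrite mxE normrM gtr0_norm ?invr_gt0//.
  by rewrite mulrC ler_pdivrMr// mulrC; exact: z1.
have e20 : 0 < e ^+ 2 by rewrite exprn_gt0.
apply: beta_lower; rewrite normrM (gtr0_norm (_ : 0 < (e ^+ 2)^-1)) ?invr_gt0//.
by rewrite ler_pdivrMr// mulrC.
Qed.

Definition bump_mass e : R := fine (\int[mu]_z (parabolic_bump e z)%:E)%E.

Lemma bump_mass_EFin e : 0 < e -> (\int[mu]_z (parabolic_bump e z)%:E)%E = (bump_mass e)%:E.
Proof.
move=> e0; rewrite fineK// ge0_fin_numE; last first.
  by apply: integral_ge0 => z _; rewrite lee_fin bump_ge0.
apply: (@le_lt_trans _ _ (\int[mu]_z (\1_(closed_box e (e ^+ 2)) z)%:E)%E).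
  apply: ge0_le_integral => //=.
  - by move=> z _; rewrite lee_fin bump_ge0.
  - by apply/measurable_EFinP; exact: measurable_bump.
  - by apply/measurable_EFinP/measurable_indic; exact: measurable_closed_box.
  - move=> z _; rewrite lee_fin indicE.
    have [->|h] := eqVneq (parabolic_bump e z) 0; first by rewrite ler0n.
    rewrite mem_set ?bump_le1//; have [z1 z2] := bump_neq0 e0 h.
    by split => [i|]; exact: ltW.
rewrite integral_indic//; last exact: measurable_closed_box.
by rewrite setIT [ltLHS]closed_box_measure ?ltry// ?ltW// exprn_gt0.
Qed.

(** The bump is at least [b0 ^+ n * b0] on the box of half-sides e / 2 and e^2 / 2, whose measure is
    exactly e^(n+2). After normalisation this is the supremum bound of order e^-(n+2). *)
Lemma bump_mass_lower e : 0 < e -> b0 ^+ n * b0 * e ^+ (n + 2) <= bump_mass e.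
Proof.
move=> e0; rewrite -lee_fin -bump_mass_EFin//.
have b00 : 0 <= b0 ^+ n * b0 by rewrite mulr_ge0 ?exprn_ge0 ?mulr_ge0 ?expR_ge0.
apply: (@le_trans _ _ (\int[mu]_z (b0 ^+ n * b0 * \1_(closed_box (e / 2) (e ^+ 2 / 2)) z)%:E)%E).
  under eq_integral do rewrite EFinM.
  rewrite ge0_integralZl//; last first.
    by apply/measurable_EFinP/measurable_indic; exact: measurable_closed_box.
  rewrite integral_indic//; last exact: measurable_closed_box.
  rewrite setIT [X in (_ <= _ * X)%E]closed_box_measure ?divr_ge0 ?exprn_ge0 ?(ltW e0)//.
  rewrite -EFinM lee_fin ler_wpM2l// exprD.
  by rewrite [2 * (e / 2)]mulrC divfK// [2 * _]mulrC divfK.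
apply: ge0_le_integral => //=.
- by move=> z _; rewrite lee_fin mulr_ge0.
- apply/measurable_EFinP/measurable_funM => //; apply: measurable_indic.
  exact: measurable_closed_box.
- by apply/measurable_EFinP; exact: measurable_bump.
- move=> z _; rewrite lee_fin indicE; case: (boolP (_ \in _)) => [/set_mem zb|_].
    by rewrite mulr1; exact: bump_lower.
  by rewrite mulr0 bump_ge0.
Qed.

Lemma bump_mass_gt0 e : 0 < e -> 0 < bump_mass e.
Proof.
move=> e0; apply: lt_le_trans (bump_mass_lower e0).
by rewrite !mulr_gt0 ?exprn_gt0 ?mulr_gt0 ?expR_gt0.
Qed.

(** The bump is divided by its own mass, so that total mass 1 is immediate and no scaling law for
    the integral has to be established. *)
Definition parabolic_kernel (e : R) (z : V) : R := (bump_mass e)^-1 * parabolic_bump e z.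

Lemma tame_kernel e : tame (parabolic_kernel e).
Proof. by apply: tameM; [exact: tame_cst|exact: tame_bump]. Qed.

Lemma measurable_kernel e : measurable_fun [set: VT] (parabolic_kernel e).
Proof. by apply: continuous_measurable_spacetime; apply: tame_continuous; exact: tame_kernel. Qed.

Lemma kernel_ge0 e z : 0 < e -> 0 <= parabolic_kernel e z.
Proof. by move=> e0; rewrite mulr_ge0 ?bump_ge0// invr_ge0 ltW// bump_mass_gt0. Qed.

Lemma kernel_neq0 e z : 0 < e -> parabolic_kernel e z != 0 ->
  (forall i, `|z.1 ord0 i| < e) /\ `|z.2| < e ^+ 2.
Proof. by move=> e0; rewrite mulf_eq0 negb_or => /andP[_]; exact: bump_neq0. Qed.

Lemma integral_kernel e : 0 < e -> (\int[mu]_z (parabolic_kernel e z)%:E = 1)%E.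
Proof.
move=> e0; under eq_integral do rewrite EFinM.
rewrite ge0_integralZl//=; last 3 first.
- by apply/measurable_EFinP; exact: measurable_bump.
- by move=> z _; rewrite lee_fin bump_ge0.
- by rewrite lee_fin invr_ge0 ltW// bump_mass_gt0.
by rewrite bump_mass_EFin// -EFinM mulVf// gt_eqF// bump_mass_gt0.
Qed.

Definition kernel_const : R := (b0 ^+ n * b0)^-1.

Lemma kernel_const_gt0 : 0 < kernel_const.
Proof. by rewrite invr_gt0 !mulr_gt0 ?exprn_gt0 ?mulr_gt0 ?expR_gt0. Qed.

Lemma bump_mass_inv_le e : 0 < e -> (bump_mass e)^-1 <= kernel_const * (e ^+ (n + 2))^-1.
Proof.
move=> e0; rewrite -invfM lef_pV2 ?posrE ?bump_mass_gt0//; last first.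
  by rewrite !mulr_gt0 ?exprn_gt0 ?mulr_gt0 ?expR_gt0.
exact: bump_mass_lower.
Qed.

Lemma kernel_le e z : 0 < e -> parabolic_kernel e z <= kernel_const * (e ^+ (n + 2))^-1.
Proof.
move=> e0; apply: le_trans (bump_mass_inv_le e0).
by rewrite ler_piMr ?bump_le1// invr_ge0 ltW// bump_mass_gt0.
Qed.

End parabolic_kernel.

(** A radius good for [x] stays good, when halved, for all points near [x]; compactness, in the form
    of near coverings, makes it uniform. *)
Lemma compact_open_margin (R : realType) (V : normedModType R) (K U : set V) :
  compact K -> open U -> K `<=` U ->
  exists2 d : R, 0 < d & forall x h, K x -> `|h| < d -> U (x + h).
Proof.
move=> cK oU KU.
have /compact_near_coveringP cov := cK.
pose P (d : R) (x : V) := forall h, `|h| < d -> U (x + h).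
have : \forall d \near 0^'+, K `<=` P d.
  apply: cov => x Kx.
  have /nbhs_ballP[e /= e0 eU] : nbhs x U by apply: open_nbhs_nbhs; split => //; exact: KU.
  near=> y d => h /= hd; apply: eU; rewrite -ball_normE/= opprD addrA.
  apply: (le_lt_trans (ler_normB _ _)); rewrite [ltRHS]splitr ltrD//.
    near: y; have nb : nbhs x (ball x (e / 2)) by apply: nbhsx_ballx; rewrite divr_gt0.
    by apply: filterS nb => y; rewrite -ball_normE.
  apply: (lt_le_trans hd); near: d.
  by apply: nbhs_right_le; rewrite divr_gt0.
move=> H; near (0 : R)^'+ => d; exists d; first by near: d; exact: nbhs_right_gt.
move=> x h Kx hd; have : K `<=` P d by near: d.
by move=> /(_ x Kx); exact.
Unshelve. all: by end_near. Qed.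

(** * Euclidean norm and Euclidean balls *)

Section enorm.
Context {R : realType} {n : nat}.
Implicit Types x y : 'rV[R]_n.

Lemma enorm_ge0 x : 0 <= enorm x. Proof. exact: sqrtr_ge0. Qed.

Lemma coord_le_enorm x i : `|x ord0 i| <= enorm x.
Proof.
rewrite -sqrtr_sqr ler_wsqrtr// (bigD1 i)//= lerDl.
by apply: sumr_ge0 => j _; exact: sqr_ge0.
Qed.

Lemma enorm_le_sum x : enorm x <= \sum_(i < n) `|x ord0 i|.
Proof.
have s0 : 0 <= \sum_(i < n) `|x ord0 i| by apply: sumr_ge0.
rewrite -[leRHS]ger0_norm// -sqrtr_sqr ler_wsqrtr//.
rewrite expr2 mulr_suml; apply: ler_sum => i _.
rewrite -real_normK ?num_real// expr2 ler_wpM2l// (bigD1 i)//= lerDl.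
by apply: sumr_ge0.
Qed.

Lemma continuous_enorm : continuous (@enorm R n).
Proof.
move=> x; apply: (@continuous_comp _ _ _ (fun x : 'rV[R]_n => \sum_(i < n) x ord0 i ^+ 2) Num.sqrt).
  apply: (@cvg_big R _ +%R 0 xpredT add_continuous _ (nbhs x) _
    (fun i (x : 'rV[R]_n) => x ord0 i ^+ 2) (fun i => x ord0 i ^+ 2)) => i _; apply: (@continuous_comp _ _ _ (fun x : 'rV[R]_n => x ord0 i) (fun t => t ^+ 2)).
    exact: coord_continuous.
  exact: exprn_continuous.
exact: sqrt_continuous.
Qed.

Lemma measurable_enorm : measurable_fun [set: 'rV[R]_n] (@enorm R n).
Proof. by apply: continuous_measurable_rV; exact: continuous_enorm. Qed.

Lemma continuous_enormB c : continuous (fun x => enorm (x - c)).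
Proof.
move=> x; apply: (@continuous_comp _ _ _ (fun x => x - c) (@enorm R n)).
  by apply: (@continuousB _ _ _ (fun x => x) (cst c)); [exact: cvg_id|exact: cst_continuous].
exact: continuous_enorm.
Qed.

Lemma open_eball c (r : R) : open [set x : 'rV[R]_n | enorm (x - c) < r].
Proof.
have oi : open (`]-oo, r[%classic : set R) by exact: interval_open.
have := @continuous_enormB c => /continuousP/(_ _ oi).
rewrite (_ : _ @^-1` _ = [set x : 'rV[R]_n | enorm (x - c) < r])//.
Qed.

Lemma compact_eball c (r : R) : compact [set x : 'rV[R]_n | enorm (x - c) <= r].
Proof.
apply: bounded_closed_compact.
  exists (r + `|c|); split; first by rewrite num_real.
  move=> M rM x /= xr; apply: ltW; apply: le_lt_trans rM.
  rewrite -[x in `|x|](subrK c) (le_trans (ler_normD _ _))// lerD2r.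
  have [->|/eqP xc] := eqVneq (x - c) 0.
    by rewrite normr0; apply: le_trans xr; exact: enorm_ge0.
  apply: le_trans xr; rewrite [leLHS]mx_normrE; apply/bigmax_leP; split; first exact: enorm_ge0.
  by move=> [i j] _ /=; rewrite (ord1 i); exact: coord_le_enorm.
have ci : closed (`]-oo, r]%classic : set R) by exact: interval_closed.
have /continuous_closedP/(_ _ ci) := @continuous_enormB c.
rewrite (_ : _ @^-1` _ = [set x : 'rV[R]_n | enorm (x - c) <= r])//.
Qed.

Lemma euclidean_ball_open (B : set 'rV[R]_n) : is_euclidean_ball B -> open B.
Proof. by move=> [c [r [_ ->]]]; exact: open_eball. Qed.

Lemma euclidean_ball_nonempty (B : set 'rV[R]_n) : is_euclidean_ball B -> exists x, B x.
Proof.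
move=> [x [r [r0 ->]]]; exists x; rewrite /= subrr (_ : enorm 0 = 0)//.
by rewrite /enorm big1 ?sqrtr0// => i _; rewrite mxE expr0n.
Qed.

Lemma euclidean_ball_measurable (B : set 'rV[R]_n) : is_euclidean_ball B -> measurable B.
Proof. by move=> /euclidean_ball_open; exact: open_measurable_rV. Qed.

Lemma lebesgue_rV_ball_lty (B : set 'rV[R]_n) : is_euclidean_ball B ->
  (lebesgue_rV n B < +oo)%E.
Proof.
move=> bB; have mB := euclidean_ball_measurable bB; case: bB => c [r [r0 BE]].
pose A i : set R := `[c ord0 i - r, c ord0 i + r]%classic.
apply: (@le_lt_trans _ _ (lebesgue_rV n [set x : 'rV[R]_n | forall i, A i (x ord0 i)])).
  apply: le_measure; rewrite ?inE//.
    by apply: measurable_box => i; exact: measurable_itv.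
  rewrite BE => x /= xr i; rewrite /A/= in_itv/= -ler_distl.
  by apply: ltW; apply: le_lt_trans xr; have := coord_le_enorm (x - c) i; rewrite !mxE.
rewrite lebesgue_rV_box; last by move=> i; exact: measurable_itv.
under eq_bigr do rewrite lebesgue_measure_itv/= lte_fin ltrD2l gtrN// -EFinB.
by rewrite prodEFin ltry.
Qed.

End enorm.

(** * Spatial bumps as test functions *)

Section spatial_kernel.
Context {R : realType} {n : nat}.
Local Notation leb := (lebesgue_rV n).
Local Notation X := 'rV[R]_n.

(** The spatial factor of the kernel, wanted by itself twice: as mollifier in the fundamental lemma,
    and as time slice of the parabolic kernel. *)
Definition sbump (e : R) (x : X) : R := bump_space (e^-1 *: x).

Lemma tame_sbump_affine e (x : X) : tame (fun y => sbump e (y - x)).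
Proof.
rewrite /sbump /bump_space; apply: tame_prod => i.
rewrite (_ : (fun _ => _) = fun y : X => beta (y ord0 i * e^-1 + (- x ord0 i * e^-1))).
  by apply: tame_beta; exact: bounded_linear_coord.
by apply/funext => y; rewrite !mxE; congr beta; ring.
Qed.

Lemma tame_sbump e : tame (sbump e).
Proof.
by have := tame_sbump_affine e 0; under eq_fun do rewrite subr0.
Qed.

Lemma measurable_sbump e : measurable_fun setT (sbump e).
Proof. by apply: continuous_measurable_rV; apply: tame_continuous; exact: tame_sbump. Qed.

Lemma sbump_neq0 e x : 0 < e -> sbump e x != 0 -> forall i, `|x ord0 i| < e.
Proof.
move=> e0 /bump_space_neq0 H i; have := H i.
by rewrite mxE normrM gtr0_norm ?invr_gt0// mulrC ltr_pdivrMr// mul1r.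
Qed.

Lemma compact_translated_cube (x : X) e : compact [set y : X | forall i, `|y ord0 i - x ord0 i| <= e].
Proof.
rewrite (_ : [set _ | _] = [set y : X | forall i, `[x ord0 i - e, x ord0 i + e]%classic (y ord0 i)]).
  by apply: (rV_compact (A := fun i => `[x ord0 i - e, x ord0 i + e]%classic)) => i; exact: segment_compact.
by apply/seteqP; split => y /= H i; have := H i; rewrite /= in_itv/= ler_distl.
Qed.

Lemma supp_sbump (e : R) (x : X) (c : R) : 0 < e ->
  closure [set y : X | c * sbump e (y - x) != 0] `<=` [set y : X | forall i, `|y ord0 i - x ord0 i| <= e].
Proof.
move=> e0.
rewrite [X in _ `<=` X](closure_id _).1; last first.
  by apply: compact_closed; [exact: norm_hausdorff|exact: compact_translated_cube].
apply: closure_subset => z /=; rewrite mulf_eq0 negb_or => /andP[_ /(sbump_neq0 e0) H] i.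
by have := H i; rewrite !mxE => /ltW.
Qed.

Lemma test_function_sbump (U : set X) (e c : R) (x : X) : 0 < e ->
  (forall y : X, (forall i, `|y ord0 i - x ord0 i| <= e) -> U y) ->
  test_function U (fun y => c * sbump e (y - x)).
Proof.
move=> e0 HU; split.
- by apply: tame_smooth; apply: tameM; [exact: tame_cst|exact: tame_sbump_affine].
- apply: (@subclosed_compact _ _ [set y : X | forall i, `|y ord0 i - x ord0 i| <= e]).
  + exact: closed_closure.
  + exact: compact_translated_cube.
  + exact: supp_sbump.
- by move=> y /(supp_sbump e0); exact: HU.
Qed.

Lemma sbump_mass e : 0 < e -> exists2 M : R, 0 < M &
  (\int[leb]_x (sbump e x)%:E)%E = M%:E.
Proof.
move=> e0.
have fin : (\int[leb]_x (sbump e x)%:E < +oo)%E.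
  apply: (@le_lt_trans _ _ (\int[leb]_x (\1_(cube e) x)%:E)%E).
    apply: ge0_le_integral => //=.
    - by move=> z _; rewrite lee_fin bump_space_ge0.
    - by apply/measurable_EFinP; exact: measurable_sbump.
    - by apply/measurable_EFinP/measurable_indic; exact: measurable_cube.
    - move=> z _; rewrite lee_fin indicE.
      have [->|h] := eqVneq (sbump e z) 0; first by rewrite ler0n.
      rewrite mem_set ?bump_space_le1// => i; rewrite /= in_itv/= -ler_norml.
      exact/ltW/sbump_neq0.
  rewrite integral_indic//; last exact: measurable_cube.
  by rewrite setIT [ltLHS]lebesgue_rV_cube ?ltry// ltW.
have I0 : (0 <= \int[leb]_x (sbump e x)%:E)%E.
  by apply: integral_ge0 => x _; rewrite lee_fin bump_space_ge0.
exists (fine (\int[leb]_x (sbump e x)%:E)%E); last by rewrite fineK// ge0_fin_numE.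
rewrite fine_gt0// fin andbT.
pose b0 : R := expR (- 2) * expR (- 2).
have b00 : 0 < b0 ^+ n by rewrite exprn_gt0// mulr_gt0// expR_gt0.
apply: (@lt_le_trans _ _ (\int[leb]_x (b0 ^+ n * \1_(cube (e / 2)) x)%:E)%E).
  under eq_integral do rewrite EFinM.
  rewrite ge0_integralZl//; last 2 first.
  - by apply/measurable_EFinP/measurable_indic; exact: measurable_cube.
  - by rewrite lee_fin ltW.
  rewrite integral_indic//; last exact: measurable_cube.
  rewrite setIT [X in (_ < _ * X)%E]lebesgue_rV_cube ?divr_ge0 ?(ltW e0)// -EFinM lte_fin.
  by rewrite mulr_gt0// exprn_gt0// mulr_gt0// divr_gt0.
apply: ge0_le_integral => //=.
- by move=> z _; rewrite lee_fin mulr_ge0// ltW.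
- by apply/measurable_EFinP/measurable_funM => //; apply: measurable_indic; exact: measurable_cube.
- by apply/measurable_EFinP; exact: measurable_sbump.
- move=> z _; rewrite lee_fin indicE; case: (boolP (_ \in _)) => [/set_mem zb|_]; last first.
    by rewrite mulr0 bump_space_ge0.
  rewrite mulr1 -[n in b0 ^+ n]card_ord -prodr_const; apply: ler_prod => i _.
  rewrite mulr_ge0 ?expR_ge0//=; apply: beta_lower; rewrite mxE normrM gtr0_norm ?invr_gt0//.
  rewrite mulrC ler_pdivrMr// mulrC; have := zb i.
  by rewrite /= in_itv/= -ler_norml.
Qed.

End spatial_kernel.

(** * Weak gradients *)

Section test_functions.
Context {R : realType} {n : nat}.
Local Notation leb := (lebesgue_rV n).
Local Notation X := 'rV[R]_n.

Lemma test_function_continuous (U : set X) (phi : X -> R) :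
  test_function U phi -> continuous phi.
Proof. by move=> [s _ _] x; apply: differentiable_continuous; exact: (s [::] x). Qed.

Lemma test_function_measurable (U : set X) (phi : X -> R) :
  test_function U phi -> measurable_fun setT phi.
Proof. by move=> /test_function_continuous; exact: continuous_measurable_rV. Qed.

Lemma test_function_bounded (U : set X) (phi : X -> R) :
  test_function U phi -> exists2 M : R, 0 <= M & forall x, `|phi x| <= M.
Proof.
move=> tphi; have cphi := test_function_continuous tphi; case: tphi => _ cs _.
have : compact (phi @` closure [set x | phi x != 0]).
  by apply: continuous_compact => //; exact: continuous_subspaceT.
move=> /compact_bounded[M [_ HM]]; exists (`|M| + 1); first by rewrite addr_ge0.
move=> x; have [->|px] := eqVneq (phi x) 0; first by rewrite normr0 addr_ge0.
apply: (HM (`|M| + 1)); first by rewrite (le_lt_trans (ler_norm _))// ltrDl.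
by exists x => //; exact: subset_closure.
Qed.

Lemma test_function_out (U : set X) (phi : X -> R) x :
  test_function U phi -> ~ U x -> phi x = 0.
Proof.
move=> [_ _ sU] nUx; apply/eqP; apply: contra_notT nUx => px.
by apply: sU; exact: subset_closure.
Qed.

Lemma derive_supp (V : normedModType R) (phi : V -> R) v x :
  'D_v phi x != 0 -> closure [set y | phi y != 0] x.
Proof.
apply: contra_neqP => nx.
have -> : 0 = 'D_v (cst 0 : V -> R) x by rewrite derive_cst.
apply: near_eq_derive.
have : nbhs x (~` closure [set y | phi y != 0]).
  apply: open_nbhs_nbhs; split => //; apply: closed_openC; exact: closed_closure.
apply: filterS => y ny /=; apply/eqP; apply: contra_notT ny => py.
exact: subset_closure.
Qed.

Lemma iter_derive_rcons (V : normedModType R) vs v (phi : V -> R) :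
  iter_derive (rcons vs v) phi = iter_derive vs ('D_v phi).
Proof. by elim: vs => //= u vs ->. Qed.

Lemma test_function_derive (U : set X) (phi : X -> R) v :
  test_function U phi -> test_function U ('D_v phi).
Proof.
move=> [s cs sU].
have sub : closure [set x | 'D_v phi x != 0] `<=` closure [set x | phi x != 0].
  rewrite [X in _ `<=` X](closure_id _).1; last exact: closed_closure.
  by apply: closure_subset => x; exact: derive_supp.
split.
- by move=> vs x _; rewrite -iter_derive_rcons; exact: s.
- by apply: subclosed_compact cs sub; exact: closed_closure.
- exact: subset_trans sub sU.
Qed.

Lemma test_function_integrable (U : set X) (phi g : X -> R) : measurable U ->
  loc_integrable U g -> test_function U phi ->
  leb.-integrable U (fun x => (g x * phi x)%:E).
Proof.
move=> mU lg tphi; have [M M0 HM] := test_function_bounded tphi.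
have mphi := test_function_measurable tphi.
case: (tphi) => _ cs sU; set K := closure _ in cs sU.
have iK := lg K cs sU; have mK : measurable K by exact: compact_measurable_rV.
have iK2 : leb.-integrable K (fun x => (g x * phi x)%:E).
  have intC := integrableZl mK M iK; apply: le_integrable intC => //.
    apply/measurable_EFinP/measurable_funM.
      by apply/measurable_EFinP; exact: measurable_int iK.
    exact: measurable_funTS.
  move=> x _ /=; rewrite lee_fin mulrC !normrM ler_wpM2r//.
  by rewrite (le_trans (HM x))// ler_norm.
have := (integrable_mkcond _ mK).1 iK2.
have -> : (fun x => (g x * phi x)%:E) \_ K = (fun x => (g x * phi x)%:E) \_ U.
  apply/funext => x; rewrite !patchE; case: ifPn => [/set_mem Kx|/negP nK].
    by rewrite mem_set//; exact: sU.
  case: ifPn => // _; have [->|px] := eqVneq (phi x) 0; first by rewrite mulr0.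
  by exfalso; apply: nK; apply/mem_set; exact: subset_closure.
by move=> /(integrable_mkcond _ mU).2.
Qed.

Lemma loc_integrableB (U : set X) (g h : X -> R) :
  loc_integrable U g -> loc_integrable U h -> loc_integrable U (fun x => g x - h x).
Proof.
move=> lg lh K cK KU; have mK : measurable K by exact: compact_measurable_rV.
have := integrableB mK (lg K cK KU) (lh K cK KU).
by apply: eq_integrable => // x _ /=.
Qed.

End test_functions.

(** * The fundamental lemma and uniqueness of weak gradients *)

Section fundamental.
Context {R : realType} {n : nat}.
Local Notation leb := (lebesgue_rV n).
Local Notation X := 'rV[R]_n.

Lemma norm_le_coord (x : X) (e : R) : 0 <= e -> (forall i, `|x ord0 i| <= e) -> `|x| <= e.
Proof.
move=> e0 H; rewrite [leLHS]mx_normrE; apply/bigmax_leP; split => //.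
by move=> [i j] _ /=; rewrite (ord1 i).
Qed.

(** The function is cut at the radius [t] to become integrable. At small scale its mollification at
    a point of the ball of radius [s] is an integral of [g] against a test function, hence zero,
    while it is close to the cut function in L^1. The gap between [s] and [t] leaves room for the
    kernel. *)
Let fundamental_step (c : X) (r s t : R) (g : X -> R) : s < t -> t < r ->
  let B := [set x | enorm (x - c) < r] in
  loc_integrable B g ->
  (forall phi, test_function B phi -> \int[leb]_(x in B) (g x * phi x) = 0) ->
  {ae leb, forall x, enorm (x - c) <= s -> g x = 0}.
Proof.
move=> st tr B lg H.
pose K := [set x : X | enorm (x - c) <= s]; pose K' := [set x : X | enorm (x - c) <= t].
have cK : compact K by exact: compact_eball.
have cK' : compact K' by exact: compact_eball.
have mK : measurable K by exact: compact_measurable_rV.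
have mK' : measurable K' by exact: compact_measurable_rV.
have K'B : K' `<=` B by move=> x /= /le_lt_trans; apply.
have mB : measurable B by apply: open_measurable_rV; exact: open_eball.
pose f := g \_ K'.
have intf : leb.-integrable setT (EFin \o f).
  by have := (integrable_mkcond _ mK').1 (lg K' cK' K'B); rewrite restrict_EFin.
have mf : measurable_fun setT f by apply/measurable_EFinP; exact: measurable_int intf.
have [tr1 bS sr] := regular_shift_rV R n.
have scf := integrable_shift_continuous tr1 bS sr intf.
have key e : 0 < e -> (\int[leb]_(x in K) `|f x|%:E <= e%:E)%E.
  move=> e0; have [r0 r00 Hr0] := scf e e0.
  have oU : open [set x : X | enorm (x - c) < t] by exact: open_eball.
  have [|dl dl0 Hdl] := compact_open_margin cK oU.
    by move=> x /= /le_lt_trans; apply.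
  (* The support is a closed cube of half-side [ep] whereas the margin [dl] is strict, hence the
     factor 1/2. *)
  pose ep := Num.min r0 dl / 2.
  have m0 : 0 < Num.min r0 dl by rewrite lt_min r00.
  have ep0 : 0 < ep by rewrite divr_gt0.
  have epm : ep < Num.min r0 dl by rewrite /ep; lra.
  have [M M0 ME] := sbump_mass (n := n) ep0.
  pose k (x : X) := M^-1 * sbump ep x.
  have mk : measurable_fun setT k.
    by apply: measurable_funM => //; exact: measurable_sbump.
  have k0 x : 0 <= k x by rewrite mulr_ge0 ?bump_space_ge0// invr_ge0 ltW.
  have kC x : k x <= M^-1 by rewrite ler_piMr ?bump_space_le1// invr_ge0 ltW.
  have k1 : (\int[leb]_x (k x)%:E = 1)%E.
    under eq_integral do rewrite EFinM.
    rewrite ge0_integralZl//=; last 3 first.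
    - by apply/measurable_EFinP; exact: measurable_sbump.
    - by move=> z _; rewrite lee_fin bump_space_ge0.
    - by rewrite lee_fin invr_ge0 ltW.
    by rewrite ME -EFinM mulVf// gt_eqF.
  have addC : commutative (fun x y : X => x + y) by move=> x y; rewrite addrC.
  have L1 : (\int[leb]_z `|mollify leb (fun x y : X => x + y)%R k f z - f z|%:E <= e%:E)%E.
    apply: (mollify_L1_le tr1 addC mk k0 kC k1 intf) => h.
    rewrite mulf_eq0 negb_or => /andP[_ /(sbump_neq0 ep0) hh].
    apply: Hr0 => i; apply: (lt_trans (hh i)); apply: (lt_le_trans epm).
    by rewrite ge_min lexx.
  apply: le_trans L1; rewrite integral_mkcond; apply: ge0_le_integral => //=.
  - by move=> x _; rewrite patchE; case: ifPn.
  - have mnf : measurable_fun setT (fun x => `|f x|%:E) by apply/measurable_EFinP/measurableT_comp.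
    exact: (measurable_restrictT _ mK).1 (measurable_funTS mnf).
  - apply/measurable_EFinP/measurableT_comp => //; apply: measurable_funB => //.
    exact: (measurable_mollify tr1 addC mk k0 kC intf).
  move=> x _; rewrite patchE; case: ifPn => [/set_mem Kx|_]; last by rewrite lee_fin.
  rewrite (_ : mollify _ _ _ _ _ = 0) ?sub0r ?normrN//.
  rewrite (@mollifyE _ _ _ leb _ tr1 addC k (fun y x : X => y - x)) //; last 2 first.
  - by move=> h w; rewrite addrC addKr.
  - apply: continuous_measurable_rV; apply: tame_continuous; apply: tameM; first exact: tame_cst.
    exact: tame_sbump_affine.
  have inU (y : X) : (forall i, `|y ord0 i - x ord0 i| <= ep) -> K' y.
    move=> Hy; have -> : y = x + (y - x) by rewrite addrC subrK.
    apply: ltW; apply: Hdl => //; apply: (@le_lt_trans _ _ ep).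
      by apply: norm_le_coord; [exact: ltW|move=> i; rewrite !mxE; exact: Hy].
    by apply: (lt_le_trans epm); rewrite ge_min lexx orbT.
  rewrite -(H (fun y => M^-1 * sbump ep (y - x))); last first.
    by apply: test_function_sbump => // y /inU; exact: K'B.
  rewrite [RHS]Rintegral_mkcond; apply: eq_Rintegral => y _.
  rewrite /f /k !patchE; have [s0|s0] := eqVneq (sbump ep (y - x)) 0.
    by rewrite s0 !mulr0; case: ifPn.
  have Ky : K' y by apply: inU => i; have := sbump_neq0 ep0 s0 i; rewrite !mxE => /ltW.
  by rewrite mem_set// mem_set//; exact: K'B.
have I0 : (\int[leb]_(x in K) `|(f x)%:E| = 0)%E.
  apply/eqP; rewrite eq_le; apply/andP; split; last exact: integral_ge0.
  by apply/lee_addgt0Pr => e e0; rewrite add0e; exact: key.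
have mfK : measurable_fun K (EFin \o f) by apply: measurable_funTS; exact/measurable_EFinP.
have /(ae_eq_integral_abs leb mK mfK).1 := I0.
apply: filterS => x /= Hx xs; have := Hx xs; rewrite /f patchE mem_set; first by case.
by rewrite /K'/=; apply: le_trans xs (ltW st).
Qed.

Lemma fundamental_lemma (B : set X) (g : X -> R) : is_euclidean_ball B ->
  loc_integrable B g ->
  (forall phi, test_function B phi -> \int[leb]_(x in B) (g x * phi x) = 0) ->
  {ae leb, forall x, B x -> g x = 0}.
Proof.
move=> [c [r [r0 ->]]] lg H.
pose s j : R := r * (1 - (j.+2%:R)^-1).
have ss j : s j < s j.+1.
  by rewrite ltr_pM2l// ltrD2l ltrN2 ltf_pV2 ?posrE// ltr_nat.
have sr j : s j < r by rewrite gtr_pMr// gtrBl invr_gt0.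
have : {ae leb, forall x, forall j, enorm (x - c) <= s j -> g x = 0}.
  apply: ae_foralln => j; exact: (fundamental_step (ss j) (sr j.+1) lg H).
apply: filterS => x Hx /= xr.
have rx0 : 0 < (r - enorm (x - c)) / r by rewrite divr_gt0// subr_gt0.
(* The integer part of the inverse of the relative distance from [x] to the sphere; this makes 1 /
   (j + 2) at most that distance, so [x] lies within radius [s j]. *)
pose j := Num.truncn ((r - enorm (x - c)) / r)^-1.
apply: (Hx j); rewrite /s mulrBr mulr1 lerBrDr -lerBrDl.
rewrite -ler_pdivlMl// mulrC.
rewrite -[leRHS]invrK lef_pV2 ?posrE ?invr_gt0//.
have /andP[_ /ltW h] := truncn_itv (ltW (eq_ind_r is_true rx0 (invr_gt0 ((r - enorm (x - c)) / r)))).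
by apply: (le_trans h); rewrite ler_nat.
Qed.

Lemma weak_gradient_unique (B : set X) u (g1 g2 : X -> X) : is_euclidean_ball B ->
  weak_gradient B u g1 -> weak_gradient B u g2 ->
  {ae leb, forall x, B x -> g1 x = g2 x}.
Proof.
move=> bB [lu lg1 H1] [_ lg2 H2]; have mB := euclidean_ball_measurable bB.
have : {ae leb, forall x, forall i : 'I_n, B x -> g1 x ord0 i - g2 x ord0 i = 0}.
  apply: filter_forall => i.
  apply: (fundamental_lemma bB) => [|phi tphi]; first exact: loc_integrableB.
  have i1 := test_function_integrable mB (lg1 i) tphi.
  have i2 := test_function_integrable mB (lg2 i) tphi.
  under eq_Rintegral do rewrite mulrBl.
  rewrite (RintegralB mB i1 i2).
  by have := H1 phi i tphi; rewrite (H2 phi i tphi) => /oppr_inj ->; rewrite subrr.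
apply: filterS => x Hx Bx; apply/rowP => i; apply/eqP.
by rewrite -subr_eq0; apply/eqP; exact: Hx.
Qed.

End fundamental.

Section almost_everywhere.
Context d (T : measurableType d) (R : realType) (m : {measure set T -> \bar R}).

Lemma aeS (P Q : T -> Prop) : (forall t, P t -> Q t) ->
  {ae m, forall t, P t} -> {ae m, forall t, Q t}.
Proof. by move=> PQ; apply: filterS. Qed.

Lemma aeS2 (P Q S : T -> Prop) : (forall t, P t -> Q t -> S t) ->
  {ae m, forall t, P t} -> {ae m, forall t, Q t} -> {ae m, forall t, S t}.
Proof. by move=> PQ; apply: filterS2. Qed.

End almost_everywhere.

(** * Iterated integrals and time slices *)

Section iterated.
Context {R : realType} {n : nat}.
Local Notation leb := (@lebesgue_rV R n).
Local Notation X := 'rV[R]_n.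
Local Notation V := ('rV[R]_n * R)%type.
Local Notation VT := ('rV[R]_n * measurableTypeR R)%type.
Local Notation mu := (@spacetime R n).

Lemma ae_time (P : R -> Prop) : {ae @lebesgue_measure R, forall t, P t} ->
  {ae mu, forall z, P z.2}.
Proof.
move=> [N [mN N0 PN]]; exists ([set: X] `*` (N : set (measurableTypeR R))); split.
- exact: measurableX.
- rewrite [LHS](_ : _ = (leb setT * lebesgue_measure N)%E); last exact: sprodE.
  by rewrite N0 mule0.
- by move=> z /= nP; split => //; exact: PN.
Qed.

Variables (U : set X) (J : set (measurableTypeR R)).
Hypotheses (mU : measurable U) (mJ : measurable J).
Let D : set VT := U `*` J.
Let mD : measurable D. Proof. exact: measurableX. Qed.

Lemma measurable_slice d (T : measurableType d) (h : VT -> T) t : J t ->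
  measurable_fun D h -> measurable_fun U (fun x => h (x, t)).
Proof.
move=> Jt mh; apply: (measurable_comp (F := D) mD _ mh); last first.
  by apply: measurable_funTS; exact: measurable_section1.
by move=> _ [x Ux <-].
Qed.

Section nonneg.
Variables (F : VT -> \bar R).
Hypotheses (mF : measurable_fun D F) (F0 : forall z, D z -> (0 <= F z)%E).

Let mFD : measurable_fun [set: VT] (F \_ D).
Proof. exact: (measurable_restrictT _ mD).1. Qed.

Let FD0 z : (0 <= (F \_ D) z)%E.
Proof. by rewrite patchE; case: ifPn => // /set_mem; exact: F0. Qed.

Let sliceE t : J t -> (\int[leb]_(x in U) F (x, t) = fubini_G leb (F \_ D) t)%E.
Proof.
move=> Jt; rewrite /fubini_G [LHS]integral_mkcond.
apply: eq_integral => x _.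
by rewrite !patchE /D in_setX /= (mem_set Jt) andbT.
Qed.

Lemma measurable_iterated : measurable_fun J (fun t => \int[leb]_(x in U) F (x, t))%E.
Proof.
apply: (@eq_measurable_fun _ _ _ _ J (fubini_G leb (F \_ D))).
  by move=> t /set_mem Jt; rewrite sliceE.
apply: measurable_funTS; exact: measurable_fun_fubini_tonelli_G.
Qed.

Lemma iterated_integral :
  (\int[lebesgue_measure]_(t in J) \int[leb]_(x in U) F (x, t) = \int[mu]_(z in D) F z)%E.
Proof.
rewrite [RHS]integral_mkcond (fubini_tonelli2 _ mFD FD0) integral_mkcond.
apply: eq_integral => t _; rewrite patchE; case: ifPn => [/set_mem Jt|nJ].
  by rewrite sliceE.
rewrite /fubini_G integral0_eq// => x _.
by rewrite patchE /D in_setX /= (negbTE nJ) andbF.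
Qed.

End nonneg.

(** By Tonelli's theorem the integral of the absolute value vanishes. This turns uniqueness of
    gradients on almost every slice into uniqueness almost everywhere in space-time. *)
Lemma ae_slices (h : VT -> R) : measurable_fun D h ->
  {ae @lebesgue_measure R, forall t, J t -> {ae leb, forall x, U x -> h (x, t) = 0}} ->
  {ae mu, forall z, D z -> h z = 0}.
Proof.
move=> mh H.
have mhe : measurable_fun D (EFin \o h) by exact/measurable_EFinP.
have mha : measurable_fun D (fun z => `|(EFin \o h) z|%E) by exact: measurableT_comp.
have : (\int[mu]_(z in D) `|(EFin \o h) z| = 0)%E.
  rewrite -iterated_integral//.
  rewrite (ge0_ae_eq_integral (g := cst 0%E)) ?integral0//.
  - exact: (measurable_iterated mha).
  - by move=> t _; exact: integral_ge0.
  - apply: filterS H => t Ht Jt; apply/(ae_eq_integral_abs leb mU).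
      exact: (measurable_slice Jt mhe).
    by apply: filterS (Ht Jt) => x Hx Ux /=; rewrite Hx.
move=> /(ae_eq_integral_abs mu mD mhe).1.
by apply: filterS => z Hz Dz; have := Hz Dz; case.
Qed.

End iterated.

(** * Independence of the choice of gradient *)

Section gradients.
Context {R : realType} {n : nat}.
Local Notation leb := (@lebesgue_rV R n).
Local Notation X := 'rV[R]_n.
Local Notation V := ('rV[R]_n * R)%type.
Local Notation VT := ('rV[R]_n * measurableTypeR R)%type.
Local Notation mu := (@spacetime R n).
Implicit Types (w : V -> R) (G : V -> X).

Lemma Dx_spec (B : set X) (J : set R) w G : spatial_gradient B J w G ->
  spatial_gradient B J w (Dx B J w).
Proof. by move=> GP; rewrite /Dx; apply: (xgetPex (fun=> 0)); exists G. Qed.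

Lemma weak_gradient_sub (U U' : set X) u g : open U' -> measurable U -> U' `<=` U ->
  weak_gradient U u g -> weak_gradient U' u g.
Proof.
move=> oU' mU sU [lu lg H]; split.
- by move=> K cK KU; apply: lu => //; exact: subset_trans sU.
- by move=> i K cK KU; apply: lg => //; exact: subset_trans sU.
- move=> phi i tphi; have tphi' := test_function_derive (delta_mx ord0 i) tphi.
  have aux (v psi : X -> R) : test_function U' psi ->
      \int[leb]_(x in U') (v x * psi x) = \int[leb]_(x in U) (v x * psi x).
    move=> tpsi; rewrite Rintegral_mkcond [RHS]Rintegral_mkcond.
    apply: eq_Rintegral => x _; rewrite !patchE.
    case: ifPn => [/set_mem/sU U'x|/negP nU']; first by rewrite mem_set.
    case: ifPn => // _; rewrite (test_function_out tpsi) ?mulr0//.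
    by move=> /mem_set.
  rewrite aux// (aux (fun x => g x ord0 i))//; apply: H.
  by case: tphi => ? ? sphi; split => //; exact: subset_trans sU.
Qed.

Lemma measurable_coord_fun d (T : measurableType d) (D : set T) (G : T -> X) i :
  measurable D -> measurable_fun D G -> measurable_fun D (fun z => G z ord0 i).
Proof.
move=> mD mG.
by apply: (measurableT_comp (measurable_coord i) mG).
Qed.

Lemma spatial_gradient_unique (B : set X) (J : set R) w (G1 G2 : V -> X) :
  is_euclidean_ball B -> measurable (J : set (measurableTypeR R)) ->
  spatial_gradient B J w G1 -> spatial_gradient B J w G2 ->
  {ae mu, forall z, (B `*` J) z -> G1 z = G2 z}.
Proof.
move=> bB mJ [mG1 H1] [mG2 H2]; have mB := euclidean_ball_measurable bB.
have mD : measurable (B `*` J : set VT) by exact: measurableX.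
have H i : {ae mu, forall z, (B `*` J : set VT) z -> G1 z ord0 i - G2 z ord0 i = 0}.
  apply: (ae_slices mB mJ (h := fun z => G1 z ord0 i - G2 z ord0 i)).
    by apply: measurable_funB; exact: measurable_coord_fun.
  apply: aeS2 H1 H2 => t h1 h2 Jt.
  apply: filterS (weak_gradient_unique bB (h1 Jt) (h2 Jt)) => x Hx Bx.
  by rewrite Hx// subrr.
apply: filterS (filter_forall _ H) => z Hz Dz; apply/rowP => i; apply/eqP.
by rewrite -subr_eq0; apply/eqP; exact: Hz.
Qed.

(** Both the energy and the norm integrate a nonnegative function of the point and of the length of
    the chosen gradient; uniqueness allows any known gradient [G] in its place. [Phi] covers the two
    at once. *)
Lemma gradient_integral (Phi : V -> R -> \bar R) (B : set X) (J : set R) w G :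
  is_euclidean_ball B -> measurable (J : set (measurableTypeR R)) ->
  (forall f : VT -> R, measurable_fun (B `*` J : set VT) f ->
    measurable_fun (B `*` J : set VT) (fun z => Phi z (f z))) ->
  (forall z r, (B `*` J) z -> 0 <= Phi z r)%E ->
  spatial_gradient B J w G ->
  (\int[lebesgue_measure]_(t in J) \int[leb]_(x in B) Phi (x, t) (enorm (Dx B J w (x, t))) =
   \int[mu]_(z in B `*` J) Phi z (enorm (G z)))%E.
Proof.
move=> bB mJ mPhi Phi0 sG; have mB := euclidean_ball_measurable bB.
have mD : measurable (B `*` J : set VT) by exact: measurableX.
have sD := Dx_spec sG.
have me G' : spatial_gradient B J w G' ->
    measurable_fun (B `*` J : set VT) (fun z => Phi z (enorm (G' z))).
  by move=> [mG' _]; apply: mPhi; exact: (measurableT_comp measurable_enorm mG').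
rewrite (iterated_integral mB mJ (me _ sD)); last by move=> z Dz; exact: Phi0.
apply: ge0_ae_eq_integral => //; [exact: me|exact: me|by move=> *; exact: Phi0..|].
by apply: aeS (spatial_gradient_unique bB mJ sD sG) => z Hz Dz; rewrite Hz.
Qed.

Lemma energy_gradient (p q : R) (a : V -> R) (B : set X) (J : set R) w G :
  is_euclidean_ball B -> measurable (J : set (measurableTypeR R)) ->
  measurable_fun (B `*` J : set VT) a -> (forall z, (B `*` J) z -> 0 <= a z) ->
  spatial_gradient B J w G ->
  (energy p q a B J w =
   \int[mu]_(z in B `*` J) (enorm (G z) `^ p + a z * enorm (G z) `^ q)%:E)%E.
Proof.
move=> bB mJ ma a0 sG.
apply: (gradient_integral (Phi := fun z r => (r `^ p + a z * r `^ q)%:E)) => //.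
  move=> f mf; apply/measurable_EFinP/measurable_funD; first exact: (measurableT_comp (measurable_powR p) mf).
  by apply: measurable_funM => //; exact: (measurableT_comp (measurable_powR q) mf).
by move=> z r Dz; rewrite lee_fin addr_ge0 ?mulr_ge0 ?powR_ge0// a0.
Qed.

Lemma LpW1p_norm_gradient (p : R) (B : set X) (J : set R) w G :
  is_euclidean_ball B -> measurable (J : set (measurableTypeR R)) ->
  measurable_fun (B `*` J : set VT) w ->
  spatial_gradient B J w G ->
  (LpW1p_norm p B J w =
   (\int[mu]_(z in B `*` J) (`|w z| `^ p + enorm (G z) `^ p)%:E) `^ p^-1)%E.
Proof.
move=> bB mJ mw sG; rewrite /LpW1p_norm; congr (_ `^ _)%E.
apply: (gradient_integral (Phi := fun z r => (`|w z| `^ p + r `^ p)%:E)) => //.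
  move=> f mf; apply/measurable_EFinP/measurable_funD; last exact: (measurableT_comp (measurable_powR p) mf).
  by apply: (measurableT_comp (measurable_powR p)); exact: measurableT_comp mw.
by move=> z r Dz; rewrite lee_fin addr_ge0 ?powR_ge0.
Qed.

End gradients.

Lemma integrable_fubini_G d1 d2 (T1 : measurableType d1) (T2 : measurableType d2) (R : realType)
    (m1 : {sigma_finite_measure set T1 -> \bar R}) (m2 : {sigma_finite_measure set T2 -> \bar R})
    (f : T1 * T2 -> \bar R) : (m1 \x m2)%E.-integrable setT f ->
  m2.-integrable setT (fubini_G m1 f).
Proof.
move=> imf; have mf := measurable_int _ imf.
have mfa : measurable_fun setT (fun z => `|f z|%E) by exact: measurableT_comp.
apply/integrableP; split; first exact: (measurable_fubini_G imf).
apply: le_lt_trans ((integrable21ltyP m1 m2 mf).1 imf).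
apply: ge0_le_integral => //.
- by apply: measurableT_comp => //; exact: (measurable_fubini_G imf).
- by apply: (measurable_fun_fubini_tonelli_G _ mfa) => z; exact: abse_ge0.
- move=> y _; apply: le_abse_integral => //.
  exact: (measurableT_comp mf (measurable_pair2 y)).
Qed.

(** * Mollified weak gradients *)

Section translates.
Context {R : realType} {V : normedModType R}.

Lemma derive_translate (phi : V -> R) h v : 'D_v (fun y => phi (y - h)) = fun y => 'D_v phi (y - h).
Proof.
apply/funext => y; rewrite /derive.
suff -> : (fun y => phi (y - h)) \o shift y = phi \o shift (y - h) by [].
by apply/funext => u /=; rewrite addrA.
Qed.

Lemma iter_derive_translate (phi : V -> R) h vs :
  iter_derive vs (fun y => phi (y - h)) = fun y => iter_derive vs phi (y - h).
Proof. by elim: vs => //= v vs ->; rewrite derive_translate. Qed.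

Lemma differentiable_translate (phi : V -> R) h x :
  differentiable phi (x - h) -> differentiable (fun y => phi (y - h)) x.
Proof.
move=> dphi; apply: (@differentiable_comp _ _ _ _ (fun y => y - h) phi) => //.
Qed.

End translates.

Section test_translate.
Context {R : realType} {n : nat}.
Local Notation X := 'rV[R]_n.

Lemma iter_deriveZ (c : R) (phi : X -> R) vs : smooth_on_open setT phi ->
  iter_derive vs (fun y => c * phi y) = fun y => c * iter_derive vs phi y.
Proof.
move=> sphi; elim: vs => //= v vs ->; apply/funext => y.
rewrite [LHS](_ : _ = 'D_v (c \*: iter_derive vs phi) y)// deriveZ//.
exact/diff_derivable/sphi.
Qed.

Lemma test_function_translate (U U' : set X) (phi : X -> R) (c : R) (h : X) :
  test_function U phi -> (forall x, U x -> U' (x + h)) ->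
  test_function U' (fun y => c * phi (y - h)).
Proof.
move=> [sphi cphi sU] UU'.
have sh : smooth_on_open setT (fun y => phi (y - h)).
  move=> vs x _; rewrite iter_derive_translate; apply: differentiable_translate.
  exact: sphi.
pose K := (fun x => x + h) @` closure [set x | phi x != 0].
have cK : compact K.
  apply: continuous_compact => //; apply: continuous_subspaceT => x.
  by apply: continuousD; [exact: id|exact: cst_continuous].
have sK : closure [set y | c * phi (y - h) != 0] `<=` K.
  rewrite [X in _ `<=` X](closure_id _).1; last first.
    by apply: compact_closed => //; exact: norm_hausdorff.
  apply: closure_subset => y /=; rewrite mulf_eq0 negb_or => /andP[_ py].
  by exists (y - h); [exact: subset_closure|rewrite subrK].
split.
- move=> vs x _; rewrite iter_deriveZ//; apply: differentiableM => //.
  exact: sh.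
- by apply: subclosed_compact cK sK; exact: closed_closure.
- by move=> y /sK[x /sU/UU' ? <-].
Qed.

End test_translate.

Section mollification.
Context {R : realType} {n : nat}.
Local Notation leb := (@lebesgue_rV R n).
Local Notation X := 'rV[R]_n.
Local Notation V := ('rV[R]_n * R)%type.
Local Notation VT := ('rV[R]_n * measurableTypeR R)%type.
Local Notation mu := (@spacetime R n).
Implicit Types (f F : V -> R).

Definition mollification (e : R) (f : V -> R) : V -> R :=
  mollify mu (fun z w : V => z + w) (parabolic_kernel e) f.

Let add (z w : V) : V := z + w.
Let tr : translation_invariant mu add. Proof. by have [] := regular_shift_spacetime R n. Qed.
Let addC : commutative add. Proof. by move=> z w; rewrite /add addrC. Qed.

Variables (e : R).
Hypothesis e0 : 0 < e.
Local Notation k := (parabolic_kernel e).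
Local Notation C := (@kernel_const R n / e ^+ (n + 2)).
Let mk : measurable_fun [set: VT] k. Proof. exact: measurable_kernel. Qed.
Let k0 (h : V) : 0 <= k h. Proof. exact: kernel_ge0. Qed.
Let kC (h : V) : k h <= C. Proof. exact: kernel_le. Qed.
Let k1 : (\int[mu]_h (k h)%:E = 1)%E. Proof. exact: integral_kernel. Qed.

Lemma mollification_EFin f z : mu.-integrable setT (EFin \o f) ->
  (mollification e f z)%:E = (\int[mu]_h (f (z + h) * k h)%:E)%E.
Proof. exact: (mollify_EFin tr addC mk k0 kC). Qed.

Lemma integrable_mollification_integrand f z : mu.-integrable setT (EFin \o f) ->
  mu.-integrable setT (fun h => (f (z + h) * k h)%:E).
Proof. exact: (integrable_mollify_integrand tr addC mk k0 kC). Qed.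

Lemma measurable_mollification f : mu.-integrable setT (EFin \o f) ->
  measurable_fun [set: VT] (mollification e f).
Proof. exact: (measurable_mollify tr addC mk k0 kC). Qed.

Lemma mollificationE f : measurable_fun [set: VT] f -> mollification e f = correlation f k.
Proof.
move=> mf; apply/funext => z; rewrite /correlation.
apply: (mollifyE tr addC (sub := fun y x : V => y - x)) => //.
  by move=> h w; rewrite /add addrC addKr.
exact: (tame_measurable_shift z (@tame_kernel R n e)).
Qed.

Lemma smooth_mollification f : mu.-integrable setT (EFin \o f) ->
  smooth_on_open setT (mollification e f).
Proof.
move=> intf; rewrite mollificationE; first exact: (correlation_smooth intf (tame_kernel e)).
by apply/measurable_EFinP; exact: measurable_int intf.
Qed.

Lemma continuous_mollification f : mu.-integrable setT (EFin \o f) ->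
  continuous (mollification e f).
Proof.
move=> intf z; apply: differentiable_continuous.
exact: (smooth_mollification intf [::]).
Qed.

Lemma continuous_mollification_slice f t : mu.-integrable setT (EFin \o f) ->
  continuous (fun x : X => mollification e f (x, t)).
Proof.
move=> intf x; apply: (@continuous_comp _ _ _ (fun x : X => (x, t) : V) (mollification e f)).
  move=> A /nbhs_ballP[d d0 dA]; apply/nbhs_ballP; exists d => // y yx.
  by apply: dA; split => //; exact: ballxx.
exact: continuous_mollification.
Qed.

(** The inner integral over the shift is at most [C * M] times the L^1 norm of [f], and the outer
    one runs over [B], of finite measure. This licenses Fubini's theorem below. *)
Lemma integrable_mul_test f (psi : X -> R) (B : set X) (M t : R) :
  mu.-integrable setT (EFin \o f) ->
  measurable B -> (leb B < +oo)%E -> measurable_fun setT psi ->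
  (forall x, `|psi x| <= M) -> (forall x, ~ B x -> psi x = 0) ->
  (leb \x mu)%E.-integrable setT
    (fun p : X * VT => (f ((p.1, t) + p.2) * k p.2 * psi p.1)%:E).
Proof.
move=> intf mB Boo mpsi psiM psiB.
have mf : measurable_fun [set: VT] f by apply/measurable_EFinP; exact: measurable_int intf.
pose P (p : X * VT) := (f ((p.1, t) + p.2) * k p.2 * psi p.1)%:E.
have mP : measurable_fun setT P.
  apply/measurable_EFinP/measurable_funM; last first.
    exact: (measurableT_comp mpsi measurable_fst).
  apply: measurable_funM; last exact: (measurableT_comp mk measurable_snd).
  have ms : measurable_fun [set: X * VT] (fun p : X * VT => ((p.1, t), p.2) : VT * VT).
    apply/measurable_fun_pairP; split; last exact: measurable_snd.
    exact: (measurableT_comp (measurable_section1 t) measurable_fst).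
  exact: (measurableT_comp (measurable_shift2 tr mf) ms).
have mPa : measurable_fun setT (fun p => `|P p|%E) by exact: measurableT_comp.
have Pa0 p : (0 <= `|P p|)%E by exact: abse_ge0.
have C0 : 0 <= C by exact: le_trans (k0 0) (kC 0).
apply/integrableP; split => //.
rewrite (fubini_tonelli1 _ mPa Pa0) /fubini_F.
pose N := (\int[mu]_z `|f z|%:E)%E.
have N0 : (0 <= N)%E by apply: integral_ge0.
have Noo : (N < +oo)%E by have /integrableP[_] := intf.
have mS x : measurable_fun [set: VT] (fun h : VT => f ((x, t) + h)).
  by have /measurable_EFinP := measurable_int _ (integrable_shift tr addC (x, t) intf).
apply: (@le_lt_trans _ _ (\int[leb]_(x in B) ((C * M)%:E * N))%E); last first.
  rewrite integral_cst// lte_mul_pinfty//; first by rewrite mule_ge0// lee_fin mulr_ge0// (le_trans _ (psiM 0)).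
  by rewrite fin_numM// ge0_fin_numE.
rewrite [leRHS]integral_mkcond; apply: ge0_le_integral => //=.
- by move=> x _; apply: integral_ge0.
- exact: (measurable_fun_fubini_tonelli_F _ mPa Pa0).
- have mc : measurable_fun B (fun=> (C * M)%:E * N)%E by [].
  exact: (measurable_restrictT _ mB).1 mc.
move=> x _; rewrite patchE; case: ifPn => [_|/negP nB]; last first.
  rewrite integral0_eq// => h _; rewrite psiB ?mulr0 ?normr0//.
  by move=> /mem_set.
rewrite /N -(integral_shift tr (f := fun z => `|f z|%:E) (x, t))//; last exact/measurable_EFinP/measurableT_comp.
have mfs : measurable_fun [set: VT] (fun h : VT => `|f (add h (x, t))|%:E).
  under eq_fun do rewrite addC; apply/measurable_EFinP/measurableT_comp => //; exact: mS.
rewrite -(ge0_integralZl _ measurableT mfs)//; last by rewrite lee_fin mulr_ge0// (le_trans _ (psiM 0)).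
apply: ge0_le_integral => //=.
- by apply/measurable_EFinP; apply: measurableT_comp => //; do 2?apply: measurable_funM => //.
- exact: measurable_funeM.
move=> h _; rewrite /add addrC -EFinM lee_fin normrM (normrM (f _)) (ger0_norm (k0 h)) -mulrA mulrC.
by rewrite ler_wpM2r// ler_pM.
Qed.

Lemma integral_mollification_slice f (psi : X -> R) (B : set X) (M t : R) :
  mu.-integrable setT (EFin \o f) ->
  measurable B -> (leb B < +oo)%E -> measurable_fun setT psi ->
  (forall x, `|psi x| <= M) -> (forall x, ~ B x -> psi x = 0) ->
  (\int[leb]_x (mollification e f (x, t) * psi x)%:E =
   \int[mu]_h \int[leb]_x (f ((x, t) + h) * k h * psi x)%:E)%E.
Proof.
move=> intf mB Boo mpsi psiM psiB.
have iP := integrable_mul_test t intf mB Boo mpsi psiM psiB.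
rewrite -(Fubini iP); apply: eq_integral => x _.
rewrite EFinM mollification_EFin// -integralZr//.
exact: integrable_mollification_integrand.
Qed.

Lemma ae_time_shift (P : R -> Prop) t : {ae @lebesgue_measure R, forall s, P s} ->
  {ae mu, forall h, P (t + h.2)}.
Proof.
move=> [N [mN N0 PN]]; apply: (@ae_time R n (fun s => P (t + s))).
exists ((fun s : measurableTypeR R => s + t) @^-1` N); split.
- rewrite -[X in measurable X]setTI; apply: (measurable_funD (f := id) (g := cst t)) => //.
- by rewrite lebesgue_measure_shift.
- by move=> s /=; rewrite addrC; exact: PN.
Qed.

(** The quantifier over test functions stands inside the almost everywhere: the exceptional times
    are common to all of them. For [s] outside [J] both sides are zero, so the identity holds for
    almost every real [s]. *)
Lemma ae_slice_parts (B : set X) (J : set R) (w : V -> R) (G : V -> X) :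
  let f := w \_ (B `*` J) in
  let g i := (fun z => G z ord0 i) \_ (B `*` J) in
  measurable B -> spatial_gradient B J w G ->
  {ae @lebesgue_measure R, forall s, forall psi i, test_function B psi ->
    (\int[leb]_y (f (y, s) * 'D_(delta_mx ord0 i) psi y)%:E =
     - \int[leb]_y (g i (y, s) * psi y)%:E)%E}.
Proof.
move=> f g mB [_ sG]; apply: aeS sG => s Hs psi i tpsi.
have tD := test_function_derive (delta_mx ord0 i) tpsi.
have patch0 (u : V -> R) y : ~ J s -> (u \_ (B `*` J)) (y, s) = 0.
  by move=> nJ; rewrite patchE memNset// => -[].
have patch1 (u : V -> R) y : J s -> B y -> (u \_ (B `*` J)) (y, s) = u (y, s).
  by move=> Js By; rewrite patchE mem_set.
have [Js|nJ] := pselect (J s); last first.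
  rewrite !integral0_eq ?oppe0// => y _; first by rewrite /g patch0// mul0r.
  by rewrite /f patch0// mul0r.
have [lw lG H] := Hs Js.
have aux (u : V -> R) phi : test_function B phi -> loc_integrable B (fun x => u (x, s)) ->
    (\int[leb]_y ((u \_ (B `*` J)) (y, s) * phi y)%:E = (\int[leb]_(y in B) (u (y, s) * phi y))%:E)%E.
  move=> tphi lu; rewrite /Rintegral fineK; last first.
    exact: integrable_fin_num (test_function_integrable mB lu tphi).
  rewrite [RHS]integral_mkcond; apply: eq_integral => y _; rewrite [RHS]patchE.
  case: ifPn => [/set_mem By|/negP nB]; first by rewrite patch1.
  by rewrite (test_function_out tphi) ?mulr0// => /mem_set.
by rewrite aux// H// EFinN (aux (fun z => G z ord0 i)).
Qed.

(** Fubini's theorem writes each pairing as an integral over shifts [h] of pairings on the slice at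
    time t + h.2, tested with the translate of [phi] by [h.1]. Bad times exclude only a null set of
    [h], so the conclusion holds for every [t]. *)
Lemma weak_gradient_mollification (B B' : set X) (J : set R) (w : V -> R) (G : V -> X) (t : R) :
  let f := w \_ (B' `*` J) in
  let g i := (fun z => G z ord0 i) \_ (B' `*` J) in
  is_euclidean_ball B -> is_euclidean_ball B' -> spatial_gradient B' J w G ->
  mu.-integrable setT (EFin \o f) -> (forall i, mu.-integrable setT (EFin \o g i)) ->
  (forall x h, B x -> k h != 0 -> B' (x + h.1)) ->
  weak_gradient B (fun x => mollification e f (x, t))
    (fun x => \row_i mollification e (g i) (x, t)).
Proof.
move=> f g bB bB' sG intf intg BB'.
have mB := euclidean_ball_measurable bB; have mB' := euclidean_ball_measurable bB'.
have Boo := lebesgue_rV_ball_lty bB.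
have lc F : mu.-integrable setT (EFin \o F) -> loc_integrable B (fun x => mollification e F (x, t)).
  move=> iF K cK KB; have mK : measurable K by exact: compact_measurable_rV.
  have cF := continuous_mollification_slice (t := t) iF.
  apply: measurable_bounded_integrable => //.
  - by apply: le_lt_trans Boo; apply: le_measure; rewrite ?inE.
  - by apply: measurable_funTS; exact: continuous_measurable_rV.
  - have := compact_bounded (continuous_compact (continuous_subspaceT cF) cK).
    move=> [M [Mr HM]]; exists M; split => // y My x Kx; apply: HM => //.
    by exists x.
split.
- exact: lc.
- by move=> i; under eq_fun do rewrite mxE; exact: lc.
move=> phi i tphi; set D := 'D_(delta_mx ord0 i) phi.
have tD : test_function B D by exact: test_function_derive.
have [M1 _ HM1] := test_function_bounded tphi; have [M2 _ HM2] := test_function_bounded tD.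
have ext (u psi : X -> R) : test_function B psi ->
    \int[leb]_(x in B) (u x * psi x) = fine (\int[leb]_x (u x * psi x)%:E)%E.
  move=> tpsi; rewrite Rintegral_mkcond; congr fine; apply: eq_integral => x _.
  rewrite patchE; case: ifPn => // /negP nB; rewrite (test_function_out tpsi) ?mulr0//.
  by move=> /mem_set.
rewrite !ext//; under [in RHS]eq_integral do rewrite mxE.
rewrite (@integral_mollification_slice f D B M2)//; last 2 first.
- exact: test_function_measurable tD.
- by move=> x; exact: test_function_out tD.
rewrite (@integral_mollification_slice (g i) phi B M1)//; last 2 first.
- exact: test_function_measurable tphi.
- by move=> x; exact: test_function_out tphi.
have iPf := integrable_mul_test t intf mB Boo (test_function_measurable tD) HM2
  (fun x => @test_function_out _ _ _ _ x tD).
have iPg := integrable_mul_test t (intg i) mB Boo (test_function_measurable tphi) HM1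
  (fun x => @test_function_out _ _ _ _ x tphi).
have iGg := integrable_fubini_G iPg.
rewrite -fineN -integralN; last first.
  by apply: fin_num_adde_defl; rewrite fin_numN; exact: (integrable_neg_fin_num measurableT iGg).
congr fine; apply: ae_eq_integral => //.
- exact: measurable_fubini_G iPf.
- by apply: measurableT_comp => //; exact: measurable_fubini_G iPg.
have AE := ae_slice_parts mB' sG.
apply: aeS (ae_time_shift t AE) => h Hh _.
(* Off the support of the kernel the translate may leave [B'], but then both integrands vanish. *)
have [kh|kh] := eqVneq (k h) 0.
  by rewrite !integral0_eq ?oppe0// => x _; rewrite kh mulr0 mul0r.
have tphi' : test_function B' (fun y => k h * phi (y - h.1)).
  by apply: test_function_translate tphi _ => x Bx; exact: BB'.
have {Hh} := Hh _ i tphi'; rewrite -/f -/(g i).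
have mslice F : mu.-integrable setT (EFin \o F) -> measurable_fun setT (fun y => F (y, t + h.2)).
  move=> iF; have mF : measurable_fun [set: VT] F by apply/measurable_EFinP; exact: measurable_int iF.
  exact: (measurableT_comp mF (measurable_section1 _)).
have trX : translation_invariant leb (fun x y : X => x + y) by have [] := regular_shift_rV R n.
have mD : measurable_fun setT (fun y => 'D_(delta_mx ord0 i) (fun y => k h * phi (y - h.1)) y).
  by apply: test_function_measurable; exact: test_function_derive tphi'.
(* The substitution y = x + h.1 takes the slice identity for the translate back to integrals over
   [x]. *)
rewrite -(integral_shift_signed trX h.1 (f := fun y => (f (y, t + h.2) * _)%:E)); last first.
  by apply/measurable_EFinP/measurable_funM => //; exact: mslice.
rewrite -(integral_shift_signed trX h.1 (f := fun y => (g i (y, t + h.2) * _)%:E)); last first.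
  by apply/measurable_EFinP/measurable_funM; [exact: mslice|exact: test_function_measurable tphi'].
have DE x : 'D_(delta_mx ord0 i) (fun y => k h * phi (y - h.1)) (x + h.1) = k h * D x.
  have [sphi _ _] := tphi.
  have sh : smooth_on_open setT (fun y => phi (y - h.1)).
    move=> vs y _; rewrite iter_derive_translate; apply: differentiable_translate; exact: sphi.
  have := congr1 (@^~ (x + h.1)) (iter_deriveZ (k h) [:: delta_mx ord0 i] sh).
  by rewrite (iter_derive_translate phi h.1 [:: delta_mx ord0 i]) addrK.
have pairE x : (x, t) + h = (x + h.1, t + h.2) :> V by [].
have L : (\int[leb]_x (f ((x, t) + h) * k h * D x)%:E = \int[leb]_z (f (z + h.1, t + h.2) *
    'D_(delta_mx ord0 i) (fun y => (k h * phi (y - h.1))%R) (z + h.1))%:E)%E.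
  by apply: eq_integral => x _; rewrite DE pairE mulrA.
have Rg : (\int[leb]_x (g i ((x, t) + h) * k h * phi x)%:E =
    \int[leb]_z (g i (z + h.1, t + h.2) * (k h * phi (z + h.1 - h.1)%R))%:E)%E.
  by apply: eq_integral => x _; rewrite addrK pairE mulrA.
by rewrite L Rg.
Qed.

End mollification.

Section powers.
Context {R : realType}.
Implicit Types y c r : R.

(** If y > c then y = y^r / y^(r-1) is at most y^r / c^(r-1). With a suitable threshold [c] this
    stands in for Jensen's and Hoelder's inequalities. *)
Lemma powR_split y c r : 0 <= y -> 0 < c -> 1 <= r -> y <= c + y `^ r / c `^ (r - 1).
Proof.
move=> y0 c0 r1; have [yc|cy] := leP y c.
  by rewrite (le_trans yc)// lerDl divr_ge0 ?powR_ge0.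
rewrite (@le_trans _ _ (y `^ r / c `^ (r - 1)))//; last by rewrite lerDr ltW.
rewrite ler_pdivlMr ?powR_gt0// -[leRHS]mulr_powRB1//; last by rewrite (lt_le_trans _ r1).
by rewrite ler_wpM2l// ge0_ler_powR ?nnegrE ?subr_ge0 ?(ltW c0)// ltW.
Qed.

End powers.

Section derivative_bound.
Context {R : realType}.

Lemma derive_norm_le (V : normedModType R) (phi : V -> R) (L : R) (v y : V) :
  derivable phi y v -> (forall h : R, `|phi (h *: v + y) - phi y| <= L * `|h|) ->
  `|'D_v phi y| <= L.
Proof.
move=> dphi H; have cv : (fun h : R => `|h^-1 *: ((phi \o shift y) (h *: v) - phi y)|) @ 0^' --> `|'D_v phi y|.
  by apply: cvg_norm; exact: dphi.
rewrite -(cvg_lim _ cv)//; apply: limr_le; first exact: cvgP cv.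
near=> h => /=; rewrite normrM normfV.
have h0 : h != 0 by near: h; exact: nbhs_dnbhs_neq.
by rewrite ler_pdivrMl ?normr_gt0// mulrC; exact: H.
Unshelve. all: by end_near. Qed.

Context {n : nat}.
Local Notation X := 'rV[R]_n.

Lemma norm_delta_le1 (i : 'I_n) : `|delta_mx ord0 i : X| <= 1.
Proof.
apply: norm_le_coord => // j; rewrite mxE eqxx /=.
by case: (j == i); rewrite ?normr1 ?normr0.
Qed.

(** The bump at scale 1 is Lipschitz, and rescaling multiplies its constant by 1 / e: the price of
    moving a derivative to the kernel. *)
Lemma derive_sbump_le : exists2 C : R, 0 <= C &
  forall (e c : R) (x y : X) (i : 'I_n), 0 < e ->
    `|'D_(delta_mx ord0 i) (fun y => c * sbump e (y - x)) y| <= `|c| * (C / e).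
Proof.
have [df tdf _] := tame_taylor1 (@tame_bump_space R n).
have [C C0 HC] := taylor1_lipschitz tdf.
exists C => // e c x y i e0; apply: derive_norm_le.
  apply: diff_derivable.
  have tm : tame (fun y : X => c * sbump e (y - x)).
    by apply: tameM; [exact: tame_cst|exact: tame_sbump_affine].
  exact: (tame_smooth tm [::]).
move=> h; rewrite -mulrBr normrM -mulrA ler_wpM2l//.
have -> : sbump e (h *: delta_mx ord0 i + y - x) =
    bump_space (e^-1 *: (y - x) + (e^-1 * h) *: delta_mx ord0 i).
  by rewrite /sbump -addrA [in LHS]addrC scalerDr scalerA.
apply: (le_trans (HC _ _)); rewrite normrZ normrM gtr0_norm ?invr_gt0//.
rewrite -mulrA ler_wpM2l// -mulrA ler_wpM2l ?invr_ge0 ?(ltW e0)//.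
by rewrite ler_piMr// norm_delta_le1.
Qed.

End derivative_bound.

(** * Pointwise bounds for mollifications *)

Section bounds.
Context {R : realType} {n : nat}.
Local Notation leb := (@lebesgue_rV R n).
Local Notation X := 'rV[R]_n.
Local Notation V := ('rV[R]_n * R)%type.
Local Notation VT := ('rV[R]_n * measurableTypeR R)%type.
Local Notation mu := (@spacetime R n).
Implicit Types (f F : V -> R).

Variables (e : R).
Hypothesis e0 : 0 < e.
Local Notation k := (@parabolic_kernel R n e).
Local Notation M := (mollification e).
Local Notation integrable_on f := (mu.-integrable setT (EFin \o f)).

Lemma mollification_ge0 f z : (forall y, 0 <= f y) -> 0 <= M f z.
Proof. by move=> f0; apply: Rintegral_ge0 => h _; rewrite mulr_ge0// kernel_ge0. Qed.

Lemma mollification_norm_le f F z : integrable_on f -> integrable_on F ->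
  (forall y, `|f y| <= F y) -> `|M f z| <= M F z.
Proof.
move=> intf intF fF; have i1 := integrable_mollification_integrand e0 z intf.
have i2 := integrable_mollification_integrand e0 z intF.
rewrite (le_trans (le_normr_Rintegral measurableT i1))//; apply: le_Rintegral => //.
  by have := integrable_norm i1.
move=> h _; rewrite normrM (ger0_norm (kernel_ge0 _ e0)).
by rewrite ler_wpM2r ?kernel_ge0.
Qed.

Lemma integrable_kernel : integrable_on k.
Proof.
apply/integrableP; split; first by apply/measurable_EFinP; exact: measurable_kernel.
under eq_integral => z _ do rewrite /= ger0_norm ?kernel_ge0//.
by rewrite integral_kernel// ltry.
Qed.

Lemma mollification_le_integral f z : integrable_on f -> (forall y, 0 <= f y) ->
  M f z <= @kernel_const R n / e ^+ (n + 2) * \int[mu]_y f y.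
Proof.
move=> intf f0; have i1 := integrable_mollification_integrand e0 z intf.
have [tr _ _] := regular_shift_spacetime R n.
have addC : commutative (fun z w : V => z + w) by move=> u w; rewrite addrC.
have i2 := integrable_shift tr addC z intf.
have mf := measurable_int _ intf.
have -> : \int[mu]_y f y = \int[mu]_h f (z + h).
  rewrite /Rintegral -(integral_shift tr z mf); last by move=> y; rewrite lee_fin.
  by congr fine; apply: eq_integral => h _; rewrite addrC.
rewrite -RintegralZl//; apply: le_Rintegral => //.
  exact: (integrableZl measurableT (kernel_const / e ^+ (n + 2)) i2).
by move=> h _; rewrite mulrC ler_wpM2r// kernel_le.
Qed.

(* Jensen's inequality up to a constant: integrate [y <= c + y^r / c^(r-1)]
   with [c] half of the average. *)
Lemma mollification_powR_le f F z (a r : R) : integrable_on f -> integrable_on F ->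
  (forall y, 0 <= f y) -> (forall y, 0 <= F y) -> 0 <= a -> 1 <= r ->
  (forall h, k h != 0 -> a * f (z + h) `^ r <= F (z + h)) ->
  a * M f z `^ r <= 2 `^ r * M F z.
Proof.
move=> intf intF f0 F0 a0 r1 H; have rp : 0 < r by rewrite (lt_le_trans _ r1).
have MF0 : 0 <= M F z by exact: mollification_ge0.
have := mollification_ge0 z f0; rewrite le_eqVlt => /predU1P[<-|Mf0].
  by rewrite powR0 ?gt_eqF// mulr0 mulr_ge0// powR_ge0.
pose c := M f z / 2; have c0 : 0 < c by rewrite divr_gt0.
have cp : 0 < c `^ (r - 1) by exact: powR_gt0.
have key : a * M f z <= a * c + M F z / c `^ (r - 1).
  have i1 := integrable_mollification_integrand e0 z intf.
  have i2 := integrable_mollification_integrand e0 z intF.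
  have I1 := integrableZl measurableT a i1.
  have I2 := integrableZl measurableT (a * c) integrable_kernel.
  have I3 := integrableZl measurableT (c `^ (r - 1))^-1 i2.
  have E1 : \int[mu]_h (a * (f (z + h) * k h)) = a * M f z by rewrite RintegralZl.
  have E2 : \int[mu]_h (a * c * k h) = a * c.
    rewrite RintegralZl//; last exact: integrable_kernel.
    by rewrite /Rintegral integral_kernel//= mulr1.
  have E3 : \int[mu]_h ((c `^ (r - 1))^-1 * (F (z + h) * k h)) = M F z / c `^ (r - 1).
    by rewrite RintegralZl// mulrC.
  rewrite -E1 -{1}E2 -E3 -RintegralD//; apply: le_Rintegral => //.
    by have := integrableD measurableT I2 I3.
  move=> h _; have [->|kh] := eqVneq (k h) 0; first by rewrite !mulr0 addr0.
  rewrite (mulrA a) (mulrA _ (F _)) -mulrDl ler_wpM2r ?kernel_ge0//.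
  have := powR_split (f0 (z + h)) c0 r1 => /(ler_wpM2l a0) /le_trans; apply.
  by rewrite mulrDr lerD2l mulrA mulrC ler_wpM2l ?invr_ge0 ?(ltW cp)// H.
have Mc : M f z = 2 * c by rewrite /c; field.
(* Since the left side of [key] is 2 a c, one half is absorbed. Multiplying by c^(r-1) leaves a c^r,
   and the mean being 2 c yields the factor 2^r. *)
have : a * c <= M F z / c `^ (r - 1).
  by move: key; rewrite Mc; lra.
rewrite ler_pdivlMr// -mulrA mulr_powRB1 ?(ltW c0)// => acr.
rewrite Mc powRM ?(ltW c0)// mulrCA ler_wpM2l ?powR_ge0//.
Qed.

End bounds.

(** * The gradient bound from time slices *)

Section slice_bound.
Context {R : realType} {n : nat}.
Local Notation leb := (@lebesgue_rV R n).
Local Notation X := 'rV[R]_n.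
Local Notation V := ('rV[R]_n * R)%type.
Local Notation VT := ('rV[R]_n * measurableTypeR R)%type.
Local Notation mu := (@spacetime R n).

Definition translated_cube (x : X) (e : R) : set X := [set y | forall j, `|y ord0 j - x ord0 j| <= e].

Lemma measurable_translated_cube x e : measurable (translated_cube x e).
Proof. by apply: compact_measurable_rV; exact: compact_translated_cube. Qed.

Lemma lebesgue_translated_cube x e : 0 <= e -> leb (translated_cube x e) = ((2 * e) ^+ n)%:E.
Proof.
move=> e0; pose A i : set R := `[(x ord0 i - e)%R, (x ord0 i + e)%R]%classic.
have -> : translated_cube x e = [set y : X | forall i, A i (y ord0 i)].
  apply/seteqP; split => y /= H i; first by rewrite /A /= in_itv/= -ler_distl; exact: H.
  by have := H i; rewrite /A /= in_itv/= -ler_distl.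
rewrite lebesgue_rV_box; last by move=> i; exact: measurable_itv.
rewrite (eq_bigr (fun=> (2 * e)%:E)).
  by rewrite prodEFin; congr EFin; rewrite prodr_const card_ord.
move=> i _; rewrite /A lebesgue_measure_itv/= lte_fin -EFinB.
by case: ltP => h; congr EFin; lra.
Qed.

Lemma integral_cst_translated_cube x e (c : R) : 0 <= e ->
  (\int[leb]_(y in translated_cube x e) c%:E = (c * (2 * e) ^+ n)%:E)%E.
Proof.
move=> e0; rewrite integral_cst//; last exact: measurable_translated_cube.
rewrite EFinM; congr (_ * _)%E; exact: lebesgue_translated_cube.
Qed.

Lemma derive_sbump_out (e c : R) (x y : X) v : 0 < e -> ~ translated_cube x e y ->
  'D_v (fun y => c * sbump e (y - x)) y = 0.
Proof.
move=> e0 ny; apply/eqP; apply: contra_notT ny => /derive_supp.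
exact: supp_sbump.
Qed.

(* Each time slice of the kernel is a test function, so the derivative can be moved to it. *)
Lemma mollified_gradient_slice_le : exists2 K : R, 0 <= K &
  forall (e L t : R) (x : X) (B : set X) (J : set R) (w : V -> R) (G : V -> X) i,
  let f := w \_ (B `*` J) in
  let g := (fun z => G z ord0 i) \_ (B `*` J) in
  0 < e -> 0 <= L -> measurable B -> spatial_gradient B J w G ->
  measurable_fun [set: VT] f -> mu.-integrable setT (EFin \o g) ->
  translated_cube x e `<=` B ->
  {ae @lebesgue_measure R, forall s,
    (\int[leb]_(y in translated_cube x e) `|f (y, s)|%:E <= L%:E)%E} ->
  `|mollification e g (x, t)| <= K / e ^+ n.+1 * L.
Proof.
have [C C0 HC] := @derive_sbump_le R n.
have kc0 : 0 < @kernel_const R n by exact: kernel_const_gt0.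
exists (2 * @kernel_const R n * C); first by rewrite !mulr_ge0// ltW.
move=> e L t x B J w G i f g e0 L0 mB sG mf intg xB HL.
have e20 : 0 < e ^+ 2 by rewrite exprn_gt0.
(* For fixed [s] the kernel centred at (x, t) is [c s] times the spatial bump at [x]; [c s] collects
   the normalisation and the time factor. *)
pose c s := (@bump_mass R n e)^-1 * beta ((s - t) * (e ^+ 2)^-1).
pose A := @kernel_const R n / e ^+ (n + 2) * (C / e).
have A0 : 0 <= A by rewrite mulr_ge0// divr_ge0 ?exprn_ge0 ?(ltW e0)// ltW.
have cA s : `|c s| * (C / e) <= A.
  rewrite ler_wpM2r ?divr_ge0 ?(ltW e0)// ger0_norm.
    apply: le_trans (bump_mass_inv_le e0); rewrite ler_piMr ?invr_ge0 ?(ltW (bump_mass_gt0 e0))//.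
    by have /andP[] := beta_bounds ((s - t) * (e ^+ 2)^-1).
  by rewrite mulr_ge0 ?beta_ge0// invr_ge0 ltW// bump_mass_gt0.
have c0 s : e ^+ 2 < `|s - t| -> c s = 0.
  move=> st; rewrite /c; have [->|/beta_neq0] := eqVneq (beta ((s - t) / e ^+ 2)) 0; first by rewrite mulr0.
  rewrite normrM (gtr0_norm (_ : 0 < (e ^+ 2)^-1)) ?invr_gt0// ltr_pdivrMr// mul1r => st'.
  by have := lt_trans st st'; rewrite ltxx.
have kE y s : parabolic_kernel e ((y, s) - (x, t) : V) = c s * sbump e (y - x).
  by rewrite /parabolic_kernel /parabolic_bump /c /sbump /= -mulrA (mulrC (beta _)).
pose h (z : VT) : \bar R := (g z * parabolic_kernel e (z - (x, t) : V))%:E.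
have ih : mu.-integrable setT h.
  apply: (integrable_mul_bounded intg (C := @kernel_const R n / e ^+ (n + 2))).
    exact: (tame_measurable_shift (x, t) (@tame_kernel R n e)).
  by move=> y; rewrite ger0_norm ?kernel_ge0// kernel_le.
have ME : (mollification e g (x, t))%:E = (\int[mu]_z h z)%E.
  rewrite mollificationE//; last by apply/measurable_EFinP; exact: measurable_int intg.
  by rewrite /correlation /Rintegral fineK//; exact: integrable_fin_num ih.
rewrite -lee_fin -abse_EFin ME.
have := @integral21_prod_meas1 _ _ _ _ R leb (@lebesgue_measure R) h ih => <-.
have mG := measurable_fubini_G (m1 := leb) (m2 := @lebesgue_measure R) ih.
apply: (le_trans (le_abse_integral _ measurableT mG)).
pose I : set (measurableTypeR R) := `[(t - e ^+ 2)%R, (t + e ^+ 2)%R]%classic.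
have mI : measurable I by exact: measurable_itv.
have IE s : I s = (`|s - t| <= e ^+ 2).
  by rewrite /I /= in_itv/= -ler_distl.
(* The relevant times fill an interval of length 2 e^2, which turns the factor e^-(n+3) of [A] into
   e^-(n+1). *)
apply: (@le_trans _ _ (\int[lebesgue_measure]_(s in I) (A * L)%:E)%E); last first.
  rewrite integral_cst//.
  have Im : lebesgue_measure I = (2 * e ^+ 2)%:E.
    rewrite /I lebesgue_measure_itv/= lte_fin ifT; last by lra.
    by rewrite -EFinB; congr EFin; ring.
  rewrite [X in (_ * X <= _)%E]Im -EFinM lee_fin /A le_eqVlt; apply/orP; left; apply/eqP.
  rewrite exprD [e ^+ n.+1]exprS; field.
  by rewrite expf_neq0 gt_eqF.
rewrite [leRHS]integral_mkcond; apply: ae_ge0_le_integral => //.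
- exact: measurableT_comp.
- by move=> s _; rewrite patchE; case: ifPn => // _; rewrite lee_fin mulr_ge0.
- have mc : measurable_fun I (fun=> (A * L)%:E) by [].
  exact: (measurable_restrictT _ mI).1 mc.
apply: aeS2 (ae_slice_parts mB sG) HL => s Hs HL _.
have tphi : test_function B (fun y => c s * sbump e (y - x)) by exact: test_function_sbump.
have -> : (fubini_G leb h s = \int[leb]_y (g (y, s) * (c s * sbump e (y - x)))%:E)%E.
  by apply: eq_integral => y _; rewrite /h kE.
rewrite patchE; case: ifPn => [_|/negP nI]; last first.
  rewrite integral0_eq ?abse0// => y _; rewrite c0 ?mul0r ?mulr0//.
  by rewrite ltNge; apply/negP; rewrite -IE => /mem_set.
have := Hs _ i tphi; rewrite -/f -/g => /(congr1 -%E); rewrite oppeK => <-.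
rewrite abseN; set D : X -> R := 'D_(delta_mx ord0 i) (fun y : X => c s * sbump e (y - x)).
have mD : measurable_fun setT D.
  by apply: test_function_measurable; exact: test_function_derive tphi.
have mfs : measurable_fun setT (fun y => f (y, s)).
  exact: (measurableT_comp mf (measurable_section1 s)).
have mfD : measurable_fun setT (fun y => (f (y, s) * D y)%:E).
  by apply/measurable_EFinP/measurable_funM.
apply: (le_trans (le_abse_integral _ measurableT mfD)).
apply: (@le_trans _ _ (\int[leb]_(y in translated_cube x e) (A%:E * `|f (y, s)|%:E))%E); last first.
  have mfa : measurable_fun (translated_cube x e) (fun y => `|f (y, s)|%:E).
    by apply/measurable_EFinP/measurableT_comp => //; exact: measurable_funTS.
  rewrite (ge0_integralZl _ (measurable_translated_cube x e) mfa)//.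
  by rewrite (EFinM A L); apply: lee_wpmul2l; rewrite ?lee_fin.
rewrite [leRHS]integral_mkcond; apply: ge0_le_integral => //.
- exact: measurableT_comp.
- have mfa : measurable_fun (translated_cube x e) (fun y => A%:E * `|f (y, s)|%:E)%E.
    apply: measurable_funeM; apply/measurable_EFinP/measurableT_comp => //; exact: measurable_funTS.
  exact: (measurable_restrictT _ (measurable_translated_cube x e)).1 mfa.
move=> y _; rewrite patchE abse_EFin; case: ifPn => [_|/negP ny]; last first.
  rewrite /D derive_sbump_out ?mulr0 ?normr0// => xy; apply: ny; exact: mem_set.
rewrite -EFinM lee_fin normrM mulrC ler_wpM2r//.
by apply: le_trans (cA s); exact: HC.
Qed.

End slice_bound.

(** * Passage to the limit *)

Section fast_L1.
Context d (T : measurableType d) (R : realType) (m : {measure set T -> \bar R}).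

(** [S] is the sum of all the errors. Its integral is at most 1, so it is finite almost everywhere
    and the errors tend to zero there; being larger than each error, it also provides the
    majorant. *)
Lemma fast_L1_cvg (D : set T) (u : nat -> T -> R) (v : T -> R) : measurable D ->
  (forall k, measurable_fun D (u k)) -> measurable_fun D v ->
  (forall k, \int[m]_(z in D) `|u k z - v z|%:E <= (1 / (2 ^ k.+1)%:R)%:E)%E ->
  exists S : T -> \bar R, [/\ m.-integrable D S,
    forall k z, D z -> (`|u k z - v z|%:E <= S z)%E &
    {ae m, forall z, D z -> u k z @[k --> \oo] --> v z}].
Proof.
move=> mD mu mv H.
pose t k z := (`|u k z - v z|%:E : \bar R).
have t0 k z : (0 <= t k z)%E by rewrite lee_fin.
have mt k : measurable_fun D (t k).
  by apply/measurable_EFinP/measurableT_comp => //; exact: measurable_funB.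
pose S z := (\sum_(0 <= k <oo) t k z)%E.
have S0 z : (0 <= S z)%E by exact: nneseries_ge0.
have iS : m.-integrable D S.
  apply/integrableP; split.
    by apply: ge0_emeasurable_sum => // k z _ _; exact: t0.
  under eq_integral do rewrite gee0_abs//.
  rewrite /S integral_nneseries//.
  apply: (@le_lt_trans _ _ 1%:E); last exact: ltry.
  apply: le_trans (epsilon_trick0 xpredT ler01).
  by apply: lee_nneseries => [k _ _|k _]; [exact: integral_ge0|exact: H].
have tS k z : (t k z <= S z)%E.
  apply: le_trans (nneseries_lim_ge k.+1 (fun j _ _ => t0 j z)).
  rewrite big_nat_recr//= leeDr// sume_ge0//.
exists S; split => //; first by move=> k z _; exact: tS.
apply: filterS (integrable_ae mD iS) => z Hz Dz; have {}Hz := Hz Dz.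
apply/subr_cvg0; apply/norm_cvg0P; apply: cvg_series_cvg_0.
apply: nondecreasing_is_cvgn.
  by apply/nondecreasing_seqP => k; rewrite /series/= big_nat_recr//= lerDl.
exists (fine (S z)) => _ [k _ <-]; rewrite -lee_fin fineK// /series/= -sumEFin.
exact: (nneseries_lim_ge k (fun j _ _ => t0 j z)).
Qed.

End fast_L1.

Section convergence.
Context {R : realType}.

(** The limit 0 is treated apart, since for positive limits continuity comes from writing the power
    as an exponential of a logarithm. *)
Lemma cvg_powR (u : nat -> R) (l p : R) : 0 < p -> (forall k, 0 <= u k) ->
  u k @[k --> \oo] --> l -> u k `^ p @[k --> \oo] --> l `^ p.
Proof.
move=> p0 u0 ul; have l0 : 0 <= l.
  rewrite -(cvg_lim _ ul)//; apply: limr_ge; first exact: cvgP ul.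
  exact: nearW.
move: l0; rewrite le_eqVlt => /predU1P[l0|l0].
  rewrite -l0 powR0 ?gt_eqF//; apply/cvgrPdist_lt => e e0.
  have ep : 0 < e `^ p^-1 by exact: powR_gt0.
  move/cvgrPdist_lt : ul => /(_ _ ep); apply: filterS => k.
  rewrite -l0 !sub0r !normrN (ger0_norm (u0 k)) (ger0_norm (powR_ge0 _ _)) => uk.
  have -> : e = (e `^ p^-1) `^ p by rewrite -powRrM mulVf ?gt_eqF// powRr1// ltW.
  by rewrite gt0_ltr_powR ?nnegrE ?powR_ge0.
rewrite {2}/powR gt_eqF//.
have : expR (p * ln (u k)) @[k --> \oo] --> expR (p * ln l).
  apply: continuous_cvg; first exact: continuous_expR.
  apply: cvgMr => //; apply: continuous_cvg => //; exact: continuous_ln.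
apply: cvg_trans; apply: near_eq_cvg; near=> k; rewrite /powR gt_eqF//.
near: k; apply: cvgr_gt ul _ l0.
Unshelve. all: by end_near. Qed.

Lemma cvg_rV (n : nat) (u : nat -> 'rV[R]_n) (v : 'rV[R]_n) :
  (forall i, u k ord0 i @[k --> \oo] --> v ord0 i) -> u k @[k --> \oo] --> v.
Proof.
move=> H; apply/cvgrPdist_le => e e0.
have : \forall k \near \oo, forall i : 'I_n, `|v ord0 i - u k ord0 i| <= e.
  by apply: filter_forall => i; move/cvgrPdist_le : (H i) => /(_ _ e0).
apply: filterS => k Hk; apply: norm_le_coord; first exact: ltW.
by move=> i; rewrite !mxE; exact: Hk.
Qed.

Lemma cvg_poweR0 (u : nat -> \bar R) (r : R) : 0 < r -> (forall k, 0 <= u k)%E ->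
  u k @[k --> \oo] --> 0%E -> (u k `^ r)%E @[k --> \oo] --> 0%E.
Proof.
move=> r0 u0 cu.
have [uf cfu] : (\forall k \near \oo, u k \is a fin_num) /\ fine (u k) @[k --> \oo] --> 0.
  by move/fine_cvgP : cu.
apply/fine_cvgP; split; first by apply: filterS uf => k; exact: fin_num_poweR.
rewrite (_ : _ \o _ = fun k => fine (u k) `^ r); last by apply/funext => k /=; rewrite fine_poweR.
rewrite -(powR0 (lt0r_neq0 r0)); apply: cvg_powR => // k; exact: fine_ge0.
Qed.

Lemma powR_add_le (x y p : R) : 0 <= x -> 0 <= y -> 0 <= p ->
  (x + y) `^ p <= 2 `^ p * (x `^ p + y `^ p).
Proof.
move=> x0 y0 p0; rewrite mulrDr.
have H (u v : R) : 0 <= u -> u <= v -> (u + v) `^ p <= 2 `^ p * v `^ p.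
  move=> u0 uv; have v0 := le_trans u0 uv.
  by rewrite -powRM// ge0_ler_powR ?nnegrE ?mulr_ge0 ?addr_ge0//; lra.
have [xy|/ltW yx] := leP x y.
  by rewrite (le_trans (H _ _ x0 xy))// lerDr mulr_ge0 ?powR_ge0.
by rewrite addrC (le_trans (H _ _ y0 yx))// lerDl mulr_ge0 ?powR_ge0.
Qed.

Lemma enormB_le (n : nat) (x y : 'rV[R]_n) : enorm (x - y) <= n%:R * (enorm x + enorm y).
Proof.
apply: (le_trans (enorm_le_sum _)).
rewrite (_ : n%:R * _ = \sum_(i < n) (enorm x + enorm y)); last first.
  by rewrite sumr_const card_ord mulr_natl.
apply: ler_sum => i _; rewrite !mxE (le_trans (ler_normB _ _))// lerD//; exact: coord_le_enorm.
Qed.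

End convergence.

(** * Dominated convergence with a common density *)

Section assembly.
Context {R : realType} {n : nat}.
Local Notation leb := (@lebesgue_rV R n).
Local Notation X := 'rV[R]_n.
Local Notation V := ('rV[R]_n * R)%type.
Local Notation VT := ('rV[R]_n * measurableTypeR R)%type.
Local Notation mu := (@spacetime R n).

Lemma measurable_fun_rV_on d (T : measurableType d) (D : set T) (F : T -> X) : measurable D ->
  (forall i, measurable_fun D (fun z => F z ord0 i)) -> measurable_fun D F.
Proof.
move=> mD mF; apply/(measurable_restrictT _ mD); apply/measurable_fun_rVP => i.
rewrite (_ : (fun _ => _) = (fun z => F z ord0 i) \_ D); first exact: (measurable_restrictT _ mD).1.
by apply/funext => z; rewrite !patchE; case: ifPn => // _; rewrite mxE.
Qed.

Lemma weak_gradientB (B : set X) (u1 u2 : X -> R) (g1 g2 : X -> X) : measurable B ->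
  weak_gradient B u1 g1 -> weak_gradient B u2 g2 ->
  weak_gradient B (fun x => u1 x - u2 x) (fun x => g1 x - g2 x).
Proof.
move=> mB [lu1 lg1 H1] [lu2 lg2 H2]; split; first exact: loc_integrableB.
  by move=> i; under eq_fun do rewrite !mxE; exact: loc_integrableB.
move=> phi i tphi; have tD := test_function_derive (delta_mx ord0 i) tphi.
under eq_Rintegral do rewrite mulrBl.
rewrite (RintegralB mB (test_function_integrable mB lu1 tD) (test_function_integrable mB lu2 tD)).
under [in RHS]eq_Rintegral do rewrite !mxE mulrBl.
rewrite (RintegralB mB (test_function_integrable mB (lg1 i) tphi) (test_function_integrable mB (lg2 i) tphi)).
by rewrite H1// H2// opprB opprK addrC.
Qed.

Variables (p q : R) (a : V -> R) (B : set X) (J : set R) (w : V -> R) (G : V -> X).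
Variables (wm : nat -> V -> R) (Gm : nat -> V -> X) (Hm : nat -> V -> R) (H : V -> R) (C : R).
Local Notation Q := (B `*` J : set VT).
Hypotheses (p1 : 1 <= p) (q1 : 1 <= q) (C0 : 0 <= C).
Hypotheses (bB : is_euclidean_ball B) (mJ : measurable (J : set (measurableTypeR R))).
Hypotheses (ma : measurable_fun Q a) (a0 : forall z, Q z -> 0 <= a z).
Hypotheses (mw : measurable_fun Q w) (sG : spatial_gradient B J w G).
Hypotheses (mwm : forall m, measurable_fun Q (wm m)).
Hypotheses (sGm : forall m, spatial_gradient B J (wm m) (Gm m)).
Hypotheses (iH : mu.-integrable Q (EFin \o H)) (iHm : forall m, mu.-integrable Q (EFin \o Hm m)).
Hypothesis wL1 : forall m,
  (\int[mu]_(z in Q) `|wm m z - w z|%:E <= (1 / (2 ^ m.+1)%:R)%:E)%E.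
Hypothesis GL1 : forall i m,
  (\int[mu]_(z in Q) `|Gm m z ord0 i - G z ord0 i|%:E <= (1 / (2 ^ m.+1)%:R)%:E)%E.
Hypothesis HL1 : forall m,
  (\int[mu]_(z in Q) `|Hm m z - H z|%:E <= (1 / (2 ^ m.+1)%:R)%:E)%E.
Hypothesis wH : forall z, Q z -> `|w z| `^ p + enorm (G z) `^ p <= C * H z.
Hypothesis wHm : forall m z, Q z -> `|wm m z| `^ p <= C * Hm m z.
Hypothesis GHm : forall m z, Q z ->
  enorm (Gm m z) `^ p + a z * enorm (Gm m z) `^ q <= C * Hm m z.

Let mB : measurable B. Proof. exact: euclidean_ball_measurable. Qed.
Let mQ : measurable Q. Proof. exact: measurableX. Qed.
Let p0 : 0 < p. Proof. exact: lt_le_trans p1. Qed.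
Let q0 : 0 < q. Proof. exact: lt_le_trans q1. Qed.

Let mG : measurable_fun Q G. Proof. by case: sG. Qed.
Let mGm m : measurable_fun Q (Gm m). Proof. by case: (sGm m). Qed.
Let mH : measurable_fun Q H. Proof. by apply/measurable_EFinP; exact: measurable_int iH. Qed.
Let mHm m : measurable_fun Q (Hm m).
Proof. by apply/measurable_EFinP; exact: measurable_int (iHm m). Qed.

Let menorm (F : V -> X) (r : R) : measurable_fun Q F -> measurable_fun Q (fun z => enorm (F z) `^ r).
Proof.
move=> mF; apply: (measurableT_comp (measurable_powR r)).
exact: (measurableT_comp measurable_enorm mF).
Qed.

Let mabs (f : V -> R) (r : R) : measurable_fun Q f -> measurable_fun Q (fun z => `|f z| `^ r).
Proof.
by move=> mf; apply: (measurableT_comp (measurable_powR r)); exact: measurableT_comp mf.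
Qed.

Let aeG : {ae mu, forall z, Q z -> Gm m z @[m --> \oo] --> G z}.
Proof.
have : forall i, {ae mu, forall z, Q z -> Gm m z ord0 i @[m --> \oo] --> G z ord0 i}.
  move=> i; have mi m := measurable_coord_fun i mQ (mGm m).
  by have [S [_ _]] := fast_L1_cvg (m := mu) mQ mi (measurable_coord_fun i mQ mG) (GL1 i).
move=> /filter_forall; apply: aeS => z Hz Dz; apply: cvg_rV => i; exact: Hz.
Qed.

Lemma energy_approximation :
  energy p q a B J (wm m) @[m --> \oo] --> energy p q a B J w.
Proof.
have [S [iS HS _]] := fast_L1_cvg mQ mHm mH HL1.
under eq_fun do rewrite (energy_gradient p q bB mJ ma a0 (sGm _)).
rewrite (energy_gradient p q bB mJ ma a0 sG).
pose F (g : V -> X) z := (enorm (g z) `^ p + a z * enorm (g z) `^ q)%:E.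
have mF (g : V -> X) : measurable_fun Q g -> measurable_fun Q (F g).
  move=> mg; apply/measurable_EFinP/measurable_funD; first exact: menorm.
  by apply: measurable_funM => //; exact: menorm.
(* The majorants [C * Hm m] vary with [m], but [Hm m] is at most [H + S], which does not. *)
pose D z := (C%:E * ((EFin \o H) z + S z))%E.
have iD : mu.-integrable Q D by apply: integrableZl => //; exact: integrableD.
have mFm m : measurable_fun Q (F (Gm m)) by exact: mF.
have [||_ _] // := dominated_convergence mQ mFm (mF _ mG) _ iD.
- apply: aeS aeG => z Hz Qz; have {}Hz := Hz Qz.
  have ce : enorm (Gm m z) @[m --> \oo] --> enorm (G z).
    by apply: continuous_cvg => //; exact: continuous_enorm.
  apply: cvg_EFin; first exact: nearW.
  apply: cvgD; last apply: cvgMr.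
    by apply: cvg_powR => // k; exact: enorm_ge0.
  by apply: cvg_powR => // k; exact: enorm_ge0.
- apply: aeW => z m Qz; rewrite /F abse_EFin ger0_norm; last first.
    by rewrite addr_ge0 ?mulr_ge0 ?powR_ge0// a0.
  apply: (@le_trans _ _ (C * Hm m z)%:E); first by rewrite lee_fin GHm.
  rewrite EFinM /D lee_wpmul2l ?lee_fin//=.
  have -> : Hm m z = H z + (Hm m z - H z) by rewrite addrC subrK.
  rewrite EFinD leeD2l//; apply: le_trans (HS m z Qz).
  by rewrite lee_fin ler_norm.
Qed.

Lemma LpW1p_approximation m : LpW1p p B J (wm m).
Proof.
split; [exact: mwm|by exists (Gm m); exact: sGm|].
rewrite (LpW1p_norm_gradient p bB mJ (mwm m) (sGm m)); apply: poweR_lty.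
have iC : mu.-integrable Q (fun z => (2 * C)%:E * (EFin \o Hm m) z)%E by exact: integrableZl.
have /integrableP[_] := iC; apply: le_lt_trans.
apply: ge0_le_integral => //.
- by move=> z _; rewrite lee_fin addr_ge0 ?powR_ge0.
- by apply/measurable_EFinP/measurable_funD; [exact: mabs|exact: menorm].
- by apply: measurableT_comp => //; exact: measurable_int iC.
move=> z Qz; rewrite /= lee_fin; apply: le_trans (ler_norm _).
rewrite -mulrA mulr_natl mulr2n lerD ?wHm//; apply: le_trans (GHm m Qz).
by rewrite lerDl mulr_ge0 ?powR_ge0// a0.
Qed.

Lemma LpW1p_norm_approximation : LpW1p_norm p B J (wm m \- w) @[m --> \oo] --> 0%E.
Proof.
have [S [iS HS _]] := fast_L1_cvg mQ mHm mH HL1.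
have [Sw [_ _ aew]] := fast_L1_cvg mQ mwm mw wL1.
have sD m : spatial_gradient B J (wm m \- w) (fun z => Gm m z - G z).
  have mGB : measurable_fun Q (fun z => Gm m z - G z).
    apply: measurable_fun_rV_on => // i; under eq_fun do rewrite !mxE.
    by apply: measurable_funB; exact: measurable_coord_fun.
  split; first exact: mGB.
  case: sG => _; case: (sGm m) => _; apply: aeS2 => t h1 h2 Jt.
  exact: (weak_gradientB mB (h1 Jt) (h2 Jt)).
have mwB m : measurable_fun Q (wm m \- w) by exact: measurable_funB.
under eq_fun do rewrite (LpW1p_norm_gradient p bB mJ (mwB _) (sD _)).
pose F (u : V -> R) (g : V -> X) z := (`|u z| `^ p + enorm (g z) `^ p)%:E.
have F0 u g z : (0 <= F u g z)%E by rewrite lee_fin addr_ge0 ?powR_ge0.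
apply: cvg_poweR0; first by rewrite invr_gt0.
  move=> k; apply: integral_ge0 => z _; rewrite lee_fin.
  by rewrite addr_ge0 ?powR_ge0.
(* The factor 2^p is the cost of the p-th power of a sum, and n^p that of the coordinatewise
   triangle inequality [enormB_le]. *)
pose K := 2 `^ p * (1 + n%:R `^ p) * C.
have K0 : 0 <= K by rewrite !mulr_ge0 ?addr_ge0 ?powR_ge0.
pose D z := (K%:E * ((EFin \o H) z + ((EFin \o H) z + S z)))%E.
have iD : mu.-integrable Q D.
  by apply: integrableZl => //; apply: integrableD => //; exact: integrableD.
have mFm m : measurable_fun Q (F (wm m \- w) (fun z => Gm m z - G z)).
  apply/measurable_EFinP/measurable_funD; first exact: mabs.
  by apply: menorm; case: (sD m).
have [||_ _] // := dominated_convergence mQ mFm (measurable_cst 0%E) _ iD.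
- apply: aeS2 aeG aew => z Hz1 Hz2 Qz; have {}Hz1 := Hz1 Qz; have {}Hz2 := Hz2 Qz.
  apply: cvg_EFin; first exact: nearW.
  have -> : (0 : R) = `|w z - w z| `^ p + enorm (G z - G z) `^ p.
    rewrite subrr normr0 subrr (_ : enorm 0 = 0) ?powR0 ?gt_eqF ?addr0//.
    by rewrite /enorm big1 ?sqrtr0// => i _; rewrite mxE expr0n.
  apply: cvgD.
    apply: cvg_powR => //; apply: cvg_norm; apply: cvgB => //; exact: cvg_cst.
  apply: cvg_powR => // [k|]; first exact: enorm_ge0.
  apply: continuous_cvg; first exact: continuous_enorm.
  by apply: cvgB => //; exact: cvg_cst.
- apply: aeW => z m Qz; rewrite /F abse_EFin ger0_norm; last by rewrite addr_ge0 ?powR_ge0.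
  apply: (@le_trans _ _ (K * (H z + Hm m z))%:E).
    rewrite lee_fin.
    have h1 : `|wm m z - w z| `^ p <= 2 `^ p * (`|wm m z| `^ p + `|w z| `^ p).
      apply: le_trans (powR_add_le _ _ (ltW p0)) => //.
      by rewrite ge0_ler_powR ?nnegrE ?addr_ge0 ?(ltW p0)// ler_normB.
    have h2 : enorm (Gm m z - G z) `^ p <=
        n%:R `^ p * (2 `^ p * (enorm (Gm m z) `^ p + enorm (G z) `^ p)).
      apply: (@le_trans _ _ ((n%:R * (enorm (Gm m z) + enorm (G z))) `^ p)).
        by rewrite ge0_ler_powR ?nnegrE ?mulr_ge0 ?addr_ge0 ?enorm_ge0 ?(ltW p0)// enormB_le.
      rewrite powRM ?addr_ge0 ?enorm_ge0// ler_wpM2l ?powR_ge0//.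
      by apply: powR_add_le; rewrite ?enorm_ge0 ?(ltW p0).
    have g1 : enorm (Gm m z) `^ p <= C * Hm m z.
      by apply: le_trans (GHm m Qz); rewrite lerDl mulr_ge0 ?powR_ge0// a0.
    have w1 := wHm m Qz; have wg := wH Qz.
    have e1 : 0 <= enorm (G z) `^ p by exact: powR_ge0.
    have e2 : 0 <= `|w z| `^ p by exact: powR_ge0.
    apply: (le_trans (lerD h1 h2)).
    rewrite (_ : K * _ = 2 `^ p * (C * Hm m z + C * H z) +
      n%:R `^ p * (2 `^ p * (C * Hm m z + C * H z))); last by rewrite /K; ring.
    by rewrite lerD// ?ler_wpM2l ?powR_ge0// lerD//; lra.
  rewrite EFinM /D lee_wpmul2l ?lee_fin//= EFinD leeD2l//.
  have -> : Hm m z = H z + (Hm m z - H z) by rewrite addrC subrK.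
  rewrite EFinD leeD2l//; apply: le_trans (HS m z Qz).
  by rewrite lee_fin ler_norm.
by rewrite integral0.
Qed.

End assembly.

(** * Domination of the mollified energy *)

Section core.
Context {R : realType} {n : nat}.
Local Notation leb := (@lebesgue_rV R n).
Local Notation X := 'rV[R]_n.
Local Notation V := ('rV[R]_n * R)%type.
Local Notation VT := ('rV[R]_n * measurableTypeR R)%type.
Local Notation mu := (@spacetime R n).
Local Notation integrable_on f := (mu.-integrable setT (EFin \o f)).

Lemma mollification_L1 (f : V -> R) (eta : R) : integrable_on f -> 0 < eta ->
  \forall e \near 0^'+, (\int[mu]_z `|mollification e f z - f z|%:E <= eta%:E)%E.
Proof.
move=> intf eta0; have [tr bS sr] := regular_shift_spacetime R n.
have addC : commutative (fun z w : V => z + w) by move=> u w; rewrite addrC.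
have [r r0 Hr] := integrable_shift_continuous tr bS sr intf eta0.
(* Below scale 1 the temporal extent e^2 of the kernel is at most [e], so its support fits into the
   box of size [r]. *)
have r1 : 0 < Num.min r 1 by rewrite lt_min r0 ltr01.
near=> e.
have e0 : 0 < e by [].
have : e < Num.min r 1 by near: e; exact: nbhs_right_lt.
rewrite lt_min => /andP[er e1].
have k0 h : 0 <= @parabolic_kernel R n e h by exact: kernel_ge0.
have kC h : @parabolic_kernel R n e h <= @kernel_const R n / e ^+ (n + 2) by exact: kernel_le.
apply: (mollify_L1_le tr addC (measurable_kernel e) k0 kC (integral_kernel e0) intf).
move=> h /(kernel_neq0 e0)[h1 h2].
apply: Hr; split => [i|]; first exact: lt_trans er.
apply: lt_trans h2 _; apply: lt_trans er; rewrite expr2 gtr_pMr//.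
Unshelve. all: by end_near. Qed.

Lemma kernel_norm_le (e : R) (h : V) : 0 < e -> e <= 1 -> parabolic_kernel e h != 0 -> `|h| <= e.
Proof.
move=> e0 e1 /(kernel_neq0 e0)[h1 h2]; rewrite prod_normE ge_max; apply/andP; split.
  by apply: norm_le_coord; [exact: ltW|move=> i; exact: ltW].
by apply: (le_trans (ltW h2)); rewrite expr2 ger_pMr.
Qed.

(** A time shift below e^2 raised to alpha / 2 stays below e^alpha, matching the spatial part. The
    constant n^alpha comes from bounding the Euclidean norm by the sum of the coordinates. *)
Lemma kernel_parabolic_le (alpha e : R) (h : V) : 0 < alpha -> 0 < e ->
  parabolic_kernel e h != 0 ->
  Num.max (enorm h.1 `^ alpha) (`|h.2| `^ (alpha / 2)) <= (n%:R `^ alpha + 1) * e `^ alpha.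
Proof.
move=> al0 e0 /(kernel_neq0 e0)[h1 h2]; rewrite mulrDl mul1r ge_max; apply/andP; split.
  rewrite -[leLHS]addr0 lerD ?powR_ge0// -powRM ?(ltW e0)//.
  rewrite ge0_ler_powR ?nnegrE ?enorm_ge0 ?mulr_ge0 ?(ltW e0) ?(ltW al0)//.
  apply: (le_trans (enorm_le_sum _)); rewrite (_ : n%:R * e = \sum_(i < n) e).
    by apply: ler_sum => i _; exact: ltW.
  by rewrite sumr_const card_ord mulr_natl.
rewrite -[leLHS]add0r lerD ?mulr_ge0 ?powR_ge0//.
have -> : e `^ alpha = (e ^+ 2) `^ (alpha / 2).
  by rewrite -(powR_mulrn 2 (ltW e0)) -powRrM mulrCA mulfV ?mulr1.
by rewrite ge0_ler_powR ?nnegrE ?exprn_ge0 ?(ltW e0) ?(ltW h2)// divr_ge0 ?(ltW al0).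
Qed.

Variables (p q alpha : R) (a : V -> R) (B B' : set X) (J J' : set R) (w : V -> R) (G : V -> X).
Local Notation Q := (B `*` J : set VT).
Local Notation Q' := (B' `*` J' : set VT).
Hypotheses (p1 : 1 <= p) (pq : p < q) (alpha0 : 0 < alpha).
Hypotheses (bB : is_euclidean_ball B) (mJ : measurable (J : set (measurableTypeR R))).
Hypotheses (bB' : is_euclidean_ball B') (mJ' : measurable (J' : set (measurableTypeR R))).
Hypotheses (ma : measurable_fun Q' a) (a0 : forall z, Q' z -> 0 <= a z).
Hypotheses (mw : measurable_fun Q' w) (sG : spatial_gradient B' J' w G).
Hypothesis (Qoo : (mu Q' < +oo)%E).
Variables (delta c : R).
Hypotheses (delta0 : 0 < delta) (c0 : 0 <= c).
Hypothesis margin : forall z h : V, Q z -> `|h| < delta -> Q' (z + h).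
Hypothesis holder : forall z y : V, Q' z -> Q' y ->
  `|a z - a y| <= c * Num.max (enorm (z.1 - y.1) `^ alpha) (`|z.2 - y.2| `^ (alpha / 2)).
Hypothesis normoo : (\int[mu]_(z in Q') (`|w z| `^ p + enorm (G z) `^ p)%:E < +oo)%E.
Hypothesis energyoo : (\int[mu]_(z in Q') (enorm (G z) `^ p + a z * enorm (G z) `^ q)%:E < +oo)%E.

(** Extension by zero makes these functions integrable on all of space-time, so they can be
    mollified globally; on [Q], at scales below [delta], the kernel sees only their values in
    [Q']. *)
Definition cut_fun : V -> R := w \_ Q'.
Definition cut_grad i : V -> R := (fun z => G z ord0 i) \_ Q'.
Definition cut_norm : V -> R := (fun z => enorm (G z)) \_ Q'.
(** The term in [w] is included so that a single density controls both the norm and the energy of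
    the mollifications. *)
Definition cut_density : V -> R :=
  (fun z => `|w z| `^ p + enorm (G z) `^ p + a z * enorm (G z) `^ q) \_ Q'.
Definition mollified_grad (e : R) (z : V) : X := \row_i mollification e (cut_grad i) z.

Variables (K gam : R).
Hypotheses (K0 : 0 <= K) (gam_le : gam * (q - p) <= alpha).
Hypothesis grad_bound : \forall e \near 0^'+, forall z, Q z ->
  enorm (mollified_grad e z) <= K * e `^ (- gam).

Let mB : measurable B. Proof. exact: euclidean_ball_measurable. Qed.
Let mB' : measurable B'. Proof. exact: euclidean_ball_measurable. Qed.
Let mQ : measurable Q. Proof. exact: measurableX. Qed.
Let mQ' : measurable Q'. Proof. exact: measurableX. Qed.
Let p0 : 0 < p. Proof. exact: lt_le_trans p1. Qed.
Let q0 : 0 < q. Proof. exact: lt_trans pq. Qed.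
Let q1 : 1 <= q. Proof. exact: le_trans (ltW pq). Qed.
Let mG : measurable_fun Q' G. Proof. by case: sG. Qed.

Let integrable_cut (f : V -> R) : measurable_fun Q' f ->
  (\int[mu]_(z in Q') `|f z|%:E < +oo)%E -> integrable_on (f \_ Q').
Proof.
move=> mf foo; rewrite -restrict_EFin; apply/(integrable_mkcond _ mQ').
by apply/integrableP; split => //; exact/measurable_EFinP.
Qed.

(* On a set of finite measure, [x <= 1 + x^p] gives integrability from p-integrability. *)
Let integrable_cut_powR (f F : V -> R) : measurable_fun Q' f -> measurable_fun Q' F ->
  (forall z, Q' z -> `|f z| `^ p <= F z) -> (\int[mu]_(z in Q') (F z)%:E < +oo)%E ->
  integrable_on (f \_ Q').
Proof.
move=> mf mF fF Foo; apply: integrable_cut => //.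
have F0 z : Q' z -> (0 <= (F z)%:E)%E by move=> Qz; rewrite lee_fin (le_trans _ (fF z Qz))// powR_ge0.
apply: (@le_lt_trans _ _ (\int[mu]_(z in Q') (1%:E + (F z)%:E))%E).
  apply: ge0_le_integral => //.
  - by apply/measurable_EFinP; exact: measurableT_comp mf.
  - by apply: emeasurable_funD => //; exact/measurable_EFinP.
  move=> z Qz; rewrite -EFinD lee_fin.
  have := powR_split (normr_ge0 (f z)) ltr01 p1.
  rewrite powR1 divr1 => /le_trans; apply; rewrite lerD2l; exact: fF.
rewrite ge0_integralD//; last exact/measurable_EFinP.
by rewrite integral_cst// mul1e lte_add_pinfty.
Qed.

Let mwp : measurable_fun Q' (fun z => `|w z| `^ p).
Proof. by apply: (measurableT_comp (measurable_powR p)); exact: measurableT_comp mw. Qed.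
Let mGr r : measurable_fun Q' (fun z => enorm (G z) `^ r).
Proof. by apply: (measurableT_comp (measurable_powR r)); exact: (measurableT_comp measurable_enorm mG). Qed.
Let maG : measurable_fun Q' (fun z => a z * enorm (G z) `^ q).
Proof. exact: measurable_funM. Qed.

Lemma integrable_cut_fun : integrable_on cut_fun.
Proof.
apply: (@integrable_cut_powR _ (fun z => `|w z| `^ p + enorm (G z) `^ p)) => //.
  exact: measurable_funD.
by move=> z _; rewrite lerDl powR_ge0.
Qed.

Lemma integrable_cut_norm : integrable_on cut_norm.
Proof.
apply: (@integrable_cut_powR _ (fun z => `|w z| `^ p + enorm (G z) `^ p)) => //.
- exact: (measurableT_comp measurable_enorm mG).
- exact: measurable_funD.
- by move=> z _; rewrite (ger0_norm (enorm_ge0 _)) lerDr powR_ge0.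
Qed.

Lemma integrable_cut_grad i : integrable_on (cut_grad i).
Proof.
apply: (@integrable_cut_powR _ (fun z => `|w z| `^ p + enorm (G z) `^ p)) => //.
- exact: measurable_coord_fun.
- exact: measurable_funD.
- move=> z _; rewrite -[leLHS]add0r lerD ?powR_ge0//.
  by rewrite ge0_ler_powR ?nnegrE ?enorm_ge0 ?(ltW p0)// coord_le_enorm.
Qed.

Lemma integrable_cut_density : integrable_on cut_density.
Proof.
have d0 z : Q' z -> 0 <= `|w z| `^ p + enorm (G z) `^ p + a z * enorm (G z) `^ q.
  by move=> Qz; rewrite !addr_ge0 ?mulr_ge0 ?powR_ge0// a0.
apply: integrable_cut; first by apply: measurable_funD => //; exact: measurable_funD.
apply: (@le_lt_trans _ _ (\int[mu]_(z in Q') ((`|w z| `^ p + enorm (G z) `^ p)%:E +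
    (enorm (G z) `^ p + a z * enorm (G z) `^ q)%:E))%E).
  apply: ge0_le_integral => //.
  - apply/measurable_EFinP/measurableT_comp => //; apply: measurable_funD => //; exact: measurable_funD.
  - by apply: emeasurable_funD; apply/measurable_EFinP; exact: measurable_funD.
  - move=> z Qz; rewrite ger0_norm ?d0// -EFinD lee_fin lerD2l.
    by rewrite lerDr powR_ge0.
rewrite ge0_integralD//.
- by rewrite lte_add_pinfty.
- by move=> z _; rewrite lee_fin addr_ge0 ?powR_ge0.
- by apply/measurable_EFinP; exact: measurable_funD.
- by move=> z Qz; rewrite lee_fin addr_ge0 ?mulr_ge0 ?powR_ge0// a0.
- by apply/measurable_EFinP; exact: measurable_funD.
Qed.

Let cut_density_ge0 z : 0 <= cut_density z.
Proof.
rewrite /cut_density patchE; case: ifPn => // /set_mem Qz.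
by rewrite !addr_ge0 ?mulr_ge0 ?powR_ge0// a0.
Qed.

Let cut_norm_ge0 z : 0 <= cut_norm z.
Proof. by rewrite /cut_norm patchE; case: ifPn => // _; exact: enorm_ge0. Qed.

Let cut_grad_le i z : `|cut_grad i z| <= cut_norm z.
Proof.
by rewrite /cut_norm /cut_grad !patchE; case: ifPn => [_|_]; [exact: coord_le_enorm|rewrite normr0].
Qed.

Let cutE (f : V -> R) z : Q' z -> (f \_ Q') z = f z.
Proof. by move=> Qz; rewrite patchE mem_set. Qed.

Let a_le e z h : 0 < e -> Q z -> Q' (z + h) -> parabolic_kernel e h != 0 ->
  Q' z -> a z <= a (z + h) + c * (n%:R `^ alpha + 1) * e `^ alpha.
Proof.
move=> e0 Qz Qzh kh Q'z; rewrite -lerBlDl (le_trans (ler_norm _))//.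
apply: (le_trans (holder Q'z Qzh)); rewrite -mulrA ler_wpM2l//.
apply: le_trans (kernel_parabolic_le alpha0 e0 kh).
have -> : z.1 - (z + h).1 = - h.1 by rewrite /= opprD addNKr.
have -> : z.2 - (z + h).2 = - h.2 by rewrite /= opprD addNKr.
by rewrite normrN (_ : enorm (- h.1) = enorm h.1)// /enorm; under eq_bigr do rewrite mxE sqrrN.
Qed.

Let near_small : \forall e \near 0^'+, [/\ 0 < e, e <= 1 & e < delta].
Proof.
near=> e; split.
- by [].
- by near: e; exact: nbhs_right_le.
- by near: e; exact: nbhs_right_lt.
Unshelve. all: by end_near. Qed.

Let margin_kernel e z h : 0 < e -> e <= 1 -> e < delta -> Q z ->
  parabolic_kernel e h != 0 -> Q' (z + h).
Proof.
by move=> e0 e1 ed Qz /(kernel_norm_le e0 e1) he; apply: margin => //; exact: le_lt_trans ed.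
Qed.

Let QQ' z : Q z -> Q' z.
Proof. by move=> Qz; rewrite -[z](addr0 (z : V)); apply: margin => //; rewrite normr0. Qed.

Lemma mollified_grad_le e z : 0 < e ->
  enorm (mollified_grad e z) <= n%:R * mollification e cut_norm z.
Proof.
move=> e0; apply: (le_trans (enorm_le_sum _)).
rewrite (_ : n%:R * _ = \sum_(i < n) mollification e cut_norm z); last first.
  by rewrite sumr_const card_ord mulr_natl.
apply: ler_sum => i _; rewrite mxE; apply: mollification_norm_le => //.
  exact: integrable_cut_grad.
exact: integrable_cut_norm.
Qed.

(** The constant must depend neither on [e] nor on [z]. The splitting inequality costs powers of 2,
    the coordinates cost powers of [n], and the oscillation of [a] costs [Kq] times the p-th power
    of the gradient, which the density already bounds. *)
Lemma cut_density_dominates : exists2 C : R, 1 <= C & \forall e \near 0^'+, forall z, Q z ->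
  `|mollification e cut_fun z| `^ p <= C * mollification e cut_density z /\
  enorm (mollified_grad e z) `^ p + a z * enorm (mollified_grad e z) `^ q <=
    C * mollification e cut_density z.
Proof.
pose c' := c * (n%:R `^ alpha + 1).
have c'0 : 0 <= c' by rewrite mulr_ge0// addr_ge0// powR_ge0.
pose Cp := n%:R `^ p * 2 `^ p : R; pose Cq := n%:R `^ q * 2 `^ q : R.
have Cp0 : 0 <= Cp by rewrite mulr_ge0 ?powR_ge0.
have Cq0 : 0 <= Cq by rewrite mulr_ge0 ?powR_ge0.
pose Kq := c' * K `^ (q - p); have Kq0 : 0 <= Kq by rewrite mulr_ge0 ?powR_ge0.
(* The summand 1 secures [1 <= C], by which the density of [w] itself is later compared with [C]
   times itself. *)
exists (1 + 2 `^ p + Cp * (1 + Kq) + Cq).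
  by rewrite -!addrA lerDl !addr_ge0 ?powR_ge0// mulr_ge0// addr_ge0.
apply: filterS2 near_small grad_bound => e [e0 e1 ed] gb z Qz.
have {gb}gz := gb z Qz; have Q'z := QQ' Qz.
set MH := mollification e cut_density z; set A := enorm (mollified_grad e z).
have MH0 : 0 <= MH by exact: mollification_ge0.
have A0 : 0 <= A by exact: enorm_ge0.
set MY := mollification e cut_norm z; have MY0 : 0 <= MY by exact: mollification_ge0.
have iY := integrable_cut_norm; have iH := integrable_cut_density.
have HE h : parabolic_kernel e h != 0 -> Q' (z + h) by exact: margin_kernel.
have Mw : `|mollification e cut_fun z| `^ p <= 2 `^ p * MH.
  have iW := integrable_cut_fun.
  have iWn : integrable_on (fun y => `|cut_fun y|) by exact: integrable_norm iW.
  apply: (@le_trans _ _ (mollification e (fun y => `|cut_fun y|) z `^ p)).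
    rewrite ge0_ler_powR ?nnegrE ?(ltW p0)//; first by apply: mollification_ge0.
    exact: mollification_norm_le.
  rewrite -[leLHS]mul1r; apply: mollification_powR_le => // h kh.
  rewrite mul1r /cut_fun /cut_density !cutE; [|exact: HE..].
  by rewrite -addrA lerDl addr_ge0 ?mulr_ge0 ?powR_ge0// a0//; exact: HE.
have AY : A <= n%:R * MY by exact: mollified_grad_le.
have Ar r : 0 < r -> A `^ r <= n%:R `^ r * MY `^ r.
  by move=> r0; rewrite -powRM// ge0_ler_powR ?nnegrE ?mulr_ge0// ltW.
have Ap : A `^ p <= Cp * MH.
  apply: (le_trans (Ar _ p0)); rewrite -mulrA ler_wpM2l ?powR_ge0//.
  rewrite -[leLHS]mul1r; apply: mollification_powR_le => // h kh.
  rewrite mul1r /cut_norm /cut_density !cutE; [|exact: HE..].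
  by rewrite addrAC lerDr addr_ge0 ?mulr_ge0 ?powR_ge0// a0//; exact: HE.
(* A lower bound for [a] on the support of the kernel around [z], constant in the shift and clipped
   at 0, as [mollification_powR_le] requires of its coefficient. *)
pose az := Num.max 0 (a z - c' * e `^ alpha).
have az0 : 0 <= az by rewrite le_max lexx.
have Aq : az * A `^ q <= Cq * MH.
  apply: (@le_trans _ _ (n%:R `^ q * (az * MY `^ q))).
    by rewrite mulrCA ler_wpM2l// Ar.
  rewrite -mulrA ler_wpM2l ?powR_ge0//.
  apply: mollification_powR_le => // h kh.
  rewrite /cut_norm /cut_density !cutE; [|exact: HE..].
  rewrite -[leLHS]add0r lerD ?addr_ge0 ?powR_ge0// ler_wpM2r ?powR_ge0//.
  rewrite ge_max a0 /=; last exact: HE.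
  by rewrite lerBlDr; apply: a_le => //; exact: HE.
(* The powers of [e] combine to e^(alpha - gam (q - p)), which is at most 1 because the exponent is
   nonnegative and [e] is at most 1. *)
have aq : c' * e `^ alpha * A `^ q <= Kq * A `^ p.
  have -> : A `^ q = A `^ (q - p) * A `^ p.
    by rewrite -powRD ?subrK// gt_eqF.
  rewrite mulrA ler_wpM2r ?powR_ge0// -mulrA ler_wpM2l//.
  have : A `^ (q - p) <= (K * e `^ (- gam)) `^ (q - p).
    by rewrite ge0_ler_powR ?nnegrE ?mulr_ge0 ?powR_ge0// subr_ge0 ltW.
  rewrite powRM ?powR_ge0// -powRrM => H.
  apply: (le_trans (ler_wpM2l (powR_ge0 _ _) H)); rewrite mulrCA ler_piMr ?powR_ge0//.
  rewrite -powRD ?(gt_eqF e0) ?implybT// -(powRr0 e) ger_powR ?e0//.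
  by rewrite mulNr subr_ge0.
have a_az : a z <= az + c' * e `^ alpha by rewrite -lerBlDr le_max lexx orbT.
split; first by apply: (le_trans Mw); rewrite ler_wpM2r// -!addrA addrCA lerDl !addr_ge0// mulr_ge0// addr_ge0.
have h1 : a z * A `^ q <= Cq * MH + Kq * (Cp * MH).
  apply: (le_trans (ler_wpM2r (powR_ge0 _ _) a_az)); rewrite mulrDl lerD//.
  by apply: (le_trans aq); rewrite ler_wpM2l.
apply: (le_trans (lerD Ap h1)).
have p2 : 0 <= (1 + 2 `^ p) * MH by rewrite mulr_ge0// addr_ge0 ?powR_ge0.
by rewrite -subr_ge0 (_ : _ - _ = (1 + 2 `^ p) * MH)//; ring.
Qed.

Lemma spatial_gradient_mollification : \forall e \near 0^'+,
  spatial_gradient B J (mollification e cut_fun) (mollified_grad e).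
Proof.
apply: filterS near_small => e [e0 e1 ed]; split.
  have mM i : measurable_fun setT (fun z : VT => mollified_grad e z ord0 i).
    under eq_fun do rewrite mxE; exact: (measurable_mollification e0 (integrable_cut_grad i)).
  have mgr : measurable_fun [set: VT] (mollified_grad e) by exact/measurable_fun_rVP.
  have : measurable_fun Q (mollified_grad e) by exact: measurable_funTS.
  exact.
apply: aeW => t Jt.
apply: (weak_gradient_mollification e0 t bB bB' sG integrable_cut_fun integrable_cut_grad) => x h Bx kh.
by have [] : Q' (((x, t) : V) + h) by exact: (margin_kernel e0 e1 ed).
Qed.

Lemma smooth_approximation : exists wm : nat -> V -> R,
  [/\ forall m, smooth_on (B `*` J) (wm m),
      forall m, LpW1p p B J (wm m),
      LpW1p_norm p B J (wm m \- w) @[m --> \oo] --> 0%E &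
      energy p q a B J (wm m) @[m --> \oo] --> energy p q a B J w].
Proof.
have [C C1 dom] := cut_density_dominates.
have C0 : 0 <= C by rewrite (le_trans _ C1).
have iW := integrable_cut_fun; have iH := integrable_cut_density.
have eps m : 0 < 1 / (2 ^ m.+1)%:R :> R by rewrite divr_gt0// ltr0n expn_gt0.
(* Each condition holds for all small [e], and there are finitely many, so one scale meets them all;
   the errors 1 / 2^(m+1) are those [fast_L1_cvg] sums. *)
pose good m e := [/\ [/\ 0 < e, spatial_gradient B J (mollification e cut_fun) (mollified_grad e) &
      forall z, Q z ->
        `|mollification e cut_fun z| `^ p <= C * mollification e cut_density z /\
        enorm (mollified_grad e z) `^ p + a z * enorm (mollified_grad e z) `^ q <=
          C * mollification e cut_density z],
    (\int[mu]_z `|mollification e cut_fun z - cut_fun z|%:E <= (1 / (2 ^ m.+1)%:R)%:E)%E,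
    (forall i, (\int[mu]_z `|mollification e (cut_grad i) z - cut_grad i z|%:E <= (1 / (2 ^ m.+1)%:R)%:E)%E) &
    (\int[mu]_z `|mollification e cut_density z - cut_density z|%:E <= (1 / (2 ^ m.+1)%:R)%:E)%E].
have : forall m, exists e : R, good m e.
  move=> m.
  have n1 := mollification_L1 iW (eps m); have n2 := mollification_L1 iH (eps m).
  have n3 : \forall e \near 0^'+, forall i,
     (\int[mu]_z `|mollification e (cut_grad i) z - cut_grad i z|%:E <= (1 / (2 ^ m.+1)%:R)%:E)%E.
    by apply: filter_forall => i; apply: mollification_L1 => //; exact: integrable_cut_grad.
  have n4 := spatial_gradient_mollification.
  suff /filter_ex : \forall e \near 0^'+, good m e by [].
  near=> e; split; [split; first by []|..].
  - by near: e; exact: n4.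
  - by near: e; exact: dom.
  - by near: e; exact: n1.
  - by near: e; exact: n3.
  - by near: e; exact: n2.
move=> /choice[es Hes].
have es0 m : 0 < es m by have [[]] := Hes m.
have L1Q (f : V -> R) m : integrable_on (f \_ Q') ->
    (\int[mu]_z `|mollification (es m) (f \_ Q') z - (f \_ Q') z|%:E <= (1 / (2 ^ m.+1)%:R)%:E)%E ->
    (\int[mu]_(z in Q) `|mollification (es m) (f \_ Q') z - f z|%:E <= (1 / (2 ^ m.+1)%:R)%:E)%E.
  move=> intf; apply: le_trans.
  have -> : (\int[mu]_(z in Q) `|mollification (es m) (f \_ Q') z - f z|%:E =
      \int[mu]_(z in Q) `|mollification (es m) (f \_ Q') z - (f \_ Q') z|%:E)%E.
    by apply: eq_integral => z /set_mem Qz; rewrite cutE//; exact: QQ'.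
  apply: ge0_subset_integral => //; apply/measurable_EFinP/measurableT_comp => //.
  apply: measurable_funB; first exact: (measurable_mollification (es0 m) intf).
  by apply/measurable_EFinP; exact: measurable_int intf.
pose H z := `|w z| `^ p + enorm (G z) `^ p + a z * enorm (G z) `^ q.
have sub : Q `<=` Q' by exact: QQ'.
have maQ : measurable_fun Q a by exact: measurable_funS ma.
have mwQ : measurable_fun Q w by exact: measurable_funS mw.
have a0Q z : Q z -> 0 <= a z by move=> /QQ'; exact: a0.
have sGQ : spatial_gradient B J w G.
  have BJ (x : X) (t : R) : B x -> J t -> B' x /\ J' t by move=> Bx Jt; exact: (sub (x, t)).
  have [x0 Bx0] := euclidean_ball_nonempty bB.
  case: sG => _ HG; split.
    have mGQ : measurable_fun Q G by exact: measurable_funS mG.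
    exact: mGQ.
  apply: aeS HG => t Ht Jt; have [_ J't] := BJ x0 t Bx0 Jt.
  apply: weak_gradient_sub (Ht J't) => //; first exact: euclidean_ball_open.
  by move=> x Bx; have [] := BJ x t Bx Jt.
have mM (f : V -> R) m : integrable_on f -> measurable_fun Q (mollification (es m) f).
  by move=> intf; apply: measurable_funTS; exact: (measurable_mollification (es0 m) intf).
have iHQ : mu.-integrable Q (EFin \o H).
  have := integrable_cut_density => iH'; have := integrableS measurableT mQ (@subsetT _ Q) iH'.
  apply: eq_integrable => // z /set_mem Qz /=; rewrite /cut_density cutE//; exact: QQ'.
(* The mollified density is integrable on [Q] because it differs from the integrable [H] by a
   function of finite L^1 norm. *)
have iMQ m : mu.-integrable Q (EFin \o mollification (es m) cut_density).
  have mD : measurable_fun Q (fun z => mollification (es m) cut_density z - H z).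
    by apply: measurable_funB; [exact: mM|apply/measurable_EFinP; exact: measurable_int iHQ].
  have iD : mu.-integrable Q (fun z => (mollification (es m) cut_density z - H z)%:E).
    apply/integrableP; split; first exact/measurable_EFinP.
    have [_ _ _ h] := Hes m; exact: le_lt_trans (L1Q H m iH h) (ltry _).
  have := integrableD mQ iHQ iD; apply: eq_integrable => // z _ /=.
  by rewrite -EFinD addrC subrK.
have sM m : spatial_gradient B J (mollification (es m) cut_fun) (mollified_grad (es m)) by have [[]] := Hes m.
have wL1 m : (\int[mu]_(z in Q) `|mollification (es m) cut_fun z - w z|%:E <= (1 / (2 ^ m.+1)%:R)%:E)%E.
  by have [_ h _ _] := Hes m; exact: (L1Q w m).
have GL1 i m : (\int[mu]_(z in Q) `|mollified_grad (es m) z ord0 i - G z ord0 i|%:E <= (1 / (2 ^ m.+1)%:R)%:E)%E.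
  under eq_integral do rewrite mxE.
  have [_ _ h _] := Hes m; exact: (L1Q (fun z => G z ord0 i) m (integrable_cut_grad i) (h i)).
have HL1 m : (\int[mu]_(z in Q) `|mollification (es m) cut_density z - H z|%:E <= (1 / (2 ^ m.+1)%:R)%:E)%E.
  by have [_ _ _ h] := Hes m; exact: (L1Q H m).
have wH z : Q z -> `|w z| `^ p + enorm (G z) `^ p <= C * H z.
  move=> Qz; rewrite -[leLHS]mul1r ler_pM ?addr_ge0 ?powR_ge0// /H lerDl mulr_ge0 ?powR_ge0//; exact: a0Q.
have wHm m z : Q z -> `|mollification (es m) cut_fun z| `^ p <= C * mollification (es m) cut_density z.
  by have [[_ _ h] _ _ _] := Hes m; move=> /h[].
have GHm m z : Q z -> enorm (mollified_grad (es m) z) `^ p + a z * enorm (mollified_grad (es m) z) `^ q <=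
    C * mollification (es m) cut_density z.
  by have [[_ _ h] _ _ _] := Hes m; move=> /h[].
have mwm m := mM _ m iW.
exists (fun m => mollification (es m) cut_fun); split.
- move=> m; exists setT, (mollification (es m) cut_fun); split => //; first exact: openT.
  by apply: smooth_mollification => //; exact: iW.
- move=> m; exact: (LpW1p_approximation bB mJ a0Q mwm sM iMQ wHm GHm m).
- exact: (LpW1p_norm_approximation p1 C0 bB mJ a0Q mwQ sGQ mwm sM iHQ iMQ wL1 GL1 HL1 wH wHm GHm).
- exact: (energy_approximation p1 q1 C0 bB mJ maQ a0Q sGQ sM iHQ iMQ GL1 HL1 GHm).
Unshelve. all: by end_near. Qed.

(** The p-th power of the mollified length of the gradient is at most 2^p times the mollified
    density, hence at most the supremum of the kernel times an L^1 norm. The p-th root of e^-(n+2)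
    gives the exponent. *)
Lemma mollified_grad_bound_energy : exists2 K1 : R, 0 <= K1 &
  \forall e \near 0^'+, forall z, Q z ->
    enorm (mollified_grad e z) <= K1 * e `^ (- ((n%:R + 2) / p)).
Proof.
have iY := integrable_cut_norm; have iH := integrable_cut_density.
pose I := \int[mu]_y cut_density y.
have I0 : 0 <= I by apply: Rintegral_ge0 => y _; exact: cut_density_ge0.
have kc0 : 0 < @kernel_const R n by exact: kernel_const_gt0.
pose C := 2 `^ p * (@kernel_const R n * I).
have C0 : 0 <= C by rewrite mulr_ge0 ?powR_ge0// mulr_ge0// ltW.
exists (n%:R * C `^ p^-1); first by rewrite mulr_ge0 ?powR_ge0.
apply: filterS near_small => e [e0 e1 ed] z _.
set MY := mollification e cut_norm z; have MY0 : 0 <= MY by exact: mollification_ge0.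
have AY : enorm (mollified_grad e z) <= n%:R * MY by exact: mollified_grad_le.
apply: (le_trans AY); rewrite -mulrA ler_wpM2l//.
have : MY `^ p <= C * e `^ (- (n%:R + 2)).
  apply: (@le_trans _ _ (2 `^ p * mollification e cut_density z)).
    rewrite -[leLHS]mul1r; apply: mollification_powR_le => // h _.
    rewrite mul1r /cut_norm /cut_density !patchE; case: ifPn => [/set_mem Qz|_].
      by rewrite addrAC lerDr addr_ge0 ?mulr_ge0 ?powR_ge0// a0.
    by rewrite powR0// gt_eqF.
  rewrite -mulrA ler_wpM2l ?powR_ge0//.
  have := mollification_le_integral e0 z iH cut_density_ge0 => /le_trans; apply.
  rewrite powRN -(natrD _ n 2) (powR_mulrn _ (ltW e0)) -/I le_eqVlt; apply/orP; left; apply/eqP.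
  by rewrite mulrAC.
move=> /(ge0_ler_powR (_ : 0 <= p^-1)) -/(_ _ _ _).
rewrite invr_ge0 (ltW p0) !nnegrE powR_ge0 mulr_ge0 ?powR_ge0// => /(_ isT isT isT).
by rewrite -powRrM mulfV ?gt_eqF// powRr1// powRM ?powR_ge0// -powRrM mulNr.
Qed.

(** The slice estimate contributes e^-(n+1) and the assumed bound e^(n - nu). The deficit [nu]
    measures how far [w] is from being bounded: it is 0 for bounded [w] and n / s in the L^s
    case. *)
Lemma mollified_grad_bound_slices (Lam nu : R) : 0 <= Lam ->
  (\forall e \near 0^'+, forall z, Q z -> {ae @lebesgue_measure R, forall s,
    (\int[leb]_(y in translated_cube z.1 e) `|cut_fun (y, s)|%:E <=
     (Lam * e `^ (n%:R - nu))%:E)%E}) ->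
  exists2 K1 : R, 0 <= K1 & \forall e \near 0^'+, forall z, Q z ->
    enorm (mollified_grad e z) <= K1 * e `^ (- (1 + nu)).
Proof.
move=> Lam0 HL; have [K1 K10 HK] := @mollified_gradient_slice_le R n.
exists (n%:R * (K1 * Lam)); first by rewrite !mulr_ge0.
apply: filterS2 near_small HL => e [e0 e1 ed] HL [x t] Qz.
have mf : measurable_fun [set: VT] cut_fun.
  by apply/measurable_EFinP; exact: measurable_int integrable_cut_fun.
have L0 : 0 <= Lam * e `^ (n%:R - nu) by rewrite mulr_ge0 ?powR_ge0.
have xB : translated_cube x e `<=` B'.
  move=> y xy; suff [] : Q' (((x, t) : V) + (y - x, 0)) by rewrite /= addrCA subrr addr0.
  apply: margin => //; apply: le_lt_trans ed.
  rewrite prod_normE ge_max normr0 (ltW e0) andbT; apply: norm_le_coord; first exact: ltW.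
  by move=> i; rewrite !mxE; exact: xy.
apply: (le_trans (enorm_le_sum _)).
apply: (@le_trans _ _ (\sum_(i < n) (K1 / e ^+ n.+1 * (Lam * e `^ (n%:R - nu))))).
  apply: ler_sum => i _; rewrite mxE.
  exact: (HK e _ t x B' J' w G i e0 L0 mB' sG mf (integrable_cut_grad i) xB (HL _ Qz)).
rewrite sumr_const card_ord -[leLHS]mulr_natl le_eqVlt; apply/orP; left; apply/eqP.
rewrite -!mulrA; congr (_ * (_ * _)); rewrite mulrCA; congr (_ * _).
rewrite -(powR_mulrn _ (ltW e0)) -powRN -powRD ?(gt_eqF e0) ?implybT//; congr (_ `^ _).
by rewrite -natr1; ring.
Qed.

(** The bound on [w] holds almost everywhere in space-time, so by Tonelli's theorem it holds almost
    everywhere on almost every slice; the cube then has volume (2 e)^n. *)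
Lemma slice_bound_bounded (M : R) : 0 <= M -> {ae mu, forall z, Q' z -> `|w z| <= M} ->
  \forall e \near 0^'+, forall z, Q z -> {ae @lebesgue_measure R, forall s,
    (\int[leb]_(y in translated_cube z.1 e) `|cut_fun (y, s)|%:E <=
     (M * 2 ^+ n * e `^ (n%:R - 0))%:E)%E}.
Proof.
move=> M0 wM.
have mf : measurable_fun [set: VT] cut_fun.
  by apply/measurable_EFinP; exact: measurable_int integrable_cut_fun.
(* The excess over [M]. Having zero integral, it turns the almost everywhere bound into a statement
   about slices without handling null sets. *)
pose h (z : VT) : R := Num.max 0 (`|cut_fun z| - M).
have mh : measurable_fun setT h.
  apply: measurable_maxr => //; apply: measurable_funB => //; exact: measurableT_comp.
have h0 z : (0 <= (h z)%:E)%E by rewrite lee_fin le_max lexx.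
have mhe : measurable_fun setT (EFin \o h) by exact/measurable_EFinP.
have : (\int[mu]_z (h z)%:E = 0)%E.
  rewrite (ge0_ae_eq_integral (g := cst 0%E))//; first exact: integral0.
  apply: aeS wM => z Hz _ /=; congr EFin; apply/max_idPl; rewrite subr_le0.
  by rewrite /cut_fun patchE; case: ifPn => [/set_mem|_]; [exact: Hz|rewrite normr0].
rewrite (fubini_tonelli2 (m1 := leb) (m2 := @lebesgue_measure R) _ mhe h0) => I0.
have mG2 := measurable_fun_fubini_tonelli_G (m1 := leb) _ mhe h0.
have ae0 : {ae @lebesgue_measure R, forall s, fubini_G leb (EFin \o h) s = 0%E}.
  have : (\int[@lebesgue_measure R]_s `|fubini_G leb (EFin \o h) s| = 0)%E.
    rewrite -[RHS]I0; apply: eq_integral => s _; rewrite gee0_abs//.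
    by apply: integral_ge0 => y _; exact: h0.
  move=> /(ae_eq_integral_abs _ measurableT mG2).1; apply: aeS => s Hs; exact: Hs.
apply: filterS near_small => e [e0 e1 ed] z Qz; apply: aeS ae0 => s Hs.
have mslice (F : VT -> R) : measurable_fun setT F -> measurable_fun setT (fun y => F (y, s)).
  by move=> mF; exact: (measurableT_comp mF (measurable_section1 s)).
have mc := measurable_translated_cube z.1 e.
apply: (@le_trans _ _ (\int[leb]_(y in translated_cube z.1 e) (M%:E + (h (y, s))%:E))%E).
  apply: ge0_le_integral => //.
  - apply: measurable_funTS; apply/measurable_EFinP/measurableT_comp => //; exact: mslice.
  - apply: measurable_funTS; apply: emeasurable_funD => //; apply/measurable_EFinP; exact: mslice.
  - by move=> y _; rewrite -EFinD lee_fin -lerBlDl le_max lexx orbT.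
rewrite ge0_integralD//; last first.
  by apply: measurable_funTS; apply/measurable_EFinP; exact: mslice.
rewrite integral_cst_translated_cube ?(ltW e0)//.
have -> : (\int[leb]_(y in translated_cube z.1 e) (h (y, s))%:E = 0)%E.
  apply/eqP; rewrite eq_le; apply/andP; split; last exact: integral_ge0.
  rewrite -[leRHS]Hs; apply: ge0_subset_integral => //.
  apply/measurable_EFinP; exact: mslice.
rewrite adde0 lee_fin subr0 powR_mulrn ?(ltW e0)//.
by rewrite exprMn mulrA.
Qed.

(** Hoelder's inequality on a cube, up to a constant, in the form of [powR_split]; at times outside
    [J'] the cut function vanishes. *)
Lemma slice_bound_Ls (r Lam : R) : 1 <= r -> 0 <= Lam ->
  (forall t, J' t -> (\int[leb]_(y in B') (`|w (y, t)| `^ r)%:E <= Lam%:E)%E) ->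
  \forall e \near 0^'+, forall z, Q z -> {ae @lebesgue_measure R, forall s,
    (\int[leb]_(y in translated_cube z.1 e) `|cut_fun (y, s)|%:E <=
     ((2 ^+ n + Lam) * e `^ (n%:R - n%:R / r))%:E)%E}.
Proof.
move=> r1 Lam0 wL; have r0 : 0 < r by exact: lt_le_trans r1.
have mf : measurable_fun [set: VT] cut_fun.
  by apply/measurable_EFinP; exact: measurable_int integrable_cut_fun.
apply: filterS near_small => e [e0 e1 ed] z Qz; apply: aeW => s.
have mfs : measurable_fun setT (fun y => cut_fun (y, s)).
  by exact: (measurableT_comp mf (measurable_section1 s)).
have mfr : measurable_fun setT (fun y => `|cut_fun (y, s)| `^ r).
  by apply: (measurableT_comp (measurable_powR r)); exact: measurableT_comp mfs.
have mc := measurable_translated_cube z.1 e.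
(* The threshold that balances the two terms: both k (2 e)^n and Lam / k^(r-1) are multiples of e^(n
   - n/r). *)
pose k := e `^ (- (n%:R / r)); have k0 : 0 < k by exact: powR_gt0.
pose b := (k `^ (r - 1))^-1; have b0 : 0 <= b by rewrite invr_ge0 powR_ge0.
apply: (@le_trans _ _ (\int[leb]_(y in translated_cube z.1 e) (k%:E + b%:E * (`|cut_fun (y, s)| `^ r)%:E))%E).
  apply: ge0_le_integral => //.
  - by apply: measurable_funTS; apply/measurable_EFinP/measurableT_comp.
  - apply: measurable_funTS; apply: emeasurable_funD => //; apply: measurable_funeM; exact/measurable_EFinP.
  - move=> y _; rewrite -EFinM -EFinD lee_fin mulrC; exact: powR_split.
rewrite ge0_integralD//; last 3 first.
- by move=> y _; rewrite lee_fin ltW.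
- by move=> y _; rewrite -EFinM lee_fin mulr_ge0 ?powR_ge0.
- apply: measurable_funTS; apply: measurable_funeM; exact/measurable_EFinP.
rewrite integral_cst_translated_cube ?(ltW e0)//.
have mfc : measurable_fun (translated_cube z.1 e) (fun y => (`|cut_fun (y, s)| `^ r)%:E).
  by apply: measurable_funTS; exact/measurable_EFinP.
rewrite (ge0_integralZl _ mc mfc)//.
have mfB : measurable_fun B' (fun y => (`|cut_fun (y, s)| `^ r)%:E).
  by apply: measurable_funTS; exact/measurable_EFinP.
have I1 : (\int[leb]_(y in translated_cube z.1 e) (`|cut_fun (y, s)| `^ r)%:E <= Lam%:E)%E.
  have [Js|nJ] := pselect (J' s); last first.
    rewrite integral0_eq ?lee_fin// => y _; rewrite /cut_fun patchE memNset ?normr0 ?powR0 ?gt_eqF//.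
    by case.
  apply: le_trans (wL s Js).
  have -> : (\int[leb]_(y in B') (`|w (y, s)| `^ r)%:E = \int[leb]_(y in B') (`|cut_fun (y, s)| `^ r)%:E)%E.
    by apply: eq_integral => y /set_mem By; rewrite /cut_fun patchE mem_set.
  rewrite integral_mkcond [leRHS]integral_mkcond; apply: ge0_le_integral => //.
  - by move=> y _; rewrite patchE; case: ifPn => // _; rewrite lee_fin powR_ge0.
  - exact: (measurable_restrictT _ mc).1 mfc.
  - exact: (measurable_restrictT _ mB').1 mfB.
  move=> y _; rewrite !patchE; case: ifPn => _; case: ifPn => // nB.
    rewrite /cut_fun patchE memNset ?normr0 ?powR0 ?gt_eqF//.
    by move=> [/= /mem_set]; rewrite (negbTE nB).
  by rewrite lee_fin powR_ge0.
apply: (@le_trans _ _ ((k * (2 * e) ^+ n)%:E + b%:E * Lam%:E)%E).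
  by rewrite leeD2l// lee_wpmul2l// lee_fin.
have ke : k * e ^+ n = e `^ (n%:R - n%:R / r).
  by rewrite -(powR_mulrn _ (ltW e0)) /k -powRD ?(gt_eqF e0) ?implybT// addrC.
have be : b = e `^ (n%:R - n%:R / r).
  rewrite /b /k -powRrM -powRN; congr (_ `^ _); field; by rewrite gt_eqF.
have kE : k * (2 * e) ^+ n = 2 ^+ n * e `^ (n%:R - n%:R / r) by rewrite exprMn mulrCA ke.
by rewrite kE be -EFinM -EFinD lee_fin mulrDl (mulrC Lam).
Qed.

End core.

Lemma Lfun_oo_bounded d (T : measurableType d) (R : realType) (m : {measure set T -> \bar R})
    (f : T -> R) : f \in Lfun m +oo%E ->
  exists2 M : R, 0 <= M & {ae m, forall z, `|f z| <= M}.
Proof.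
move=> /sub_Lfun_finLfun; rewrite inE /finite_norm unlock /=; case: ifPn => [m0|].
  move=> Noo; pose M := Num.max 0 (fine (ess_sup m (abse \o (EFin \o f)))).
  exists M; first by rewrite le_max lexx.
  apply: filterS (ess_sup_ge m (abse \o (EFin \o f))) => z Hz.
  rewrite le_max; apply/orP; right; rewrite -lee_fin fineK//.
  by rewrite ge0_fin_numE// (le_trans _ Hz)// abse_ge0.
(* If the whole space is null, every bound holds almost everywhere. *)
rewrite -leNgt => mT _; exists 0 => //; exists setT; split => //.
by apply/eqP; rewrite eq_le mT measure_ge0.
Qed.

(** * Cylinders *)

Section product_containment.
Context {S T : topologicalType}.

Lemma closure_pair (A : set S) (B : set T) x t : closure A x -> closure B t ->
  closure (A `*` B) (x, t).
Proof.
move=> cA cB N [[P1 P2] /= [n1 n2] PN].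
have [y [Ay Py]] := cA _ n1; have [s [Bs Ps]] := cB _ n2.
by exists (y, s); split => //; exact: PN.
Qed.

Lemma interior_pair (A : set S) (B : set T) x t : (A `*` B)° (x, t) -> A° x /\ B° t.
Proof.
move=> [[P1 P2] /= [n1 n2] PN]; have P1x := nbhs_singleton n1; have P2t := nbhs_singleton n2.
split.
  by apply: filterS n1 => y Py; have [] := PN (y, t) (conj Py P2t).
by apply: filterS n2 => s Ps; have [] := PN (x, s) (conj P1x Ps).
Qed.

(** A point in each factor lets the closure of the product project onto each closure; an empty
    factor would leave the other one unconstrained. *)
Lemma cpt_contained_pair (A C : set S) (B D : set T) x t :
  A x -> B t -> cpt_contained (A `*` B) (C `*` D) -> cpt_contained A C /\ cpt_contained B D.
Proof.
move=> Ax Bt [cAB sAB].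
have cf : continuous (@fst S T) by move=> z; exact: cvg_fst.
have cs : continuous (@snd S T) by move=> z; exact: cvg_snd.
split; split.
- apply: subclosed_compact (@closed_closure _ _) (continuous_compact (continuous_subspaceT cf) cAB) _.
  move=> y cy; exists (y, t) => //; apply: closure_pair => //; exact: subset_closure.
- move=> y cy; have [] // := @interior_pair C D y t _; apply: sAB.
  by apply: closure_pair => //; exact: subset_closure.
- apply: subclosed_compact (@closed_closure _ _) (continuous_compact (continuous_subspaceT cs) cAB) _.
  move=> s cls; exists (x, s) => //; apply: closure_pair => //; exact: subset_closure.
- move=> s cls; have [] // := @interior_pair C D x s _; apply: sAB.
  by apply: closure_pair => //; exact: subset_closure.
Qed.

End product_containment.

(** * Uniform bounds in time *)

Section uniform_Ls.
Context {R : realType} {n : nat}.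
Local Notation leb := (@lebesgue_rV R n).
Local Notation X := 'rV[R]_n.
Local Notation V := ('rV[R]_n * R)%type.

(** Continuity in time bounds the norm near each time; compactness of the closure of [J] makes the
    bound uniform. Letting the bound tend to infinity, as a filter, replaces the maximum over a
    finite subcover. *)
Lemma CLs_loc_bounded (r T : R) (Om B : set X) (J : set R) (w : V -> R) : 1 <= r ->
  CLs_loc r Om T w -> open B -> cpt_contained B Om -> is_interval J -> cpt_contained J `]0, T[ ->
  exists2 Lam : R, 0 <= Lam & forall t, J t ->
    (\int[leb]_(y in B) (`|w (y, t)| `^ r)%:E <= Lam%:E)%E.
Proof.
move=> r1 cw oB cB iJ [cJ sJ]; have r0 : 0 < r by exact: lt_le_trans r1.
have mB : measurable B by exact: open_measurable_rV.
(* Continuity is known on compact intervals, so [J] is replaced by its closure, still an interval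
   because closures of connected sets are connected. *)
have icJ : is_interval (closure J).
  by apply/connected_intervalP; apply: connected_closure; exact/connected_intervalP.
have sJT : closure J `<=` `]0, T[ by apply: subset_trans sJ _; exact: interior_subset.
have [Hfin Hcont] := cw (closure J) B icJ cJ sJT oB cB.
pose Phi t := (\int[leb]_(y in B) (`|w (y, t)| `^ r)%:E)%E.
have NE (u : X -> R) : (\int[leb]_(y in B) (`|u y| `^ r)%:E =
    'N[leb]_(r%:E)[EFin \o (u \_ B)] `^ r)%E.
  rewrite poweR_Lnorm ?gt_eqF// [LHS]integral_mkcond; apply: eq_integral => y _.
  have -> : (EFin \o (u \_ B)) y = (if y \in B then u y else 0)%:E by rewrite /= patchE.
  rewrite patchE; case: ifPn => _; first by rewrite abse_EFin poweR_EFin.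
  by rewrite abse_EFin normr0 poweR_EFin powR0// gt_eqF.
have Phioo t : closure J t -> (Phi t < +oo)%E.
  move=> Jt; rewrite /Phi (NE (fun x => w (x, t))); apply: poweR_lty.
  by have /sub_Lfun_finLfun := Hfin t Jt; rewrite inE.
have mwt t : closure J t -> measurable_fun B (fun x => w (x, t)).
  move=> Jt; apply/(measurable_restrictT _ mB).
  by have /sub_Lfun_mfun := Hfin t Jt; rewrite inE.
have local t0 : closure J t0 -> \forall t \near t0 & M \near +oo, closure J t -> (Phi t <= M%:E)%E.
  move=> Jt0; have /fine_cvgP[fN cN] := Hcont t0 Jt0.
  (* The norm of the difference is below 1 near [t0], and 2^r is the cost of the r-th power of a
     sum. *)
  pose M0 := 2 `^ r * (fine (Phi t0) + 1).
  have near1 : \forall t \near t0, closure J t -> (Phi t <= M0%:E)%E.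
    move/cvgrPdist_lt : cN => /(_ 1 ltr01) cN.
    move: fN cN; rewrite !near_withinE => fN cN; apply: filterS2 fN cN => t ft lt1 Jt.
    have {}ft := ft Jt; have {}lt1 := lt1 Jt.
    rewrite /= sub0r normrN in lt1.
    set N := ('N[leb]_r%:E[_])%E in ft lt1.
    have N0 : (0 <= N)%E by exact: Lnorm_ge0.
    have D1 : (\int[leb]_(y in B) (`|w (y, t) - w (y, t0)| `^ r)%:E <= 1%:E)%E.
      rewrite (NE (fun y => w (y, t) - w (y, t0))) -/N -(fineK ft) poweR_EFin lee_fin.
      have -> : 1 = 1 `^ r :> R by rewrite powR1.
      rewrite ge0_ler_powR ?nnegrE ?fine_ge0 ?(ltW r0)//.
      by rewrite ltW// (le_lt_trans (ler_norm _)).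
    have mB1 : measurable_fun B (fun y => (`|w (y, t) - w (y, t0)| `^ r)%:E).
      apply/measurable_EFinP; apply: (measurableT_comp (measurable_powR r)); apply: measurableT_comp => //.
      by apply: measurable_funB; exact: mwt.
    have mB2 : measurable_fun B (fun y => (`|w (y, t0)| `^ r)%:E).
      apply/measurable_EFinP; apply: (measurableT_comp (measurable_powR r)); apply: measurableT_comp => //.
      exact: mwt.
    apply: (@le_trans _ _ (\int[leb]_(y in B) ((2 `^ r)%:E *
        ((`|w (y, t0)| `^ r)%:E + (`|w (y, t) - w (y, t0)| `^ r)%:E)))%E).
      apply: ge0_le_integral => //.
      - apply/measurable_EFinP; apply: (measurableT_comp (measurable_powR r)); apply: measurableT_comp => //.
        exact: mwt.
      - by apply: measurable_funeM; exact: emeasurable_funD.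
      - move=> y _; rewrite -EFinD -EFinM lee_fin; apply: le_trans (powR_add_le _ _ (ltW r0)) => //.
        rewrite ge0_ler_powR ?nnegrE ?addr_ge0 ?(ltW r0)//.
        by rewrite -[X in `|X| <= _](subrK (w (y, t0))) addrC (le_trans (ler_normD _ _))// addrC.
    rewrite (ge0_integralZl _ mB (emeasurable_funD mB2 mB1)); last 2 first.
    - by move=> y _; rewrite -EFinD lee_fin addr_ge0 ?powR_ge0.
    - by rewrite lee_fin powR_ge0.
    rewrite ge0_integralD//; try by move=> y _; rewrite lee_fin powR_ge0.
    rewrite /M0 EFinM; apply: lee_wpmul2l; first by rewrite lee_fin powR_ge0.
    rewrite EFinD leeD// fineK// ge0_fin_numE ?Phioo//.
    by apply: integral_ge0 => y _; rewrite lee_fin powR_ge0.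
  exists ([set t | closure J t -> (Phi t <= M0%:E)%E], [set M | M0 <= M]).
    by split => //; exact: nbhs_pinfty_ge.
  by move=> [t M] [/= Ht HM] Jt; rewrite (le_trans (Ht Jt))// lee_fin.
have := (compact_near_coveringP (closure J)).1 cJ R (pinfty_nbhs R)
  (fun M t => closure J t -> (Phi t <= M%:E)%E) _ local.
move=> H; have [M [M0 HM]] := filter_ex (filterI (nbhs_pinfty_ge (num_real 0)) (H _)).
by exists M => // t Jt; apply: (HM t (subset_closure Jt)); exact: subset_closure.
Qed.

End uniform_Ls.

(** * Reduction to a growth bound for mollified gradients *)

Section cylinders.
Context {R : realType} {n : nat}.
Local Notation leb := (@lebesgue_rV R n).
Local Notation X := 'rV[R]_n.
Local Notation V := ('rV[R]_n * R)%type.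
Local Notation VT := ('rV[R]_n * measurableTypeR R)%type.
Local Notation mu := (@spacetime R n).

(** The three cases differ only in the growth exponent of the mollified gradient. Everything about
    cylinders is unpacked here once, and that bound is left as the single obligation. *)
Lemma smoothly_approximable_of_bound (Om : set X) (T p q alpha : R) (a w : V -> R) :
  1 <= p -> p < q -> 0 < alpha -> (forall z, (Om `*` `]0, T[) z -> 0 <= a z) ->
  parabolic_holder alpha Om T a -> LpW1p_loc p Om T w ->
  (forall (B B' : set X) (I I' : set R) (delta : R) (G := Dx B' I' w)
      (Q := B `*` I : set VT) (Q' := B' `*` I' : set VT),
    is_euclidean_ball B' -> is_interval I' -> cpt_contained B' Om -> cpt_contained I' `]0, T[ ->
    measurable (I' : set (measurableTypeR R)) ->
    measurable_fun Q' a -> (forall z, Q' z -> 0 <= a z) ->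
    measurable_fun Q' w -> spatial_gradient B' I' w G -> (mu Q' < +oo)%E -> 0 < delta ->
    (forall z h : V, Q z -> `|h| < delta -> Q' (z + h)) ->
    (\int[mu]_(z in Q') (`|w z| `^ p + enorm (G z) `^ p)%:E < +oo)%E ->
    (\int[mu]_(z in Q') (enorm (G z) `^ p + a z * enorm (G z) `^ q)%:E < +oo)%E ->
    exists K gam : R, [/\ 0 <= K, gam * (q - p) <= alpha &
      \forall e \near 0^'+, forall z, Q z -> enorm (mollified_grad B' I' G e z) <= K * e `^ (- gam)]) ->
  smoothly_approximable Om T p q a w.
Proof.
move=> p1 pq alpha0 a0 [[aoo]] [c [c0 holder]] wloc bound B I B' I' bB iI bB' iI' QQ' Q'Om energyoo.
have p0 : 0 < p by exact: lt_le_trans p1.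
(* With [I] empty the inclusion of cylinders says nothing about [B'] and [I'], but all norms and
   energies over it vanish and the zero sequence serves. *)
have [[t0 It0]|/forallNP I0] := pselect (exists t, I t); last first.
  have {}I0 : I = set0 by apply/seteqP; split => t // /I0.
  subst I; have n0 u : LpW1p_norm p B set0 u = 0%E.
    by rewrite /LpW1p_norm integral_set0 poweR0r// invr_neq0// gt_eqF.
  have en0 u : energy p q a B set0 u = 0%E by rewrite /energy integral_set0.
  exists (fun=> cst 0); split.
  - move=> m; exists setT, (cst 0); split => //; first exact: openT.
    by apply: tame_smooth; exact: tame_cst.
  - move=> m; split; last by rewrite n0.
      by rewrite setX0; exact: measurable_fun_set0.
    exists (fun=> 0); split; first by rewrite setX0; exact: measurable_fun_set0.
    exact: aeW.
  - by under eq_fun do rewrite n0; exact: cvg_cst.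
  - by under eq_fun do rewrite en0; rewrite en0; exact: cvg_cst.
have [x0 Bx0] := euclidean_ball_nonempty bB.
have [cQ sQ] := QQ'; have [cQ' sQ'] := Q'Om.
have QsQ' : B `*` I `<=` B' `*` I'.
  by move=> z Qz; apply: interior_subset; apply: sQ; exact: subset_closure.
have [B'x0 I't0] : (B' `*` I') (x0, t0) by apply: QsQ'; split.
have [cB' cI'] := cpt_contained_pair B'x0 I't0 Q'Om.
have Q'sub : B' `*` I' `<=` Om `*` `]0, T[.
  by move=> z Qz; apply: interior_subset; apply: sQ'; exact: subset_closure.
have mI : measurable (I : set (measurableTypeR R)) by exact: is_interval_measurable.
have mI' : measurable (I' : set (measurableTypeR R)) by exact: is_interval_measurable.
have mB' := euclidean_ball_measurable bB'.
have mQ' : measurable (B' `*` I' : set VT) by exact: measurableX.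
have ma : measurable_fun (B' `*` I' : set VT) a.
  have mO : measurable_fun [set: VT] (a \_ (Om `*` `]0, T[)).
    by have /sub_Lfun_mfun := aoo; rewrite inE.
  apply: (eq_measurable_fun (a \_ (Om `*` `]0, T[))) => [z /set_mem Qz|].
    by rewrite patchE mem_set//; exact: Q'sub.
  exact: measurable_funTS.
have a0' z : (B' `*` I') z -> 0 <= a z by move=> /Q'sub; exact: a0.
have [mw [G0 sG0] noo] := wloc I' B' iI' cI' (euclidean_ball_open bB') cB'.
have mwV : measurable_fun (B' `*` I' : set VT) w by exact: mw.
have sG := Dx_spec sG0.
have normoo : (\int[mu]_(z in B' `*` I') (`|w z| `^ p + enorm (Dx B' I' w z) `^ p)%:E < +oo)%E.
  move: noo; rewrite (LpW1p_norm_gradient p bB' mI' mwV sG); apply: lty_poweRy.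
  by rewrite invr_neq0// gt_eqF.
move: energyoo; rewrite (energy_gradient p q bB' mI' ma a0' sG) => energyoo.
have Qoo : (mu (B' `*` I') < +oo)%E.
  rewrite [ltLHS](_ : _ = (leb B' * lebesgue_measure (I' : set (measurableTypeR R)))%E); last exact: sprodE.
  have lB := lebesgue_rV_ball_lty bB'.
  have lI : (lebesgue_measure (I' : set (measurableTypeR R)) < +oo)%E.
    apply: (@le_lt_trans _ _ (lebesgue_measure (`]0, T[%classic : set (measurableTypeR R)))).
      apply: le_measure; rewrite ?inE//=.
      by move=> t It; have [_] := Q'sub (x0, t) (conj B'x0 It).
    by rewrite [ltLHS]lebesgue_measure_itv/=; case: ifP => _; rewrite -?EFinB ltry.
  by rewrite lte_mul_pinfty// ge0_fin_numE.
have [delta delta0 margin] := compact_open_margin cQ (@open_interior _ (B' `*` I')) sQ.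
have margin' z h : (B `*` I) z -> `|h| < delta -> (B' `*` I') (z + h).
  by move=> Qz hd; apply: interior_subset; apply: margin => //; exact: subset_closure.
have holder' (z y : V) : (B' `*` I') z -> (B' `*` I') y ->
    `|a z - a y| <= c * Num.max (enorm (z.1 - y.1) `^ alpha) (`|z.2 - y.2| `^ (alpha / 2)).
  by move=> /Q'sub + /Q'sub; case: z y => [x1 t1] [x2 t2] [/= O1 T1] [/= O2 T2]; exact: holder.
have [K [gam [K0 gl gb]]] := bound B B' I I' delta bB' iI' cB' cI' mI' ma a0' mwV sG Qoo
  delta0 margin' normoo energyoo.
exact: (smooth_approximation p1 pq alpha0 bB mI bB' mI' ma a0' mwV sG Qoo delta0 (ltW c0)
  margin' holder' normoo energyoo K0 gl gb).
Qed.

Lemma closure_pair_sub (S T : topologicalType) (A : set S) (B : set T) z :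
  closure (A `*` B) z -> closure A z.1 /\ closure B z.2.
Proof.
case: z => x t cz; split => P nP.
  have [|[y s] [[/= Ay _] Py]] := cz (fst @^-1` P); first exact: (cvg_fst (F := nbhs x) (G := nbhs t) nP).
  by exists y.
have [|[y s] [[/= _ Bs] Ps]] := cz (snd @^-1` P); first exact: (cvg_snd (F := nbhs x) (G := nbhs t) nP).
by exists s.
Qed.

(* [Linfty_loc] tests open sets only, whereas the time interval [J] need not be open. *)
Lemma Linfty_loc_bounded (Om B : set X) (T : R) (J : set R) (w : V -> R) :
  Linfty_loc (Om `*` `]0, T[) w -> open B -> cpt_contained B Om -> cpt_contained J `]0, T[ ->
  exists2 M : R, 0 <= M & {ae mu, forall z, (B `*` J) z -> `|w z| <= M}.
Proof.
move=> wloc oB [cB sB] [cJ sJ].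
have o0T : open (`]0, T[%classic : set R) by exact: interval_open.
have sJ' : closure J `<=` `]0, T[ by apply: subset_trans sJ _; exact: interior_subset.
have [d d0 Hd] := compact_open_margin cJ o0T sJ'.
(* An open enlargement of [J] by half the margin: each point of its closure is within d / 2 of a
   point of [J2], hence within [d] of [J]. *)
pose J2 : set R := \bigcup_(t in J) ball t (d / 2).
have d20 : 0 < d / 2 by rewrite divr_gt0.
have oJ2 : open J2 by apply: bigcup_open => t _; exact: ball_open.
have cJ2 : closure J2 `<=` `]0, T[.
  move=> s cs; have [u [[t Jt tu] su]] := cs _ (nbhsx_ballx s (d / 2) d20).
  have -> : s = t + (s - t) by rewrite addrC subrK.
  apply: Hd; first exact: subset_closure.
  rewrite (splitr d) (le_lt_trans (ler_distD u _ _))// ltrD//.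
  by rewrite distrC.
have kJ2 : compact (closure J2).
  apply: subclosed_compact (@closed_closure _ _) (@segment_compact _ 0 T) _.
  by apply: subset_trans cJ2 _ => s /=; rewrite !in_itv/= => /andP[/ltW-> /ltW->].
have oK : open (B `*` J2).
  rewrite (_ : B `*` J2 = (fst @^-1` B) `&` (snd @^-1` J2)); last by apply/seteqP; split => z [].
  by apply: openI; apply: open_comp => // z _; [exact: cvg_fst|exact: cvg_snd].
have cK : cpt_contained (B `*` J2) (Om `*` `]0, T[).
  split.
    apply: subclosed_compact (@closed_closure _ _) (compact_setX cB kJ2) _.
    by move=> z /closure_pair_sub.
  move=> [x t] /closure_pair_sub[/= /sB Ox /cJ2 Tt].
  exists (Om, `]0, T[%classic) => //; split => //=.
  by move: o0T => /(_ t Tt).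
have [M M0 HM] := Lfun_oo_bounded (wloc _ oK cK).
exists M => //; have {}HM : {ae mu, forall z, `|(w \_ (B `*` J2)) z| <= M} by exact: HM.
apply: aeS HM => z + [Bz Jz]; rewrite patchE mem_set//; split => //.
by exists z.2 => //; exact: ballxx.
Qed.

End cylinders.

(** * The three ranges of exponents *)

Theorem theorem1p3 (R : realType) (n : nat) (Om : set 'rV[R]_n)
    (T p q alpha : R) (a : 'rV[R]_n * R -> R)
    (n_ge2 : (2 <= n)%N)
    (Om_bounded : bounded_set Om) (Om_open : open Om)
    (T_gt0 : 0 < T)
    (p_ge2 : 2 <= p) (p_lt_q : p < q)
    (alpha_gt0 : 0 < alpha) (alpha_le1 : alpha <= 1)
    (a_ge0 : forall z, (Om `*` `]0, T[) z -> 0 <= a z)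
    (a_holder : parabolic_holder alpha Om T a) :
  [/\ (* (i) *)
      q <= p + p * alpha / (n%:R + 2) ->
      forall w : 'rV[R]_n * R -> R,
        LpW1p_loc p Om T w ->
        smoothly_approximable Om T p q a w,
      (* (ii) *)
      q <= p + Num.max (p * alpha / (n%:R + 2)) alpha ->
      forall w : 'rV[R]_n * R -> R,
        Linfty_loc (Om `*` `]0, T[) w -> LpW1p_loc p Om T w ->
        smoothly_approximable Om T p q a w &
      (* (iii) *)
      forall s : R, 2 <= s ->
      q <= p + Num.max (s * alpha / (n%:R + s)) (p * alpha / (n%:R + 2)) ->
      forall w : 'rV[R]_n * R -> R,
        CLs_loc s Om T w -> LpW1p_loc p Om T w ->
        smoothly_approximable Om T p q a w].
Proof.
have p1 : 1 <= p by lra.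
have p0 : 0 < p by lra.
have energy_case w : q <= p + p * alpha / (n%:R + 2) -> LpW1p_loc p Om T w ->
    smoothly_approximable Om T p q a w.
  move=> qp wloc; apply: (smoothly_approximable_of_bound p1 p_lt_q alpha_gt0 a_ge0 a_holder wloc).
  move=> B B' I I' delta G Q Q' bB' iI' cB' cI' mI' ma a0 mw sG Qoo delta0 margin noo eoo.
  have [K K0 HK] := mollified_grad_bound_energy B I p1 bB' mI' ma a0 mw sG Qoo delta0 noo eoo.
  (* With this exponent the condition gam (q - p) <= alpha is the assumed bound on [q] multiplied
     out. *)
  exists K, ((n%:R + 2) / p); split => //.
  have n2 : 0 < n%:R + 2 :> R by rewrite ltr_wpDl.
  have h : (q - p) * (n%:R + 2) <= p * alpha by rewrite -ler_pdivlMr// lerBlDl.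
  by rewrite mulrAC ler_pdivrMr// mulrC (mulrC alpha).
split => [qp w|qp w wb wloc|s s2 qp w wc wloc]; first exact: energy_case.
  (* If the first term of the maximum already bounds [q], the case of finite energy applies;
     otherwise the bound must come from the term [alpha]. *)
  have [/(energy_case w)|h] := leP q (p + p * alpha / (n%:R + 2)); first exact.
  have qpa : q - p <= alpha.
    by move: qp; rewrite addr_maxr le_max leNgt h /= lerBlDl.
  apply: (smoothly_approximable_of_bound p1 p_lt_q alpha_gt0 a_ge0 a_holder wloc).
  move=> B B' I I' delta G Q Q' bB' iI' cB' cI' mI' ma a0 mw sG Qoo delta0 margin noo eoo.
  have [M M0 HM] := Linfty_loc_bounded wb (euclidean_ball_open bB') cB' cI'.
  have HL := slice_bound_bounded B I p1 bB' mI' mw sG Qoo delta0 noo M0 HM.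
  have Lam0 : 0 <= M * 2 ^+ n by rewrite mulr_ge0// exprn_ge0.
  have [K K0 HK] := mollified_grad_bound_slices p1 bB' mI' mw sG Qoo delta0 margin noo Lam0 HL.
  by exists K, (1 + 0); split => //; rewrite addr0 mul1r.
have [/(energy_case w)|h] := leP q (p + p * alpha / (n%:R + 2)); first exact.
have s1 : 1 <= s by lra.
have s0 : 0 < s by lra.
have ns0 : 0 < n%:R + s by rewrite ltr_wpDl.
have qps : (q - p) * (n%:R + s) <= s * alpha.
  rewrite -ler_pdivlMr// lerBlDl.
  by move: qp; rewrite addr_maxr le_max (leNgt q (p + p * alpha / _)) h orbF.
apply: (smoothly_approximable_of_bound p1 p_lt_q alpha_gt0 a_ge0 a_holder wloc).
move=> B B' I I' delta G Q Q' bB' iI' cB' cI' mI' ma a0 mw sG Qoo delta0 margin noo eoo.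
have [Lam Lam0 HLam] := CLs_loc_bounded s1 wc (euclidean_ball_open bB') cB' iI' cI'.
have HL := slice_bound_Ls B I p1 bB' mI' mw sG Qoo delta0 noo s1 Lam0 HLam.
have Lam'0 : 0 <= 2 ^+ n + Lam by rewrite addr_ge0// exprn_ge0.
have [K K0 HK] := mollified_grad_bound_slices p1 bB' mI' mw sG Qoo delta0 margin noo Lam'0 HL.
(* Since 1 + n/s = (n + s)/s, the condition on [gam] is [qps] divided by [s]. *)
exists K, (1 + n%:R / s); split => //.
have -> : 1 + n%:R / s = (n%:R + s) / s by field; rewrite gt_eqF.
by rewrite mulrAC ler_pdivrMr// mulrC (mulrC alpha).
Qed.
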